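(* Let $n\ge1$, let $(B_t)$ be a standard Brownian motion on $\mathbb{R}^n$, let $\alpha>1$, set $f_\alpha(t)=\frac{1}{(1-t)^\alpha}$ for $t\in[0,1)$, and let $(y^\alpha_t)$ be the solution of the stochastic differential equation $$dy_t=dB_t-f_\alpha(t)\,y_t\,dt,\qquad y_0=0,\quad t<1.$$ Then $(y^\alpha_t)$ is a generalised Brownian bridge from $0$ to $0$ with terminal time $1$. Its probability distribution on the loop space $C_{0,0}([0,1];\mathbb{R}^n)$ is singular with respect to the classical Brownian bridge measure on $C_{0,0}([0,1];\mathbb{R}^n)$, and these two Gaussian measures have different Cameron-Martin spaces.
   Context: $C_{0,0}([0,1];\mathbb{R}^n)$ is the space of continuous paths $\sigma:[0,1]\to\mathbb{R}^n$ with $\sigma(0)=\sigma(1)=0$, with the supremum norm. A generalised Brownian bridge from $0$ to $0$ in $\mathbb{R}^n$ with terminal time $1$ is a stochastic process $(z_t,t\in[0,1])$ with $z_0=0$ such that (1) $(z_t,t\in[0,1))$ is a Markov process with (time-dependent) infinitesimal generator $\frac12\Delta-f(t)\,x\cdot\nabla$, i.e. $\frac12\Delta-f(t)\nabla(\frac{|x|^2}{2})$, where $f$ is a suitably smooth real valued function on $[0,1)$ with $\lim_{t\to1}f(t)=\infty$; and (2) $\lim_{t\to 1}z_t=0$ almost surely. The process is extended to $t=1$ by $y^\alpha_1=0$. The classical Brownian bridge measure is the law on $C_{0,0}([0,1];\mathbb{R}^n)$ of the solution of $dz_t=dB_t-\frac{z_t}{1-t}dt$, $z_0=0$ (with $z_1=0$).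 The Cameron-Martin space of a centred Gaussian measure $\mu$ on a separable Banach space $E$ is the set of $h\in E$ for which $\sup\{|\ell(h)|:\ell\in E^*,\ \|\ell\|_{L^2(\mu)}\le 1\}<\infty$; for the Brownian bridge measure it is $H_{0,0}=\{h:[0,1]\to\mathbb{R}^n \text{ absolutely continuous}: \dot h\in L^2([0,1];\mathbb{R}^n),\ h(0)=h(1)=0\}$. *)

(* Defs.v *)
From HB Require Import structures.
From mathcomp Require Import all_boot all_order all_algebra.
From mathcomp Require Import all_classical all_reals all_analysis.

Set Implicit Arguments.
Unset Strict Implicit.
Unset Printing Implicit Defensive.

Import Order.TTheory GRing.Theory Num.Theory.
Import numFieldNormedType.Exports.

Local Open Scope classical_set_scope.
Local Open Scope ring_scope.

Definition borelType (T : ptopologicalType) := g_sigma_algebraType (@open T).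
HB.instance Definition _ (T : ptopologicalType) := Measurable.on (borelType T).

(* C_{0,0}([0,1]; R^n).  A path is represented by its extension by 0 to the
   whole line, so that two paths are equal iff they agree on [0, 1]. *)
Definition is_loop (R : realType) (n : nat) : {pred R -> 'rV[R]_n} :=
  mem [set f : R -> 'rV[R]_n |
    [/\ {within `[0, 1], continuous f}, f 0 = 0, f 1 = 0 &
        forall t : R, t \notin `[0, 1] -> f t = 0]].
Arguments is_loop : clear implicits.

Definition loopSpace (R : realType) (n : nat) := {f | f \in is_loop R n}.

Section loop_lmodule.
Variables (R : realType) (n : nat).

Lemma is_loop_submod_closed : submod_closed (is_loop R n).
Proof.
split; first by apply/mem_set; split => // x; apply: cvg_cst.
move=> a f g /set_mem[cf f0 f1 fo] /set_mem[cg g0 g1 go].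
apply/mem_set; split.
- by move=> x; apply: cvgD; [apply: cvgZr; exact: cf|exact: cg].
- by rewrite -[LHS]/(a *: f 0 + g 0) f0 g0 scaler0 addr0.
- by rewrite -[LHS]/(a *: f 1 + g 1) f1 g1 scaler0 addr0.
- by move=> t t01; rewrite -[LHS]/(a *: f t + g t) fo// go// scaler0 addr0.
Qed.

HB.instance Definition _ := GRing.isSubmodClosed.Build _ _ (is_loop R n)
  is_loop_submod_closed.

HB.instance Definition _ :=
  SubType.copy (loopSpace R n) {f | f \in is_loop R n}.
HB.instance Definition _ :=
  Choice.copy (loopSpace R n) {f | f \in is_loop R n}.
HB.instance Definition _ := [SubChoice_isSubLmodule of loopSpace R n by <:].

End loop_lmodule.

(* The supremum norm on C_{0,0}.  R^n carries the max norm of the library, which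
   is equivalent to the Euclidean one: the Borel sets and the dual, hence the
   Cameron-Martin spaces, are the same for both. *)
Section loop_norm.
Variables (R : realType) (n : nat).
Implicit Types f g : loopSpace R n.

Definition loop_norm f : R := sup [set `|val f t| | t in `[0, 1]].

Lemma loop_has_sup f : has_sup [set `|val f t| | t in `[0, 1]].
Proof.
have [cf _ _ _] := set_mem (valP f).
apply: compact_has_sup.
  by exists `|val f 0|, 0 => //=; rewrite in_itv /= lexx ler01.
apply: continuous_compact; last exact: segment_compact.
by move=> x; apply: cvg_norm; exact: cf.
Qed.

Lemma loop_norm_ub f t : `|val f t| <= loop_norm f.
Proof.
have [_ ubf] := loop_has_sup f.
have f_in s : s \in `[0, 1] -> `|val f s| <= loop_norm f.
  by move=> s01; apply: ub_le_sup => //; exists s.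
have [/f_in//|t01] := boolP (t \in `[0, 1]).
have [_ f0 _ /(_ t t01) ->] := set_mem (valP f).
by rewrite -f0; apply: f_in; rewrite in_itv /= lexx ler01.
Qed.

Lemma loop_norm_le f c : (forall t, `|val f t| <= c) -> loop_norm f <= c.
Proof.
by move=> fc; apply: ge_sup; [case: (loop_has_sup f)|move=> _ [t _ <-]].
Qed.

Lemma loop_norm_ge0 f : 0 <= loop_norm f.
Proof. exact: le_trans (loop_norm_ub f 0). Qed.

Lemma ler_loop_normD f g : loop_norm (f + g) <= loop_norm f + loop_norm g.
Proof.
apply: loop_norm_le => t.
apply: le_trans (lerD (loop_norm_ub f t) (loop_norm_ub g t)).
exact: ler_normD.
Qed.

Lemma loop_normZ (a : R) f : loop_norm (a *: f) = `|a| * loop_norm f.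
Proof.
have le_Z b g : loop_norm (b *: g) <= `|b| * loop_norm g.
  apply: loop_norm_le => t; rewrite -[X in `|X|]/(b *: val g t) normrZ.
  by rewrite ler_wpM2l// loop_norm_ub.
apply/eqP; rewrite eq_le le_Z /=; have [->|a0] := eqVneq a 0.
  by rewrite normr0 mul0r loop_norm_ge0.
rewrite -ler_pdivlMl ?normr_gt0// -normfV.
by rewrite -[f in leLHS](scalerK a0) le_Z.
Qed.

Lemma loop_norm_eq0 f : loop_norm f = 0 -> f = 0.
Proof.
move=> f0; apply/val_inj/funext => t.
by apply/normr0_eq0/eqP; rewrite eq_le normr_ge0 andbT -f0 loop_norm_ub.
Qed.

HB.instance Definition _ := Lmodule_isNormed.Build R (loopSpace R n)
  ler_loop_normD loop_normZ loop_norm_eq0.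

End loop_norm.

Section gaussian_measures.
Variables (R : realType) (E : normedModType R).
Implicit Types mu nu : probability (borelType E) R.

(* The centred normal law with standard deviation s; normal_prob is not the
   Dirac mass when s = 0. *)
Definition centred_normal (s : R) : set R -> \bar R :=
  if s == 0 then \d_(0 : R) else normal_prob 0 s.

Definition centred_gaussian mu : Prop :=
  forall l : {linear E -> R^o}, continuous l ->
    exists s : R, 0 <= s /\
      forall A : set R, measurable A -> mu (l @^-1` A) = centred_normal s A.

Definition cameron_martin_space mu : set E :=
  [set h | (ereal_sup [set `|l h|%:E | l in
              [set l : {linear E -> R^o} |
                continuous l /\ ('N[mu]_2%:E [EFin \o l] <= 1)%E]] < +oo)%E].

End gaussian_measures.

Definition mutually_singular d (T : measurableType d) (R : realType)
    (mu nu : set T -> \bar R) : Prop :=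
  exists A : set T, [/\ measurable A, mu A = 0%E & nu (~` A) = 0%E].

Section processes.
Variables (R : realType) (n : nat).
Variables (d : measure_display) (Omega : measurableType d).
Variable P : probability Omega R.

(* A process is a family indexed by all of R; only its values at the times
   mentioned in the definitions below (in [0, +oo[, [0, 1[ or [0, 1]) matter. *)
Implicit Types B y z : R -> Omega -> 'rV[R]_n.

Definition mutually_independent (I : finType) (X : I -> Omega -> R) : Prop :=
  forall A : I -> set R, (forall i, measurable (A i)) ->
    P (\bigcap_(i in [set: I]) (X i @^-1` A i)) =
    (\prod_(i : I) P (X i @^-1` A i))%E.

(* The family in bm_indep runs over both time steps and coordinates: it
   expresses independence of the increments and of the components at once. *)
Record brownian_motion B : Prop := {
  bm_measurable : forall t : R, 0 <= t ->
    measurable_fun [set: Omega] (B t : Omega -> borelType 'rV[R]_n);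
  bm_start : {ae P, forall w, B 0 w = 0};
  bm_normal : forall (s t : R) (i : 'I_n) (A : set R),
    0 <= s < t -> measurable A ->
    P [set w | A ((B t w - B s w) 0 i)] = normal_prob 0 (Num.sqrt (t - s)) A;
  bm_indep : forall (m : nat) (t : nat -> R), 0 <= t 0 ->
    (forall k, (k < m)%N -> t k < t k.+1) ->
    mutually_independent (fun ki : 'I_m * 'I_n =>
      fun w => (B (t ki.1.+1) w - B (t ki.1) w) 0 ki.2);
  bm_continuous : {ae P, forall w, {within `[0, +oo[, continuous (B ^~ w)}}
}.

(* dy_t = dB_t - f(t) y_t dt on [0, 1[ with y_0 = 0.  The noise is additive, so
   the integral form of the equation makes sense path by path. *)
Record sde_solution B (f : R -> R) y : Prop := {
  sde_measurable : forall t : R, 0 <= t < 1 ->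
    measurable_fun [set: Omega] (y t : Omega -> borelType 'rV[R]_n);
  sde_start : {ae P, forall w, y 0 w = 0};
  sde_continuous : {ae P, forall w, {within `[0, 1[, continuous (y ^~ w)}};
  sde_equation : {ae P, forall w, forall (t : R) (i : 'I_n), 0 <= t < 1 ->
    y t w 0 i =
      B t w 0 i - \int[lebesgue_measure]_(s in `[0, t]) (f s * y s w 0 i)}
}.

Definition extend_at_1 y : R -> Omega -> 'rV[R]_n :=
  fun t w => if t < 1 then y t w else 0.

(* The sigma-algebra generated by (z_r, 0 <= r <= s). *)
Definition natural_filtration z (s : R) : set (set Omega) :=
  <<s [set G | exists (r : R) (A : set (borelType 'rV[R]_n)),
         [/\ 0 <= r <= s, measurable A & G = z r @^-1` A]] >>.

Definition partial (i : 'I_n) (phi : 'rV[R]_n -> R) : 'rV[R]_n -> R :=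
  fun x => 'D_(delta_mx 0 i) phi x.

Record C2_compact_support (phi : 'rV[R]_n -> R) : Prop := {
  c2_support : exists M : R, forall x, M < `|x| -> phi x = 0;
  c2_continuous : continuous phi;
  c2_derivable : forall i x, derivable phi x (delta_mx 0 i);
  c2_continuous1 : forall i, continuous (partial i phi);
  c2_derivable2 : forall i j x, derivable (partial i phi) x (delta_mx 0 j);
  c2_continuous2 : forall i j, continuous (partial j (partial i phi))
}.

(* (1/2) Delta phi (x) - f(t) x . grad phi (x) *)
Definition bridge_generator (f : R -> R) (t : R) (phi : 'rV[R]_n -> R)
    (x : 'rV[R]_n) : R :=
  2^-1 * (\sum_i partial i (partial i phi) x)
  - f t * (\sum_i x 0 i * partial i phi x).

Definition transition_family :=
  R -> R -> R.-pker (borelType 'rV[R]_n) ~> (borelType 'rV[R]_n).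

Definition chapman_kolmogorov (K : transition_family) : Prop :=
  (forall (t : R) x (A : set (borelType 'rV[R]_n)),
     0 <= t < 1 -> measurable A ->
     K t t x A = \d_x A) /\
  (forall (s t u : R) x (A : set (borelType 'rV[R]_n)),
     0 <= s -> s <= t -> t <= u -> u < 1 -> measurable A ->
     K s u x A = (\int[K s t x]_v K t u v A)%E).

(* P(z_t \in A | F_s) = K_{s,t}(z_s, A) a.s. *)
Definition markov_property (K : transition_family) z : Prop :=
  forall (s t : R) (A : set (borelType 'rV[R]_n)) (G : set Omega),
    0 <= s -> s <= t -> t < 1 -> measurable A -> natural_filtration z s G ->
    P (G `&` z t @^-1` A) = (\int[P]_(w in G) K s t (z s w) A)%E.

(* The difference quotients converge in the supremum norm. *)
Definition has_generator (K : transition_family)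
    (L : R -> ('rV[R]_n -> R) -> 'rV[R]_n -> R) : Prop :=
  forall (t : R) phi, 0 <= t < 1 -> C2_compact_support phi ->
    forall e : R, 0 < e -> \forall h \near 0^'+, forall x : 'rV[R]_n,
      `| (\int[K t (t + h) x]_v phi v - phi x) / h - L t phi x | <= e.

Definition markov_with_generator z L : Prop :=
  exists K : transition_family,
    [/\ chapman_kolmogorov K, markov_property K z & has_generator K L].

(* Derivatives are two-sided: at 0 this refers to an extension of f to the left
   of 0. *)
Definition smooth_before_1 (f : R -> R) : Prop :=
  forall (k : nat) (t : R), 0 <= t < 1 ->
    \forall s \near t, derivable (derive1n k f) s 1.

Record generalised_brownian_bridge (f : R -> R) z : Prop := {
  gbb_measurable : forall t : R, 0 <= t <= 1 ->
    measurable_fun [set: Omega] (z t : Omega -> borelType 'rV[R]_n);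
  gbb_start : {ae P, forall w, z 0 w = 0};
  gbb_smooth : smooth_before_1 f;
  gbb_blowup : f t @[t --> 1^'-] --> +oo;
  gbb_markov : markov_with_generator z (bridge_generator f);
  gbb_end : {ae P, forall w, z t w @[t --> 1^'-] --> (0 : 'rV[R]_n)}
}.

(* mu is the law of (z_t, 0 <= t <= 1) on C_{0,0}([0,1]; R^n): up to a null set
   the paths of z are those of a C_{0,0}-valued random variable of law mu. *)
Definition loop_law z (mu : probability (borelType (loopSpace R n)) R) : Prop :=
  exists Z : Omega -> borelType (loopSpace R n),
    [/\ measurable_fun [set: Omega] Z,
        {ae P, forall w, forall t : R, 0 <= t <= 1 ->
           val (Z w : loopSpace R n) t = z t w} &
        forall A : set (borelType (loopSpace R n)), measurable A ->
          mu A = P (Z @^-1` A)].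

End processes.

Definition f_ (R : realType) (alpha : R) : R -> R :=
  fun t => ((1 - t) `^ alpha)^-1.

Definition classical_brownian_bridge_measure (R : realType) (n : nat)
    (nu : probability (borelType (loopSpace R n)) R) : Prop :=
  exists (d : measure_display) (Omega : measurableType d)
         (P : probability Omega R) (B z : R -> Omega -> 'rV[R]_n),
    [/\ brownian_motion P B, sde_solution P B (fun t => (1 - t)^-1) z &
        loop_law P (extend_at_1 z) nu].

(* Main.v *)
(* If E is an integrating factor, E' = f E, then M = E y satisfies dM = E dB.
   Its increments are limits of Riemann sums of Brownian increments, so they
   are centred Gaussian, independent of the past, with the clock q, q' = E^2.
   Hence y_t = E(t)^-1 (E(s) y_s + (M_t - M_s)) is Markov with an explicit
   Gaussian kernel, whose generator comes from second order Taylor expansion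
   and the moments of Gaussian variables.

   Each coordinate of y_t has variance q(t) / E(t)^2.  For f_alpha this is
   O((1 - t)^alpha), whereas the classical bridge has variance t (1 - t).  The
   ratio tends to 0 as t -> 1, and a sequence of evaluations separates the two
   laws.

   For 1/2 < b < min(1, alpha/2) put h(t) = ((1 - t)^b - (1 - t)) e_0.  It lies
   in the Cameron-Martin space of the classical bridge, but not in that of the
   law of y, because |h(t)| is not bounded by a multiple of the standard
   deviation of y_t. *)

From HB Require Import structures.
Require Import Defs.
From mathcomp Require Import all_boot all_order all_algebra.
From mathcomp Require Import all_classical all_reals all_analysis.
From mathcomp Require Import measurable_realfun ring lra.
Set Implicit Arguments.
Unset Strict Implicit.
Unset Printing Implicit Defensive.
Import Order.TTheory GRing.Theory Num.Theory.
Import numFieldNormedType.Exports.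
Local Open Scope classical_set_scope.
Local Open Scope ring_scope.

(** * Gaussian random variables *)

(** No stochastic integral occurs. The noise is additive, so on a fixed path the increment of [E y]
    is a limit of left-point Riemann sums of [B]; along the path only [E] and the drift integral are
    differentiated. These limits hold almost surely while the filtration is not completed, so
    independence is proved for measurable versions of the limits and carried over through null sets.
    Gaussian laws pass to such limits without characteristic functions: E exp(-X^2) = (1 + 2
    s^2)^(-1/2) determines s^2 and converges by bounded convergence. The generator has to converge
    uniformly in x. Compact support gives the uniformity, and a modulus of continuity of the form
    eta + C |z|^2 reduces the Taylor error to second and fourth moments. Functionals on the loop
    space are not represented by measures: interpolation on a grid makes them limits of finite
    combinations of evaluations, which gives Gaussianity, the variance and the bound for
    Cameron-Martin membership. The bounds on b have three origins: 1/2 makes the energy finite,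
    alpha/2 comes from the deviation of y_t, and 1 lets (1 - t)^b dominate 1 - t. *)

Section law.
Context d1 d2 d3 (T1 : measurableType d1) (T2 : measurableType d2)
  (U : measurableType d3) (R : realType).
Variables (P1 : {measure set T1 -> \bar R}) (P2 : {measure set T2 -> \bar R}).

Lemma ge0_integral_law (X1 : T1 -> U) (X2 : T2 -> U) (phi : U -> \bar R) :
  measurable_fun setT X1 -> measurable_fun setT X2 ->
  (forall A, measurable A -> P1 (X1 @^-1` A) = P2 (X2 @^-1` A)) ->
  measurable_fun setT phi -> (forall u, 0 <= phi u)%E ->
  (\int[P1]_x phi (X1 x) = \int[P2]_x phi (X2 x))%E.
Proof.
move=> mX1 mX2 E mphi phi0.
transitivity (\int[pushforward P1 X1]_x phi x)%E.
  by rewrite ge0_integral_pushforward// => u _; exact: phi0.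
transitivity (\int[pushforward P2 X2]_x phi x)%E; last first.
  by rewrite ge0_integral_pushforward// => u _; exact: phi0.
by apply: eq_measure_integral => A mA _; exact: E.
Qed.

End law.

Lemma cvg_integral_bounded d (T : measurableType d) (R : realType)
    (P : probability T R) (f_ : (T -> R)^nat) (f : T -> R) (C : R) :
  (forall n, measurable_fun setT (f_ n)) -> measurable_fun setT f ->
  {ae P, forall x, f_ ^~ x @ \oo --> f x} ->
  (forall n x, `|f_ n x| <= C) ->
  (\int[P]_x (f_ n x)%:E @[n --> \oo] --> \int[P]_x (f x)%:E)%E.
Proof.
move=> mf_ mf cvf fC.
have [|||||//] := @dominated_convergence _ _ _ P setT measurableT
  (fun n x => (f_ n x)%:E) (EFin \o f) (cst C%:E).
- by move=> n; exact/measurable_EFinP.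
- exact/measurable_EFinP.
- apply: filterS cvf => x cx _; apply: (cvg_comp _ EFin cx) => //.
- exact: finite_measure_integrable_cst.
- by apply/aeW => x n _; rewrite lee_fin.
Qed.

Section has_mean.
Context d (T : measurableType d) (R : realType) (P : probability T R).
Implicit Types X Y : T -> R.

(** Integrability is bundled with the value, so that means of linear combinations can be computed
    without side conditions. *)
Definition has_mean X (m : R) : Prop :=
  P.-integrable setT (EFin \o X) /\ (\int[P]_w (X w)%:E = m%:E)%E.

Lemma has_meanD X Y m p : has_mean X m -> has_mean Y p ->
  has_mean (fun w => X w + Y w) (m + p).
Proof.
move=> [iX eX] [iY eY]; split.
  by apply: eq_integrable (integrableD measurableT iX iY) => // w _.
by rewrite integralD_EFin// eX eY.
Qed.

Lemma has_meanZ c X m : has_mean X m -> has_mean (fun w => c * X w) (c * m).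
Proof.
move=> [iX eX]; split; first exact: (integrableZl _ c iX).
by under eq_integral do rewrite EFinM; rewrite integralZl// eX.
Qed.

Lemma has_meanN X m : has_mean X m -> has_mean (fun w => - X w) (- m).
Proof.
move=> /(has_meanZ (-1)); rewrite mulN1r; congr (has_mean _ _).
by apply/funext => w; rewrite mulN1r.
Qed.

Lemma has_mean_cst c : has_mean (cst c) c.
Proof.
split; first exact: finite_measure_integrable_cst.
by rewrite -[LHS]/(\int[P]_w (cst c%:E w))%E integral_cst//; rewrite [X in (_ * X)%E](_ : _ = 1%E) ?mule1//; exact: probability_setT.
Qed.

Lemma has_mean_sum (I : Type) (r : seq I) (X : I -> T -> R) (m : I -> R) :
  (forall i, has_mean (X i) (m i)) ->
  has_mean (fun w => \sum_(i <- r) X i w) (\sum_(i <- r) m i).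
Proof.
move=> h; elim: r => [|i r IH].
  rewrite big_nil; under eq_fun do rewrite big_nil; exact: has_mean_cst.
by rewrite big_cons; under eq_fun do rewrite big_cons; exact: has_meanD.
Qed.

Lemma has_mean_le X Y m p : has_mean X m -> has_mean Y p ->
  (forall w, X w <= Y w) -> m <= p.
Proof.
move=> [iX eX] [iY eY] XY; rewrite -lee_fin -eX -eY.
by apply: le_integral => // w _; rewrite lee_fin.
Qed.

Lemma ge0_has_mean X m : measurable_fun setT X -> (forall w, 0 <= X w) ->
  (\int[P]_w (X w)%:E = m%:E)%E -> has_mean X m.
Proof.
move=> mX X0 eX; split => //; apply/integrableP; split; first exact/measurable_EFinP.
by under eq_integral do rewrite /= ger0_norm//; rewrite eX ltry.
Qed.

Lemma dominated_has_mean X Y p : measurable_fun setT X -> has_mean Y p ->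
  (forall w, `|X w| <= Y w) -> exists m, has_mean X m.
Proof.
move=> mX [iY eY] XY; exists (fine (\int[P]_w (X w)%:E)%E).
have iX : P.-integrable setT (EFin \o X).
  apply: (le_integrable _ _ _ iY) => //; first exact/measurable_EFinP.
  by move=> w _; rewrite /= lee_fin (le_trans (XY w))// ler_norm.
split => //; rewrite fineK//.
exact: (integrable_fin_num _ iX).
Qed.

Lemma bounded_has_mean X C : measurable_fun setT X -> (forall w, `|X w| <= C) ->
  exists m, has_mean X m.
Proof. by move=> mX XC; exact: dominated_has_mean (has_mean_cst C) XC. Qed.

End has_mean.

(** * Continuous test functions determine a law *)

Section ramp.
Context {R : realType}.
Implicit Types a x : R.

Definition ramp (n : nat) a x : R := Num.min 1 (Num.max 0 (n%:R * (x - a))).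

Lemma continuous_ramp n a : continuous (ramp n a).
Proof.
move=> x; apply: (@continuous_min _ _ (cst 1) (fun y => Num.max 0 (n%:R * (y - a)))).
  exact: cvg_cst.
apply: (@continuous_max _ _ (cst 0) (fun y => n%:R * (y - a))); first exact: cvg_cst.
by apply: cvgM; [exact: cvg_cst|apply: cvgB; [exact: cvg_id|exact: cvg_cst]].
Qed.

Lemma ramp01 n a x : 0 <= ramp n a x <= 1.
Proof. by rewrite /ramp le_min ler01 ge_min lexx le_max lexx. Qed.

Lemma cvg_ramp a x : ramp n a x @[n --> \oo] --> (\1_`]a, +oo[ x : R).
Proof.
rewrite indicE mem_setE in_itv/= andbT.
have [ax|xa] := ltP a x.
  apply: cvg_near_cst; exists (Num.truncn (x - a)^-1).+1 => // n /= Hn.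
  apply/eqP; rewrite /ramp eq_le ge_min lexx/= le_min lexx/= le_max.
  apply/orP; right; rewrite -ler_pdivrMr ?subr_gt0// mul1r.
  rewrite ltW//; apply: lt_le_trans (truncnS_gt _) _.
  by rewrite ler_nat.
apply: cvg_near_cst; near=> n; apply/eqP.
rewrite /ramp max_l ?min_r// ?ler01//.
by rewrite mulr_ge0_le0// subr_le0.
Unshelve. all: by end_near. Qed.

End ramp.

(** Ramps converge to indicators of open half-lines, which generate the Borel sets and are stable
    under intersection. Bounded continuous test functions suit the substitutions and the limits in
    law made below. *)
Lemma law_eq_continuous d1 d2 (T1 : measurableType d1) (T2 : measurableType d2)
    (R : realType) (P1 : probability T1 R) (P2 : probability T2 R)
    (X1 : T1 -> R) (X2 : T2 -> R) :
  measurable_fun setT X1 -> measurable_fun setT X2 ->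
  (forall phi : R -> R, continuous phi -> (forall x, 0 <= phi x <= 1)%R ->
    \int[P1]_x (phi (X1 x))%:E = \int[P2]_x (phi (X2 x))%:E)%E ->
  forall A, measurable A -> P1 (X1 @^-1` A) = P2 (X2 @^-1` A).
Proof.
move=> mX1 mX2 E.
have key d (T : measurableType d) (P : probability T R) (X : T -> R) a :
    measurable_fun setT X ->
    (\int[P]_x (ramp n a (X x))%:E @[n --> \oo] --> P (X @^-1` `]a, +oo[))%E.
  move=> mX.
  have mXa : measurable (X @^-1` `]a, +oo[).
    by rewrite -[_ @^-1` _]setTI; exact: mX.
  have -> : (P (X @^-1` `]a, +oo[) = \int[P]_x (\1_(`]a, +oo[) (X x))%:E)%E.
    rewrite -[X @^-1` _ in LHS]setIT -integral_indic//; exact: eq_integral.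
  apply: (@cvg_integral_bounded _ _ _ _ _ _ 1).
  - move=> n; apply: measurableT_comp => //.
    by apply: continuous_measurable_fun; exact: continuous_ramp.
  - exact: measurableT_comp.
  - by apply/aeW => x; exact: cvg_ramp.
  - by move=> n x; rewrite ger0_norm; case/andP: (ramp01 n a (X x)).
pose Q1 : {measure set R -> \bar R} := measure_function_pushforward__canonical__measure_function_Measure P1 mX1.
pose Q2 : {measure set R -> \bar R} := measure_function_pushforward__canonical__measure_function_Measure P2 mX2.
have EQ A : measurable A -> Q1 A = Q2 A.
  apply: (@measure_unique _ _ _ (@RGenOInfty.G R) (fun k => `](- k%:R), +oo[%classic)).
  - exact: RGenOInfty.measurableE.
  - move=> _ _ [x ->] [y ->]; exists (Num.max x y).
    by rewrite predeqE => z /=; rewrite !in_itv/= !andbT gt_max; split => [[-> ->]//|/andP[]].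
  - by move=> i; exists (- i%:R).
  - rewrite -subTset => x _; exists (Num.truncn `|x|).+1 => //=.
    rewrite in_itv/= andbT ltrNl (le_lt_trans _ (truncnS_gt _))//.
    by rewrite -normrN ler_norm.
  - move=> _ [a ->]; have h1 := key _ _ P1 X1 a mX1; have h2 := key _ _ P2 X2 a mX2.
    apply: (cvg_unique _ h1) => //.
    move: h2; apply: cvg_trans; apply: near_eq_cvg; near=> n.
    rewrite -E//; [exact: continuous_ramp|exact: ramp01].
  - move=> k; apply: (@le_lt_trans _ _ 1%E); last exact: ltry.
    apply: probability_le1; rewrite -[X in measurable X]setTI.
    exact: (mX1 measurableT _ (measurable_itv _)).
exact: EQ.
Unshelve. all: by end_near. Qed.

(** * The standard normal law: scaling, moments, limits, tails *)

Section standard_normal.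
Context {R : realType}.
Local Notation leb := (@lebesgue_measure R).
Import HBNNSimple.

(** Comparing integrals over all measurable sets shows that the density agrees almost everywhere
    with the Radon-Nikodym derivative, for which the change of measure is known. *)
Lemma ge0_integral_normal_prob (m s : R) (f : measurableTypeR R -> \bar R) :
  measurable_fun setT f -> (forall x, 0 <= f x)%E ->
  (\int[normal_prob m s]_x f x = \int[leb]_x (f x * (normal_pdf m s x)%:E))%E.
Proof.
move=> mf f0.
have dom : normal_prob m s `<< leb by exact: normal_prob_dominates.
rewrite -(Radon_Nikodym_SigmaFinite.change_of_variables dom f0 measurableT mf).
have mp : measurable_fun setT (fun x => (normal_pdf m s x)%:E).
  by apply/measurable_EFinP; exact: measurable_normal_pdf.
have mRN := measurable_int _ (Radon_Nikodym_SigmaFinite.f_integrable dom).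
apply: ae_eq_integral => //; [exact: emeasurable_funM|exact: emeasurable_funM|].
apply: ae_eqe_mul2l; apply: integral_ae_eq => //.
  exact: Radon_Nikodym_SigmaFinite.f_integrable.
by move=> A _ mA; rewrite -Radon_Nikodym_SigmaFinite.f_integral.
Qed.

(** The same set function as [normal_prob], retyped over [R] instead of [measurableTypeR R], so that
    it is a probability on the type in which the random variables take their values. *)
Definition gauss (s : R) : set R -> \bar R := normal_prob 0 s.

HB.instance Definition _ (s : R) := isMeasure.Build _ R R (gauss s)
  (measure0 (normal_prob 0 s)) (measure_ge0 (normal_prob 0 s))
  (@measure_semi_sigma_additive _ _ _ (normal_prob 0 s)).

Lemma gauss_setT (s : R) : gauss s setT = 1%E.
Proof. exact: (@probability_setT _ _ _ (normal_prob 0 s)). Qed.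

HB.instance Definition _ (s : R) := Measure_isProbability.Build _ R R (gauss s)
  (gauss_setT s).

Lemma ge0_integral_gauss (s : R) (f : R -> \bar R) :
  measurable_fun setT f -> (forall x, 0 <= f x)%E ->
  (\int[gauss s]_x f x = \int[leb]_x (f x * (normal_pdf 0 s x)%:E))%E.
Proof.
move=> mf f0; rewrite -ge0_integral_normal_prob//.
have mid : measurable_fun setT (fun x : measurableTypeR R => x : R).
  exact: measurable_id.
exact: (@ge0_integral_pushforward _ _ _ _ _ _ mid (normal_prob 0 s) setT).
Qed.

(** [X] is distributed as [s] times a standard normal variable. This form covers the Dirac mass at
    [s = 0] and negative [s] without case distinction. *)
Definition gaussian d (T : measurableType d) (P : probability T R)
    (X : T -> R) (s : R) :=
  forall A : set R, measurable A -> P (X @^-1` A) = gauss 1 ((fun x => s * x) @^-1` A).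

Lemma gaussian_integral d (T : measurableType d) (P : probability T R)
    (X : T -> R) (s : R) (phi : R -> \bar R) :
  measurable_fun setT X -> gaussian P X s ->
  measurable_fun setT phi -> (forall x, 0 <= phi x)%E ->
  (\int[P]_w phi (X w) = \int[gauss 1]_x phi (s * x)%R)%E.
Proof. by move=> mX gX mphi phi0; apply: ge0_integral_law. Qed.

Lemma normal_pdf_scale (s x : R) : 0 < s ->
  normal_pdf 0 s (s * x) * s = normal_pdf 0 1 x.
Proof.
move=> s0; rewrite !normal_pdfE ?oner_eq0 ?gt_eqF// /normal_peak /normal_fun.
rewrite !subr0 expr1n mul1r -mulrnAr sqrtrM ?sqr_ge0// sqrtr_sqr gtr0_norm//.
rewrite invfM exprMn -mulrnAr -mulNr -mulrN mulrAC [s^-1 * _ * _]mulrAC mulVf ?gt_eqF// mul1r.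
congr (_ * expR _).
by field; rewrite gt_eqF.
Qed.

(** Substitution in the density. It goes through continuous test functions because the substitution
    formula asks for a continuous integrand. *)
Lemma gauss_scale (s : R) (A : set R) : 0 < s -> measurable A ->
  gauss s A = gauss 1 ((fun x => s * x) @^-1` A).
Proof.
move=> s0 mA.
suff h : forall phi : R -> R, continuous phi -> (forall x, 0 <= phi x <= 1) ->
    (\int[gauss s]_x (phi x)%:E = \int[gauss 1]_x (phi (s * x))%:E)%E.
  have m1 : measurable_fun setT (fun x : R => x) by exact: measurable_id.
  have m2 : measurable_fun setT (fun x : R => s * x) by exact: mulrl_measurable.
  by have /= /(_ _ mA) := law_eq_continuous m1 m2 h.
move=> phi cphi phi01.
have phi0 x : 0 <= phi x by case/andP: (phi01 x).
have mphi : measurable_fun setT phi by exact: continuous_measurable_fun.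
rewrite (@ge0_integral_gauss s (fun x => (phi x)%:E)); last 2 first.
- exact/measurable_EFinP.
- by move=> x; rewrite lee_fin.
rewrite (@ge0_integral_gauss 1 (fun x => (phi (s * x))%:E)); last 2 first.
- by apply/measurable_EFinP; apply: measurableT_comp => //; exact: mulrl_measurable.
- by move=> x; rewrite lee_fin.
have dF : (fun x : R => s * x)^`()%classic = cst s.
  by apply/funext => x; rewrite derive1E deriveM// derive_cst derive_id scaler0 addr0 /GRing.scale/= mulr1.
under eq_integral do rewrite -EFinM.
rewrite (@increasing_ge0_integration_by_substitutionT _ (fun x => s * x)
  (fun x => phi x * normal_pdf 0 s x)).
- apply: eq_integral => x _; rewrite dF /= -EFinM -(normal_pdf_scale x s0).
  by rewrite !fctE/= mulrA.
- by move=> x y xy; rewrite ltr_pM2l.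
- by rewrite dF => x; exact: cvg_cst.
- by rewrite dF; exact: is_cvg_cst.
- by rewrite dF; exact: is_cvg_cst.
- by move=> x; apply: derivableM.
- by under eq_fun do rewrite mulrC; apply: gt0_cvgMlNy.
- by under eq_fun do rewrite mulrC; apply: gt0_cvgMly.
- move=> x; apply: cvgM; first exact: cphi.
  by apply: continuous_normal_pdf; rewrite gt_eqF.
- by move=> x; rewrite mulr_ge0 ?normal_pdf_ge0.
Qed.

Lemma centred_normalE (s : R) (A : set R) : 0 <= s -> measurable A ->
  centred_normal s A = gauss 1 ((fun x => s * x) @^-1` A).
Proof.
rewrite /centred_normal le_eqVlt => /predU1P[<- mA|s0 mA].
  rewrite eqxx diracE.
  have [A0|A0] := boolP (0 \in A).
    rewrite (_ : _ @^-1` _ = setT) ?probability_setT//.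
    by apply/seteqP; split => // x _ /=; rewrite mul0r; rewrite inE in A0.
  rewrite (_ : _ @^-1` _ = set0); first by rewrite measure0.
  apply/seteqP; split => // x; rewrite /preimage/= mul0r => A0'.
  by rewrite mem_set in A0.
by rewrite (gt_eqF s0) -[LHS]/(gauss s A); exact: gauss_scale.
Qed.

Lemma gaussian_centred_normal d (T : measurableType d) (P : probability T R)
    (X : T -> R) (s : R) : 0 <= s -> gaussian P X s <->
  (forall A, measurable A -> P (X @^-1` A) = centred_normal s A).
Proof.
by move=> s0; split=> h A mA; rewrite h// centred_normalE.
Qed.

Lemma gauss_sym (A : set R) : measurable A ->
  gauss 1 ((fun x : R => - x) @^-1` A) = gauss 1 A.
Proof.
move=> mA.
suff h : forall phi : R -> R, continuous phi -> (forall x, 0 <= phi x <= 1) ->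
    (\int[gauss 1]_x (phi (- x))%:E = \int[gauss 1]_x (phi x)%:E)%E.
  have m1 : measurable_fun setT (fun x : R => x) by exact: measurable_id.
  have m2 : measurable_fun setT (fun x : R => - x) by exact: oppr_measurable.
  by have /= /(_ _ mA) := law_eq_continuous m2 m1 h.
move=> phi cphi phi01.
have phi0 x : 0 <= phi x by case/andP: (phi01 x).
have mphi : measurable_fun setT phi by exact: continuous_measurable_fun.
rewrite (@ge0_integral_gauss 1 (fun x => (phi x)%:E)); last 2 first.
- exact/measurable_EFinP.
- by move=> x; rewrite lee_fin.
rewrite (@ge0_integral_gauss 1 (fun x => (phi (- x))%:E)); last 2 first.
- by apply/measurable_EFinP; apply: measurableT_comp.
- by move=> x; rewrite lee_fin.
pose g x := ((phi x)%:E * (normal_pdf 0 1 x)%:E)%E.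
transitivity (\int[pushforward leb (-%R : R -> measurableTypeR R)]_x g x)%E; last first.
  by apply: eq_measure_integral => //= B mB _; exact: lebesgue_measureN.
have mopp : measurable_fun setT (-%R : measurableTypeR R -> measurableTypeR R).
  exact: oppr_measurable.
rewrite (@ge0_integral_pushforward _ _ _ _ _ _ mopp leb setT g) => [||//|].
- apply: eq_integral => x _; rewrite /g/=; congr (_ * _%:E)%E.
  by rewrite !normal_pdfE ?oner_eq0// /normal_fun !subr0 sqrrN.
- exact: measurableT.
- apply: emeasurable_funM; first exact/measurable_EFinP.
  by apply/measurable_EFinP; exact: measurable_normal_pdf.
- by move=> x _; rewrite mule_ge0 ?lee_fin ?normal_pdf_ge0.
Qed.

Lemma gaussianZ d (T : measurableType d) (P : probability T R)
    (X : T -> R) (s c : R) : gaussian P X s -> gaussian P (fun w => c * X w) (c * s).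
Proof.
move=> gX A mA; rewrite (gX ((fun x => c * x) @^-1` A)); last first.
  by rewrite -[X in measurable X]setTI; exact: mulrl_measurable.
by congr gauss; apply/seteqP; split => x /=; rewrite mulrA.
Qed.

Lemma gaussian_norm d (T : measurableType d) (P : probability T R)
    (X : T -> R) (s : R) : gaussian P X s -> gaussian P X `|s|.
Proof.
move=> gX; case: (lerP 0 s) => [s0|s0]; first by rewrite ger0_norm.
rewrite ltr0_norm// => A mA; rewrite gX// -gauss_sym; last first.
  by rewrite -[X in measurable X]setTI; exact: mulrl_measurable.
by congr gauss; apply/seteqP; split => x /=; rewrite mulrN mulNr.
Qed.

Lemma measurable_gauss_exp (c : R) : measurable_fun setT (fun x : R => expR (- (c * x ^+ 2))).
Proof.
apply: measurableT_comp => //; apply: measurableT_comp => //.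
by apply: measurable_funM => //; exact: exprn_measurable.
Qed.

(** The integrand times the standard density is [s] times the density of deviation [s], where [s] is
    the right-hand side. Negative [c] down to -1/2 are allowed; they give the exponential
    moments. *)
Lemma integral_normal_expR (c : R) : - 2^-1 < c ->
  (\int[gauss 1]_x (expR (- (c * x ^+ 2)))%:E =
   (Num.sqrt (1 + 2 * c))^-1%:E)%E.
Proof.
move=> c0.
have c1 : 0 < 1 + 2 * c by lra.
rewrite ge0_integral_gauss; last 2 first.
- by apply/measurable_EFinP; exact: measurable_gauss_exp.
- by move=> x; rewrite lee_fin expR_ge0.
pose s := (Num.sqrt (1 + 2 * c))^-1.
have s0 : 0 < s by rewrite invr_gt0 sqrtr_gt0.
under eq_integral.
  move=> x _; rewrite -EFinM.
  rewrite (_ : _ * _ = s * normal_pdf 0 s x); last first.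
    rewrite !normal_pdfE ?oner_eq0 ?gt_eqF// /normal_peak /normal_fun !subr0 expr1n mul1r.
    rewrite -mulrnAr sqrtrM ?sqr_ge0// sqrtr_sqr gtr0_norm// invfM !mulrA.
    rewrite divff ?gt_eqF// mul1r mulrAC [RHS]mulrC; congr (_ * _).
    rewrite -expRD; congr expR; rewrite /s exprVn sqr_sqrtr ?ltW//.
    by field; rewrite gt_eqF.
  rewrite EFinM; over.
rewrite ge0_integralZl//.
- by rewrite integral_normal_pdf mule1.
- by apply/measurable_EFinP; exact: measurable_normal_pdf.
- by move=> x _; rewrite lee_fin normal_pdf_ge0.
- by rewrite lee_fin ltW.
Qed.

Lemma gaussian_expR d (T : measurableType d) (P : probability T R)
    (X : T -> R) (s : R) : measurable_fun setT X -> gaussian P X s ->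
  (\int[P]_w (expR (- (X w ^+ 2)))%:E = (Num.sqrt (1 + 2 * s ^+ 2))^-1%:E)%E.
Proof.
move=> mX gX.
have mf : measurable_fun setT (fun x : R => (expR (- x ^+ 2))%:E).
  apply/measurable_EFinP; apply: measurableT_comp => //.
  by apply: measurableT_comp => //; exact: exprn_measurable.
rewrite (gaussian_integral mX gX mf); last by move=> x; rewrite lee_fin expR_ge0.
rewrite -integral_normal_expR; last first.
  by rewrite (lt_le_trans _ (sqr_ge0 _))// oppr_lt0 invr_gt0.
by apply: eq_integral => x _; rewrite exprMn.
Qed.

(** Squaring [x ^+ 2 / 8 <= expR (x ^+ 2 / 8)] bounds the fourth power by 64 exp(x^2 / 4), which is
    integrable because 1/4 < 1/2. *)
Lemma gauss_pow4_lty : (\int[gauss 1]_x (x ^+ 4)%:E < +oo :> \bar R)%E.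
Proof.
apply: (@le_lt_trans _ _ (\int[gauss 1]_x (64 * expR (- ((- 4^-1) * x ^+ 2)))%:E)%E); last first.
  under eq_integral do rewrite EFinM.
  rewrite ge0_integralZl//.
  - rewrite integral_normal_expR; last by lra.
    by rewrite -EFinM ltry.
  - by apply/measurable_EFinP; exact: measurable_gauss_exp.
apply: ge0_le_integral => //.
- by move=> x _; rewrite lee_fin exprn_even_ge0.
- by apply/measurable_EFinP; exact: exprn_measurable.
- by apply/measurable_EFinP; apply: measurable_funM => //; exact: measurable_gauss_exp.
- move=> x _; rewrite lee_fin.
  have -> : - (- 4^-1 * x ^+ 2) = x ^+ 2 / 8 + x ^+ 2 / 8 by field.
  rewrite expRD.
  have h : 1 + x ^+ 2 / 8 <= expR (x ^+ 2 / 8) by exact: expR_ge1Dx.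
  have h2 : x ^+ 2 / 8 <= expR (x ^+ 2 / 8) by lra.
  have h3 : 0 <= x ^+ 2 / 8 by rewrite divr_ge0// sqr_ge0.
  have -> : x ^+ 4 = 64 * ((x ^+ 2 / 8) * (x ^+ 2 / 8)) by field.
  by rewrite ler_pM2l// ler_pM.
Qed.

Definition gauss_pow4 : R := fine (\int[gauss 1]_x (x ^+ 4)%:E).

Lemma gauss_pow4E : (\int[gauss 1]_x (x ^+ 4)%:E = gauss_pow4%:E :> \bar R)%E.
Proof.
rewrite fineK// ge0_fin_numE ?gauss_pow4_lty//.
by apply: integral_ge0 => x _; rewrite lee_fin exprn_even_ge0.
Qed.

Lemma gauss_pow4_ge0 : 0 <= gauss_pow4.
Proof.
apply: fine_ge0.
by apply: integral_ge0 => x _; rewrite lee_fin exprn_even_ge0.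
Qed.

(* E[G^2] is squeezed between the two bounds obtained by integrating
   1 <= c x^2 + exp (- c x^2) <= 1 + c^2 x^4 and letting c go to 0. *)
Lemma gauss_pow2 : (\int[gauss 1]_x (x ^+ 2)%:E = 1 :> \bar R)%E.
Proof.
have h1 := has_mean_cst (gauss 1) (1 : R).
have h4 : has_mean (gauss 1) (fun x : R => x ^+ 4) gauss_pow4.
  apply: ge0_has_mean gauss_pow4E => [|x]; [exact: exprn_measurable|exact: exprn_even_ge0].
have hE (c : R) : 0 < c ->
    has_mean (gauss 1) (fun x : R => expR (- (c * x ^+ 2))) (Num.sqrt (1 + 2 * c))^-1.
  move=> c0; apply: ge0_has_mean; [|by move=> x; exact: expR_ge0|].
    exact: measurable_gauss_exp.
  by apply: integral_normal_expR; lra.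
have [e he] : exists e, has_mean (gauss 1) (fun x : R => x ^+ 2) e.
  apply: dominated_has_mean (has_meanD h1 h4) _; first exact: exprn_measurable.
  move=> x; rewrite ger0_norm ?sqr_ge0// (_ : x ^+ 4 = x ^+ 2 * x ^+ 2); last by ring.
  by have := sqr_ge0 (x ^+ 2 - 1); rewrite /cst; nra.
rewrite he.2; congr (_%:E).
have lo (c : R) : 0 < c -> 1 <= c * e + (Num.sqrt (1 + 2 * c))^-1.
  move=> c0; apply: has_mean_le h1 (has_meanD (has_meanZ c he) (hE c c0)) _ => x.
  by rewrite -lerBlDl; exact: expR_ge1Dx.
have hi (c : R) : 0 < c -> c * e + (Num.sqrt (1 + 2 * c))^-1 <= 1 + c ^+ 2 * gauss_pow4.
  move=> c0; apply: has_mean_le (has_meanD (has_meanZ c he) (hE c c0))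
    (has_meanD h1 (has_meanZ (c ^+ 2) h4)) _ => x; rewrite /cst.
  have v0 : 0 <= c * x ^+ 2 by rewrite mulr_ge0 ?sqr_ge0// ltW.
  have := expR_ge1Dx (c * x ^+ 2) => h.
  rewrite (_ : c ^+ 2 * x ^+ 4 = (c * x ^+ 2) * (c * x ^+ 2)); last by ring.
  move: v0 h; set v := c * x ^+ 2 => v0 h.
  rewrite expRN.
  have e0 : 0 < expR v by exact: expR_gt0.
  have : (expR v)^-1 <= (1 + v)^-1 by rewrite lef_pV2// posrE; lra.
  have : (1 + v)^-1 * (1 + v) = 1 by rewrite mulVf// gt_eqF//; lra.
  have : 0 < (1 + v)^-1 by rewrite invr_gt0; lra.
  nra.
have sq (c : R) : 0 < c -> let r := Num.sqrt (1 + 2 * c) in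
    [/\ 1 <= r, r <= 1 + c & r ^+ 2 = 1 + 2 * c].
  move=> c0 /=; split.
  - by rewrite -[leLHS]sqrtr1 ler_sqrt; lra.
  - rewrite -[leRHS]ger0_norm; last by lra.
    by rewrite -sqrtr_sqr ler_sqrt; nra.
  - by rewrite sqr_sqrtr//; lra.
apply/eqP; rewrite eq_le; apply/andP; split.
- apply/ler_addgt0Pr => x x0.
  have M0 := gauss_pow4_ge0.
  (* As [1 - q <= c], the bound [hi] divided by [c] reads [e <= 1 + c * gauss_pow4]; this [c] makes
     the error at most [x]. *)
  pose c := x / (1 + gauss_pow4).
  have c0 : 0 < c by rewrite divr_gt0//; lra.
  have cx : c * gauss_pow4 <= x.
    by rewrite /c mulrAC ler_pdivrMr; nra.
  have [] := sq c c0; set r := Num.sqrt _ => r1 r2 r3.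
  have := hi c c0; rewrite -/r.
  have : r^-1 * r = 1 by rewrite mulVf// gt_eqF//; lra.
  have : 0 < r^-1 by rewrite invr_gt0; lra.
  set q := r^-1 => q0 qr h.
  have q1 : 1 - q = q * (r - 1) by rewrite mulrBr qr mulr1.
  have : 1 - q <= c by nra.
  nra.
- apply/ler_addgt0Pr => x x0.
  pose c := x / 2.
  have c0 : 0 < c by rewrite divr_gt0.
  have [] := sq c c0; set r := Num.sqrt _ => r1 r2 r3.
  have := lo c c0; rewrite -/r.
  have : r^-1 * r = 1 by rewrite mulVf// gt_eqF//; lra.
  have : 0 < r^-1 by rewrite invr_gt0; lra.
  set q := r^-1 => q0 qr h.
  have q1 : 1 - q = q * (r - 1) by rewrite mulrBr qr mulr1.
  have c2 : 2 * c = (r - 1) * (r + 1) by rewrite -subr_sqr expr1n r3; lra.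
  have : c * (1 - 2 * c) <= 1 - q.
    have q2 : 1 - c <= q by nra.
    nra.
  have -> : 2 * c = x by rewrite /c; field.
  move=> h3; have : c * (1 - x) <= c * e by lra.
  by rewrite ler_pM2l//; lra.
Qed.

Lemma gaussian_pow p d (T : measurableType d) (P : probability T R)
    (X : T -> R) (s : R) : ~~ odd p -> measurable_fun setT X -> gaussian P X s ->
  (\int[P]_w (X w ^+ p)%:E = (s ^+ p)%:E * \int[gauss 1]_x (x ^+ p)%:E)%E.
Proof.
move=> ep mX gX.
have p0 (x : R) : (0 <= (x ^+ p)%:E)%E by rewrite lee_fin exprn_even_ge0.
have mp : measurable_fun setT (fun x : R => (x ^+ p)%:E).
  by apply/measurable_EFinP; exact: exprn_measurable.
rewrite (gaussian_integral mX gX mp)//; under eq_integral do rewrite exprMn EFinM.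
by rewrite ge0_integralZl.
Qed.

Lemma gaussian_pow2 d (T : measurableType d) (P : probability T R)
    (X : T -> R) (s : R) : measurable_fun setT X -> gaussian P X s ->
  (\int[P]_w (X w ^+ 2)%:E = (s ^+ 2)%:E)%E.
Proof. by move=> mX gX; rewrite (gaussian_pow (p := 2) _ mX gX)// gauss_pow2 mule1. Qed.

Lemma gaussian_pow4 d (T : measurableType d) (P : probability T R)
    (X : T -> R) (s : R) : measurable_fun setT X -> gaussian P X s ->
  (\int[P]_w (X w ^+ 4)%:E = (s ^+ 4 * gauss_pow4)%:E)%E.
Proof. by move=> mX gX; rewrite (gaussian_pow (p := 4) _ mX gX)// gauss_pow4E. Qed.

(** E exp(-X^2) is an injective function of the variance and converges by bounded convergence, so
    the variances converge. The law of the limit is then identified by passing to the limit on both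
    sides for each continuous test function. *)
Lemma gaussian_limit d (T : measurableType d) (P : probability T R)
    (X_ : (T -> R)^nat) (X : T -> R) (s_ : R^nat) :
  (forall n, measurable_fun setT (X_ n)) -> measurable_fun setT X ->
  (forall n, gaussian P (X_ n) (s_ n)) ->
  {ae P, forall w, X_ ^~ w @ \oo --> X w} ->
  exists s : R, [/\ 0 <= s, s_ n ^+ 2 @[n --> \oo] --> s ^+ 2 & gaussian P X s].
Proof.
move=> mX_ mX gX cX.
pose f (x : R) : R := expR (- x ^+ 2).
have mf : measurable_fun setT f.
  by apply: measurableT_comp => //; apply: measurableT_comp => //; exact: exprn_measurable.
have cf : continuous f by exact: continuous_gauss_fun.
have f0 x : 0 < f x by exact: expR_gt0.
have f1 x : `|f x| <= 1 by rewrite ger0_norm ?(ltW (f0 _))// /f -[leRHS]expR0 ler_expR oppr_le0 sqr_ge0.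
have mfX : measurable_fun setT (f \o X) by exact: measurableT_comp.
have cfX : {ae P, forall w, (f \o X_ n) w @[n --> \oo] --> (f \o X) w}.
  by apply: filterS cX => w cw; apply: (cvg_comp _ f cw); exact: cf.
have := @cvg_integral_bounded _ _ _ P (fun n => f \o X_ n) _ 1
  (fun n => measurableT_comp mf (mX_ n)) mfX cfX (fun n w => f1 _).
under eq_fun do rewrite (gaussian_expR (mX_ _) (gX _)).
have ifX : P.-integrable setT (EFin \o (f \o X)).
  apply: (@le_integrable _ _ _ P _ measurableT _ (cst 1%:E)).
  - exact/measurable_EFinP.
  - by move=> w _; rewrite /= normr1 lee_fin.
  - exact: finite_measure_integrable_cst.
have fin := integrable_fin_num measurableT ifX.
set p := fine (\int[P]_x ((f \o X) x)%:E).
rewrite -(fineK fin) -/p => /fine_cvg/=.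
(* Positivity of the limit excludes that the variances escape to infinity; it holds because
   exp(-X^2) vanishes nowhere. *)
have p0 : 0 < p.
  rewrite lt_neqAle fine_ge0 ?andbT; last first.
    by apply: integral_ge0 => x _; rewrite lee_fin; exact: ltW (f0 _).
  apply/eqP => p0.
  have : (\int[P]_(x in setT) `|((f \o X) x)%:E| = 0)%E.
    under eq_integral do rewrite gee0_abs ?lee_fin ?(ltW (f0 _))//=.
    by rewrite -[LHS](fineK fin) -/p -p0.
  have mfX' : measurable_fun setT (EFin \o (f \o X)) by exact/measurable_EFinP.
  move/(ae_eq_integral_abs P measurableT mfX') => [N [mN N0 sub]].
  have : (P setT <= P N)%E.
    apply: le_measure; rewrite ?inE//; apply: subset_trans sub => w _ /= h.
    by have := h Logic.I; move=> [] /eqP; rewrite gt_eqF.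
  by rewrite probability_setT N0 lee_fin ler10.
move=> cp.
(* The solution of (1 + 2 v)^(-1/2) = p. *)
pose v := ((p ^+ 2)^-1 - 1) / 2.
have cs : s_ n ^+ 2 @[n --> \oo] --> v.
  have E n : s_ n ^+ 2 = (((Num.sqrt (1 + 2 * s_ n ^+ 2))^-1 ^+ 2)^-1 - 1) / 2.
    rewrite exprVn invrK sqr_sqrtr; first by field.
    by rewrite addr_ge0// mulr_ge0// sqr_ge0.
  rewrite (_ : (fun n => _) = (fun n =>
    (((Num.sqrt (1 + 2 * s_ n ^+ 2))^-1 ^+ 2)^-1 - 1) / 2)); last exact/funext.
  apply: cvgMl; apply: cvgB; last exact: cvg_cst.
  apply: cvgV; first by rewrite expf_eq0/= gt_eqF.
  exact: (cvgM cp cp).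
have v0 : 0 <= v.
  rewrite -(cvg_lim _ cs)//; apply: limr_ge; first exact: cvgP cs.
  by near=> n; exact: sqr_ge0.
have cabs : `|s_ n| @[n --> \oo] --> Num.sqrt v.
  under eq_fun do rewrite -sqrtr_sqr.
  by apply: (cvg_comp _ (@Num.sqrt R) cs); exact: sqrt_continuous.
exists (Num.sqrt v); split; first exact: sqrtr_ge0.
  by rewrite sqr_sqrtr.
suff h : forall phi : R -> R, continuous phi -> (forall x, 0 <= phi x <= 1) ->
    (\int[P]_x (phi (X x))%:E = \int[gauss 1]_x (phi (Num.sqrt v * x))%:E)%E.
  move=> A mA; have m2 : measurable_fun setT (fun x : R => Num.sqrt v * x).
    exact: mulrl_measurable.
  by have /= /(_ _ mA) := law_eq_continuous mX m2 h.
move=> phi cphi phi01.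
have mphi : measurable_fun setT phi by exact: continuous_measurable_fun.
have bphi x : `|phi x| <= 1 by case/andP: (phi01 x) => *; rewrite ger0_norm.
have phi0 x : (0 <= (phi x)%:E)%E by case/andP: (phi01 x) => *; rewrite lee_fin.
have l1 : (\int[P]_x (phi (X_ n x))%:E @[n --> \oo] --> \int[P]_x (phi (X x))%:E)%E.
  apply: (@cvg_integral_bounded _ _ _ P (fun n => phi \o X_ n) (phi \o X) 1) => //.
  - by move=> n; exact: measurableT_comp.
  - exact: measurableT_comp.
  - by apply: filterS cX => w cw; apply: (cvg_comp _ phi cw); exact: cphi.
  - by move=> n x; exact: bphi.
apply: (cvg_unique _ l1) => //.
(* The signs of [s_ n] may oscillate, only the absolute values converge; symmetry of the normal law
   allows the replacement. *)
rewrite (_ : (fun n => _) = (fun n => \int[gauss 1]_x (phi (`|s_ n| * x))%:E)%E); last first.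
  apply/funext => n.
  apply: (gaussian_integral (phi := EFin \o phi) (mX_ n) (gaussian_norm (gX n))) => //.
  exact/measurable_EFinP.
apply: (@cvg_integral_bounded _ _ _ (gauss 1) (fun n x => phi (`|s_ n| * x))
  (fun x => phi (Num.sqrt v * x)) 1) => //.
- by move=> n; apply: measurableT_comp => //; exact: mulrl_measurable.
- by apply: measurableT_comp => //; exact: mulrl_measurable.
- apply/aeW => x; apply: (cvg_comp (fun n => `|s_ n| * x) phi); last exact: cphi.
  exact: cvgMl.
Unshelve. all: by end_near. Qed.

(** Chebyshev's inequality for the second moment. *)
Lemma gaussian_tail d (T : measurableType d) (P : probability T R)
    (X : T -> R) (s c : R) : measurable_fun setT X -> gaussian P X s -> 0 < c ->
  (P [set w | (c <= `|X w|)%R] <= (s ^+ 2 / c ^+ 2)%:E)%E.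
Proof.
move=> mX gX c0.
have mA : measurable [set w | c <= `|X w|].
  rewrite -[X in measurable X]setTI.
  by apply: (measurable_fun_le (f := cst c) (g := fun w => `|X w|)) => //; exact: measurableT_comp.
rewrite EFinM lee_pdivlMr ?exprn_gt0// muleC.
rewrite -(gaussian_pow2 mX gX) -[X in P X]setIT -integral_indic// -ge0_integralZl//; last 2 first.
- exact/measurable_EFinP.
- by rewrite lee_fin sqr_ge0.
apply: ge0_le_integral => //.
- by move=> w _; rewrite mule_ge0// lee_fin ?sqr_ge0.
- by apply: measurable_funeM; exact/measurable_EFinP.
- by apply/measurable_EFinP; exact: measurable_funX.
- move=> w _; rewrite -EFinM lee_fin indicE; case: (boolP (_ \in _)); rewrite ?mulr0 ?sqr_ge0//.
  by rewrite inE/= mulr1 => h; rewrite -[leRHS]real_normK ?num_real// ler_sqr// nnegrE ltW.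
Qed.

(** The standard density is at most 1, so an interval has at most its length [2 * c / s] as
    probability. *)
Lemma gaussian_small_ball d (T : measurableType d) (P : probability T R)
    (X : T -> R) (s c : R) : gaussian P X s -> 0 < s -> 0 <= c ->
  (P [set w | (`|X w| <= c)%R] <= (2 * c / s)%:E)%E.
Proof.
move=> gX s0 c0.
have -> : [set w | `|X w| <= c] = X @^-1` `[- c, c].
  by apply/seteqP; split => w /=; rewrite in_itv/= ler_norml.
rewrite gX; last exact: measurable_itv.
have -> : (fun x => s * x) @^-1` `[- c, c] = `[- (c / s), c / s]%classic.
  have E x : (- c <= s * x <= c) = (- (c / s) <= x <= c / s).
    by rewrite -!ler_norml normrM gtr0_norm// ler_pdivlMr// mulrC.
  by apply/seteqP; split => x /=; rewrite !in_itv/= E.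
rewrite /gauss /normal_prob.
apply: (@le_trans _ _ (\int[leb]_(x in `[(- (c / s))%R, (c / s)%R]) (cst 1%:E) x)%E).
  apply: ge0_le_integral => //=.
  - by move=> x _; rewrite lee_fin normal_pdf_ge0.
  - by apply/measurable_EFinP; apply: measurable_funTS; exact: measurable_normal_pdf.
  - move=> x _; rewrite lee_fin; apply: le_trans (normal_pdf_ub _ _ (oner_neq0 _)) _.
    rewrite /normal_peak expr1n mul1r.
    have h : 1 <= Num.sqrt (pi *+ 2) :> R.
      rewrite -[leLHS]sqrtr1 ler_wsqrtr// mulr2n.
      by have := @pi_ge2 R; lra.
    by rewrite invf_le1// (lt_le_trans ltr01).
rewrite integral_cst/=; last exact: measurable_itv.
rewrite mul1e lebesgue_measure_itv/= lte_fin.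
case: ifPn => _; last by rewrite lee_fin divr_ge0 ?mulr_ge0// ltW.
by rewrite -EFinD lee_fin; have := divr_ge0 c0 (ltW s0); lra.
Qed.

End standard_normal.

(** * Independence *)

Section sigma_independence.
Context d (T : measurableType d) (R : realType) (P : probability T R).
Implicit Types C : set (set T).

Definition indep_classes C1 C2 :=
  forall A B, C1 A -> C2 B -> (P (A `&` B) = P A * P B)%E.

Lemma sub_sigma_measurable C : C `<=` measurable -> <<s C >> `<=` measurable.
Proof. by move=> Cm; apply: smallest_sub => //; exact: sigma_algebra_measurable. Qed.

(** For fixed [B], both sides are finite measures in [A] that agree on a generating class stable
    under intersection. *)
Lemma indep_sigma_half C B : C `<=` measurable -> setI_closed C -> C setT ->
  measurable B -> (forall A, C A -> P (A `&` B) = P A * P B)%E ->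
  forall A, <<s C >> A -> (P (A `&` B) = P A * P B)%E.
Proof.
move=> Cm CI CT mB CB A sA.
have PB0 : 0 <= fine (P B) by exact: fine_ge0.
pose c : {nonneg R} := NngNum PB0.
have E : mrestr P mB A = mscale c P A.
  apply: (@g_sigma_algebra_measure_unique _ R _ C Cm (fun=> setT) (fun=> CT)) => //.
  - by rewrite bigcup_const.
  - move=> X CX; rewrite -[LHS]/(P (X `&` B)) -[RHS]/(c%:num%:E * P X)%E.
    by rewrite CB//= fineK ?fin_num_measure// muleC.
  - move=> _; apply: (@le_lt_trans _ _ 1%E); last exact: ltry.
    by apply: probability_le1; exact: measurableI.
by rewrite -[LHS]/(mrestr P mB A) E /mscale/= fineK ?fin_num_measure// muleC.
Qed.

Lemma indep_sigma C1 C2 : C1 `<=` measurable -> C2 `<=` measurable ->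
  setI_closed C1 -> setI_closed C2 -> C1 setT -> C2 setT ->
  indep_classes C1 C2 -> indep_classes <<s C1 >> <<s C2 >>.
Proof.
move=> m1 m2 I1 I2 T1 T2 ind A B sA sB.
apply: (indep_sigma_half m1 I1 T1) => //; first exact: sub_sigma_measurable sB.
move=> A' CA'; rewrite setIC muleC.
apply: (indep_sigma_half m2 I2 T2) => //; first exact: m1.
by move=> B' CB'; rewrite setIC muleC; exact: ind.
Qed.

End sigma_independence.

(** Measurability with respect to the sigma-algebra generated by [C] is expressed throughout by
    giving the domain the type [g_sigma_algebraType C]; this turns it back into membership of
    events. *)
Lemma sub_sigma_preimage d' (U : measurableType d') (T : pointedType)
    (C : set (set T)) (Y : g_sigma_algebraType C -> U) (B : set U) :
  measurable_fun setT Y -> measurable B -> <<s C >> (Y @^-1` B).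
Proof. by move=> mY mB; have := mY measurableT _ mB; rewrite setTI. Qed.

Section cylinders.
Context d (T : measurableType d) (R : realType) (P : probability T R).
Context (I : finType) (X : I -> T -> R).
Hypothesis mX : forall i, measurable_fun setT (X i).
Hypothesis indX : mutually_independent P X.

(** Constraints are indexed by all of [I] and are trivial outside [J], so that cylinders over two
    blocks intersect in one product event over [I]. *)
Definition family_cylinders (J : {pred I}) : set (set T) :=
  [set G | exists2 A : I -> set R,
    (forall i, measurable (A i) /\ (i \notin J -> A i = setT)) &
    G = \bigcap_(i in [set: I]) (X i @^-1` A i)].

Let mpre i (A : set R) : measurable A -> measurable (X i @^-1` A).
Proof. by move=> mA; rewrite -[X in measurable X]setTI; exact: mX. Qed.

Let family_cylinders_measurable J : family_cylinders J `<=` measurable.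
Proof.
move=> _ [A mA ->]; apply: fin_bigcap_measurable => // i _.
by apply: mpre; case: (mA i).
Qed.

Let family_cylindersI J : setI_closed (family_cylinders J).
Proof.
move=> _ _ [A mA ->] [B mB ->]; exists (fun i => A i `&` B i).
  move=> i; have [? hA] := mA i; have [? hB] := mB i; split; first exact: measurableI.
  by move=> iJ; rewrite hA// hB// setTI.
by rewrite -bigcapI; apply: eq_bigcapr.
Qed.

Let family_cylindersT J : family_cylinders J setT.
Proof.
exists (fun=> setT) => //; apply/seteqP; split => // w _ i _ //.
Qed.

(** For each index at most one of the two constraints is nontrivial, so the product formula for the
    family splits factor by factor. *)
Lemma indep_family_cylinders (J K : {pred I}) : [predI J & K] =1 pred0 ->
  indep_classes P <<s family_cylinders J >> <<s family_cylinders K >>.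
Proof.
move=> JK; apply: indep_sigma => //.
move=> _ _ [A mA ->] [B mB ->].
have mAB i : measurable (A i `&` B i).
  by apply: measurableI; [case: (mA i)|case: (mB i)].
rewrite -bigcapI.
rewrite (_ : \bigcap_(i in _) _ = \bigcap_(i in setT) (X i @^-1` (A i `&` B i))); last first.
  exact: eq_bigcapr.
rewrite (indX mAB) (indX (fun i => (mA i).1)) (indX (fun i => (mB i).1)).
rewrite -big_split/=; apply: eq_bigr => i _.
have [iJ|iJ] := boolP (i \in J).
  have iK : i \notin K by apply/negP => iK; have := JK i; rewrite /= iJ iK.
  by rewrite ((mB i).2 iK) setIT preimage_setT probability_setT mule1.
by rewrite ((mA i).2 iJ) setTI preimage_setT probability_setT mul1e.
Qed.

Lemma measurable_family_cylinders (J : {pred I}) i : i \in J ->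
  measurable_fun setT (X i : g_sigma_algebraType (family_cylinders J) -> R).
Proof.
move=> iJ _ A mA; rewrite setTI; apply: sub_sigma_algebra.
exists (fun j => if j == i then A else setT).
  move=> j; case: eqP => [->|_]; split => //.
  by move=> /negP.
apply/seteqP; split => [w XA j _ /=|w /(_ i Logic.I)]; last by rewrite eqxx.
by case: eqP => [->|].
Qed.

End cylinders.

Lemma ge0_integral_mrestr d (T : measurableType d) (R : realType)
    (mu : {measure set T -> \bar R}) (G : set T) (mG : measurable G) (f : T -> \bar R) :
  measurable_fun setT f -> (forall x, 0 <= f x)%E ->
  (\int[mrestr mu mG]_x f x = \int[mu]_(x in G) f x)%E.
Proof.
move=> mf f0; rewrite -[in LHS](setUv G) ge0_integral_setU//=.
- rewrite [X in (_ + X)%E](_ : _ = 0)%E ?adde0; last first.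
    apply: null_set_integral; first exact: measurableC.
      exact: measurable_funTS.
    by rewrite -[LHS]/(mu (~` G `&` G)) setICl measure0.
  by apply: eq_measure_integral => A mA AG; rewrite -[LHS]/(mu (A `&` G)) setIidl.
- exact: measurableC.
- by rewrite setUv.
- by rewrite disj_set2E setICr.
Qed.

Section pair.
Context d1 d2 d (T : measurableType d) (U1 : measurableType d1)
  (U2 : measurableType d2) (R : realType) (P : probability T R).
Variables (X : T -> U1) (Y : T -> U2) (G : set T).
Hypotheses (mX : measurable_fun setT X) (mY : measurable_fun setT Y).
Hypothesis mG : measurable G.

Let PG : {measure set T -> \bar R} := mrestr P mG.
Let m1 : {measure set U1 -> \bar R} :=
  measure_function_pushforward__canonical__measure_function_Measure PG mX.
Let m2 : {measure set U2 -> \bar R} :=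
  measure_function_pushforward__canonical__measure_function_Measure P mY.

Let m1_fin : fin_num_fun m1.
Proof.
move=> A mA; rewrite -[m1 A]/(P (X @^-1` A `&` G)) fin_num_measure//.
apply: measurableI => //.
by rewrite -[X in measurable X]setTI; exact: mX.
Qed.
Let m2_fin : fin_num_fun m2.
Proof.
move=> A mA; rewrite fin_num_measure//.
by rewrite -[X in measurable X]setTI; exact: mY.
Qed.

Let n1 := (m1 : set U1 -> \bar R).
#[local] HB.instance Definition _ := Measure.on n1.
#[local] HB.instance Definition _ := Measure_isFinite.Build _ _ _ n1 m1_fin.
Let n2 := (m2 : set U2 -> \bar R).
#[local] HB.instance Definition _ := Measure.on n2.
#[local] HB.instance Definition _ := Measure_isFinite.Build _ _ _ n2 m2_fin.

(** Under the measure restricted to [G], the pair has a product law by uniqueness of product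
    measures; the claim is its section formula. The event [G] carries information from the past that
    [X] need not contain. *)
Lemma indep_pair :
  (forall A B, measurable A -> measurable B ->
    (P (G `&` X @^-1` A `&` Y @^-1` B) = P (G `&` X @^-1` A) * P (Y @^-1` B))%E) ->
  forall C : set (U1 * U2), measurable C ->
  (P (G `&` [set w | C (X w, Y w)]) =
   \int[P]_(w in G) P [set w' | C (X w, Y w')])%E.
Proof.
move=> ind C mC.
have mXY : measurable_fun setT (fun w => (X w, Y w)) by exact: measurable_fun_pair.
pose m' : {measure set (U1 * U2) -> \bar R} :=
  measure_function_pushforward__canonical__measure_function_Measure PG mXY.
have E : (n1 \x n2)%E C = m' C.
  apply: product_measure_unique => //.
  move=> A B mA mB; rewrite /m' /n1 /n2 /m1 /m2/= /pushforward /PG /mrestr.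
  rewrite [X in _ = (P X * _)%E]setIC -ind//; congr (P _).
  by apply/seteqP; split => [w [[? ?] ?]//|w [[? ?] ?]].
rewrite setIC -[LHS]/(m' C) -E /product_measure1.
have mS : measurable_fun setT (n2 \o xsection C) by exact: measurable_fun_xsection.
rewrite /n1 /m1 /= ge0_integral_pushforward//=.
rewrite preimage_setT.
have mf : measurable_fun setT (fun w => n2 (xsection C (X w))).
  exact: (measurableT_comp mS mX).
rewrite (ge0_integral_mrestr P mG mf); last by move=> w; exact: measure_ge0.
by apply: eq_integral => w _; congr (P _); apply/seteqP; split => w'; rewrite /= /xsection/= inE.
Qed.

End pair.

Section gaussian_sums.
Context {R : realType}.

(* Stability of the normal laws under convolution need not be computed: a
   Brownian motion provides the witnesses, as B_(t+s) = B_t + (B_(t+s) - B_t). *)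
Definition normal_convolution := forall a b : R, 0 < a -> 0 < b ->
  exists (d : measure_display) (T : measurableType d) (P : probability T R)
         (U V : T -> R),
  [/\ measurable_fun setT U /\ measurable_fun setT V,
      forall A B : set R, measurable A -> measurable B ->
        (P (U @^-1` A `&` V @^-1` B) = P (U @^-1` A) * P (V @^-1` B))%E,
      gaussian P U a /\ gaussian P V b &
      gaussian P (U \+ V) (Num.sqrt (a ^+ 2 + b ^+ 2))].

(** The right-hand side depends on [s] and [t] only, so knowing the law of one independent sum with
    these deviations settles all of them. *)
Lemma gaussian_indep_addE d (T : measurableType d) (P : probability T R)
    (X Y : T -> R) (s t : R) (A : set R) :
  measurable_fun setT X -> measurable_fun setT Y ->
  (forall A B : set R, measurable A -> measurable B ->
        (P (X @^-1` A `&` Y @^-1` B) = P (X @^-1` A) * P (Y @^-1` B))%E) ->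
  gaussian P X s -> gaussian P Y t -> measurable A ->
  (P ((X \+ Y)%R @^-1` A) =
   \int[gauss 1]_x gauss 1 [set y | A (s * x + t * y)%R])%E.
Proof.
move=> mX mY ind gX gY mA.
have mD : measurable_fun setT (fun z : R * R => z.1 + z.2) by exact: measurable_funD.
pose C : set (R * R) := (fun z : R * R => z.1 + z.2) @^-1` A.
have mC : measurable C by rewrite -[C]setTI; exact: mD.
have := @indep_pair _ _ _ _ _ _ R P X Y setT mX mY measurableT _ C mC.
rewrite setTI => ->; last by move=> B D mB mD'; rewrite !setTI; exact: ind.
pose phi x := gauss 1 [set y | A (x + t * y)].
have phiE x : P [set w' | C (x, Y w')] = phi x.
  rewrite -[[set w' | _]]/(Y @^-1` [set y | A (x + y)]) gY//.
  rewrite -[X in measurable X]setTI.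
  have : measurable_fun setT (fun y : R => x + y) by exact: measurable_funD.
  exact.
have mphi : measurable_fun setT phi.
  pose C' : set (R * R) := (fun z : R * R => z.1 + t * z.2) @^-1` A.
  have mC' : measurable C'.
    rewrite -[C']setTI.
    have : measurable_fun setT (fun z : R * R => z.1 + t * z.2).
      by apply: measurable_funD => //; exact: measurable_funM.
    exact.
  rewrite (_ : phi = (gauss 1) \o xsection C'); first exact: measurable_fun_xsection.
  by apply/funext => x; rewrite /phi/=; congr gauss; apply/seteqP; split => y; rewrite /xsection/= inE.
under eq_integral do rewrite phiE.
by rewrite (gaussian_integral mX gX mphi)//.
Qed.

Lemma gaussian0 d (T : measurableType d) (P : probability T R) :
  gaussian P (cst 0) 0.
Proof.
move=> A mA; have [A0|A0] := pselect (A 0).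
  have -> : cst 0 @^-1` A = [set: T] by apply/seteqP; split.
  have -> : (fun x : R => 0 * x) @^-1` A = setT.
    by apply/seteqP; split => // x _ /=; rewrite mul0r.
  by rewrite probability_setT gauss_setT.
have -> : cst 0 @^-1` A = set0 :> set T by apply/seteqP; split.
have -> : (fun x : R => 0 * x) @^-1` A = set0.
  by apply/seteqP; split => // x /=; rewrite mul0r.
by rewrite !measure0.
Qed.

Lemma gaussianD d (T : measurableType d) (P : probability T R)
    (X Y : T -> R) (s t : R) : normal_convolution ->
  measurable_fun setT X -> measurable_fun setT Y ->
  (forall A B : set R, measurable A -> measurable B ->
        (P (X @^-1` A `&` Y @^-1` B) = P (X @^-1` A) * P (Y @^-1` B))%E) ->
  gaussian P X s -> gaussian P Y t ->
  gaussian P (X \+ Y) (Num.sqrt (s ^+ 2 + t ^+ 2)).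
Proof.
move=> conv mX mY ind gX gY.
wlog : s t gX gY / 0 <= s /\ 0 <= t.
  move=> /(_ `|s| `|t| (gaussian_norm gX) (gaussian_norm gY)).
  by rewrite !normr_ge0 !real_normK ?num_real//; exact.
move=> [s0 t0] A mA.
rewrite (gaussian_indep_addE mX mY ind gX gY mA).
have mpre (c : R) : measurable ((fun x => c * x) @^-1` A).
  by rewrite -[X in measurable X]setTI; exact: mulrl_measurable.
(* The witnesses of [normal_convolution] exist for positive deviations only; degenerate summands are
   treated directly. *)
move: s0; rewrite le_eqVlt => /predU1P[<-|s0].
  rewrite expr0n/= add0r sqrtr_sqr ger0_norm//.
  under eq_integral do under eq_set do rewrite mul0r add0r.
  by rewrite integral_cst// [X in (_ * X)%E](gauss_setT 1) mule1.
move: t0; rewrite le_eqVlt => /predU1P[<-|t0].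
  rewrite expr0n/= addr0 sqrtr_sqr gtr0_norm//.
  under eq_integral do under eq_set do rewrite mul0r addr0.
  rewrite -[X in _ = gauss 1 X]setIT -integral_indic//; apply: eq_integral => x _.
  rewrite indicE; have [h|h] := pselect (A (s * x)).
    by rewrite mem_set// (_ : [set _ | _] = setT) ?gauss_setT//; apply/seteqP; split.
  by rewrite memNset// (_ : [set _ | _] = set0) ?measure0//; apply/seteqP; split.
have [d' [T' [P' [U [V [[mU mV] indUV [gU gV] gUV]]]]]] := conv s t s0 t0.
by rewrite -(gaussian_indep_addE mU mV indUV gU gV mA) gUV.
Qed.

Lemma gaussian_indep_sum d (T : measurableType d) (P : probability T R)
    (I : finType) (X : I -> T -> R) (s c : I -> R) : normal_convolution ->
  (forall i, measurable_fun setT (X i)) -> mutually_independent P X ->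
  (forall i, gaussian P (X i) (s i)) ->
  gaussian P (fun w => \sum_i c i * X i w) (Num.sqrt (\sum_i (c i * s i) ^+ 2)).
Proof.
move=> conv mX ind gX.
suff h r : uniq r -> gaussian P (fun w => \sum_(i <- r) c i * X i w)
    (Num.sqrt (\sum_(i <- r) (c i * s i) ^+ 2)).
  by have := h _ (index_enum_uniq I).
have msum r' : measurable_fun setT (fun w => \sum_(i <- r') c i * X i w).
  by apply: measurable_sum => i; exact: measurable_funM.
elim: r => [_|i r IH /= /andP[ir ur]].
  rewrite big_nil sqrtr0 (_ : (fun w => _) = cst 0); first exact: gaussian0.
  by apply/funext => w; rewrite big_nil.
rewrite big_cons.
rewrite (_ : (fun w => _) = (fun w => c i * X i w) \+ (fun w => \sum_(j <- r) c j * X j w)); last first.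
  by apply/funext => w; rewrite big_cons.
rewrite -[X in _ + X]sqr_sqrtr; last by apply: sumr_ge0 => j _; exact: sqr_ge0.
apply: gaussianD => //; [exact: measurable_funM| |exact: gaussianZ|exact: IH].
move=> A B mA mB.
have JK : [predI pred1 i & mem r] =1 pred0.
  by move=> j /=; apply/negP => /andP[/eqP -> /=]; exact/negP.
apply: (indep_family_cylinders mX ind JK).
- apply: sub_sigma_preimage mA; apply: measurable_funM => //.
  by apply: measurable_family_cylinders; exact: eqxx.
- apply: sub_sigma_preimage mB.
  (* Measurability of a sum is asked for every index, and only the variables with index in [r] are
     measurable here; the others are replaced by 0. *)
  rewrite (_ : (fun w => _) = (fun w => \sum_(j <- r) (if j \in r then c j * X j w else 0))); last first.
    by apply/funext => w; rewrite big_seq [RHS]big_seq; apply: eq_bigr => j ->.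
  apply: measurable_sum => j; have [jr|jr] := boolP (j \in r); last exact: measurable_cst.
  by apply: measurable_funM => //; exact: measurable_family_cylinders.
Qed.

End gaussian_sums.

(** * Brownian motion *)

Section borel.
Context {R : realType}.

Lemma measurable_borel (T : ptopologicalType) d (U : measurableType d) (f : U -> T) :
  (forall A, open A -> measurable (f @^-1` A)) ->
  measurable_fun setT (f : U -> borelType T).
Proof.
move=> mf; apply: (measurability _ (erefl (@measurable _ (borelType T)))).
by move=> _ [A oA <-]; rewrite setTI; exact: mf.
Qed.

Lemma continuous_borel_measurable (T : ptopologicalType) (f : T -> R) :
  continuous f -> measurable_fun setT (f : borelType T -> R).
Proof.
move=> /continuousP cf; apply: (measurability _ (RGenOpens.measurableE R)).
move=> _ [_ [a [b ->] <-]]; rewrite setTI; apply: sub_sigma_algebra.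
by apply: cf; exact: interval_open.
Qed.

Lemma measurable_coord n i :
  measurable_fun setT (fun x : borelType 'rV[R]_n => (x : 'rV[R]_n) 0 i).
Proof. by apply: continuous_borel_measurable; exact: coord_continuous. Qed.

Definition rat_box n (q : {ffun 'I_n -> rat} * rat) : set 'rV[R]_n :=
  [set x | forall i, `|x 0 i - ratr (q.1 i)| < ratr q.2].

Lemma open_rV_bigcup n (A : set 'rV[R]_n) : open A ->
  A = \bigcup_(q in [set: {ffun 'I_n -> rat} * rat])
      (if pselect (rat_box q `<=` A) then rat_box q else set0).
Proof.
move=> oA; apply/seteqP; split => [x Ax|x [q _]]; last first.
  by case: pselect => // qA /qA.
have /nbhs_ballP [e /= e0 eA] : nbhs x A by exact: open_nbhs_nbhs.
have [r /[!in_itv]/= /andP[r0 re]] := rat_in_itvoo (divr_gt0 e0 (ltr0n R 2)).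
have /choice [q qP] (i : 'I_n) : exists q : rat, `|x 0 i - ratr q| < ratr r.
  have [q] := @rat_in_itvoo R (x 0 i - ratr r) (x 0 i + ratr r) ltac:(lra).
  by rewrite in_itv/= => /andP[q1 q2]; exists q; rewrite ltr_norml; lra.
exists ([ffun i => q i], r) => //; case: pselect => [_ i|[]] /=.
  by rewrite ffunE.
move=> y /= yq; apply: eA; split => // i j.
rewrite ord1 /ball/= ltr_norml.
have := yq j; have := qP j; rewrite /= ffunE !ltr_norml => /andP[? ?] /andP[? ?].
by lra.
Qed.

(** Rational boxes form a countable base of the topology, and the preimage of a box is a finite
    intersection of coordinate events. *)
Lemma measurable_rV n d (T : measurableType d) (f : T -> 'rV[R]_n) :
  (forall i, measurable_fun setT (fun w => f w 0 i)) ->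
  measurable_fun setT (f : T -> borelType 'rV[R]_n).
Proof.
move=> mf; apply: measurable_borel => // A oA.
rewrite (open_rV_bigcup oA) preimage_bigcup.
apply: countable_bigcupT_measurable => [|q]; first exact: countableP.
case: pselect => [?|?]; last by rewrite preimage_set0.
rewrite (_ : _ @^-1` _ = \bigcap_(i in [set: 'I_n])
    ((fun w => f w 0 i) @^-1` (ball (ratr (q.1 i) : R) (ratr q.2)))); last first.
  apply/seteqP; split => [w h i _|w h i]; rewrite /preimage/= /ball/= /ball_/= distrC.
    exact: h.
  by have := h i Logic.I; rewrite /preimage/= /ball/= /ball_/= distrC.
apply: fin_bigcap_measurable => // i _; rewrite -[X in measurable X]setTI.
by apply: mf => //; exact: measurable_ball.
Qed.

End borel.

Section cylinder_sets.
Context {J T : Type} d' (U : measurableType d').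
Implicit Types (V : J -> T -> U) (D : set J).

(** A finite list of constraints, given by a length and functions on [nat]. An index may be
    repeated, so intersection is concatenation. *)
Definition cylinders V D : set (set T) :=
  [set G | exists (m : nat) (j : nat -> J) (A : nat -> set U),
    (forall k, (k < m)%N -> D (j k) /\ measurable (A k)) /\
    G = \bigcap_(k in [set k | (k < m)%N]) (V (j k) @^-1` A k)].

Lemma cylindersT V D : J -> cylinders V D setT.
Proof.
move=> j0; exists 0%N, (fun=> j0), (fun=> setT); split => //.
by apply/seteqP; split.
Qed.

Lemma cylindersI V D : setI_closed (cylinders V D).
Proof.
move=> _ _ [m1 [j1 [A1 [H1 ->]]]] [m2 [j2 [A2 [H2 ->]]]].
exists (m1 + m2)%N, (fun k => if (k < m1)%N then j1 k else j2 (k - m1)%N),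
  (fun k => if (k < m1)%N then A1 k else A2 (k - m1)%N); split.
  move=> k km; case: ifPn => [/H1//|]; rewrite -leqNgt => mk.
  by apply: H2; rewrite ltn_subLR.
apply/seteqP; split => [w [h1 h2] k /= km|w h].
  case: ifPn => [/h1//|]; rewrite -leqNgt => mk.
  by apply: h2; rewrite /= ltn_subLR.
split => k /= km.
  have := h k; rewrite /= km; apply.
  by rewrite (leq_trans km)// leq_addr.
have := h (m1 + k)%N; rewrite /= ltn_add2l => /(_ km).
by rewrite ltnNge leq_addr/= addKn.
Qed.

Lemma cylinders1 V D j A : D j -> measurable A -> cylinders V D (V j @^-1` A).
Proof.
move=> Dj mA; exists 1%N, (fun=> j), (fun=> A); split => //.
by apply/seteqP; split => [w h k _|w /(_ 0%N)]; [|exact].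
Qed.

End cylinder_sets.

Lemma cylinders_measurable d d' (T : measurableType d) (U : measurableType d')
    J (V : J -> T -> U) (D : set J) :
  (forall j A, D j -> measurable A -> measurable (V j @^-1` A)) ->
  cylinders V D `<=` measurable.
Proof.
move=> h _ [m [j [A [H ->]]]]; apply: bigcap_measurableType => k /= km.
by have [? ?] := H k km; exact: h.
Qed.

Section brownian.
Context {R : realType} (n : nat) d (T : measurableType d) (P : probability T R).
Variable B : R -> T -> 'rV[R]_n.
Hypothesis bm : brownian_motion P B.

Lemma bm_measurable_coord t i : 0 <= t -> measurable_fun setT (fun w => B t w 0 i).
Proof.
move=> t0.
exact: (measurableT_comp (@measurable_coord R n i) (bm_measurable bm t0)).
Qed.

Lemma bm_gaussian s t i : 0 <= s -> s <= t ->
  gaussian P (fun w => (B t w - B s w) 0 i) (Num.sqrt (t - s)).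
Proof.
move=> s0; rewrite le_eqVlt => /predU1P[<-|st].
  rewrite subrr sqrtr0 (_ : (fun w => _) = cst 0); first exact: gaussian0.
  by apply/funext => w; rewrite subrr mxE.
apply/gaussian_centred_normal; first exact: sqrtr_ge0.
move=> A mA; rewrite /centred_normal gt_eqF ?sqrtr_gt0 ?subr_gt0//.
by apply: (bm_normal bm) => //; rewrite s0.
Qed.

Section partition.
Variables (m : nat) (t : nat -> R).
Hypotheses (t0 : 0 <= t 0%N) (tS : forall k, (k < m)%N -> t k < t k.+1).

Definition bm_increment (ki : 'I_m * 'I_n) (w : T) : R :=
  (B (t ki.1.+1) w - B (t ki.1) w) 0 ki.2.

Lemma partition_ge0 k : (k <= m)%N -> 0 <= t k.
Proof.
elim: k => [//|k IH] km; apply: le_trans (ltW (tS km)); exact: IH (ltnW km).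
Qed.

Lemma measurable_bm_increment ki : measurable_fun setT (bm_increment ki).
Proof.
rewrite /bm_increment; under eq_fun do rewrite !mxE.
by apply: measurable_funB; apply: bm_measurable_coord; apply: partition_ge0 => //; exact: ltnW.
Qed.

Lemma bm_increment_indep : mutually_independent P bm_increment.
Proof. exact: (bm_indep bm). Qed.

Lemma gaussian_bm_increment ki :
  gaussian P (bm_increment ki) (Num.sqrt (t ki.1.+1 - t ki.1)).
Proof.
by apply: bm_gaussian; [apply: partition_ge0; exact: ltnW|rewrite ltW// tS].
Qed.

Lemma measurable_bm_diff (J : {pred 'I_m * 'I_n}) a b i : (a <= b <= m)%N ->
  (forall l : 'I_m, (a <= l < b)%N -> (l, i) \in J) ->
  measurable_fun setT ((fun w => (B (t b) w - B (t a) w) 0 i) :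
    g_sigma_algebraType (family_cylinders bm_increment J) -> R).
Proof.
move=> /andP[ab bm'] HJ.
rewrite (_ : (fun w => _) = (fun w => \sum_(l <- index_iota a b)
    (if (a <= l < b)%N then (B (t l.+1) w - B (t l) w) 0 i else 0))); last first.
  apply/funext => w.
  transitivity (\sum_(a <= l < b) (B (t l.+1) w - B (t l) w) 0 i).
    by rewrite -summxE telescope_sumr.
  by rewrite big_seq [RHS]big_seq; apply: eq_bigr => l; rewrite mem_index_iota => ->.
apply: measurable_sum => l; have [/andP[al lb]|_] := boolP (a <= l < b)%N; last exact: measurable_cst.
have lm : (l < m)%N by exact: leq_trans bm'.
apply: (@measurable_family_cylinders _ T R _ bm_increment J (Ordinal lm, i)).
by apply: HJ; rewrite /= al lb.
Qed.

End partition.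

Lemma bm_normal_convolution : (0 < n)%N -> @normal_convolution R.
Proof.
move=> n0 a b a0 b0; pose i0 := Ordinal n0.
(* Increments over steps of lengths [a ^+ 2] and [b ^+ 2] have deviations [a] and [b]. *)
pose t k : R := if k == 0%N then 0 else if k == 1%N then a ^+ 2 else a ^+ 2 + b ^+ 2.
have tS k : (k < 2)%N -> t k < t k.+1.
  by case: k => [_|[_|//]]; rewrite /t/= ?ltrDl exprn_gt0.
have t0 : 0 <= t 0%N by rewrite /t.
pose k0 : 'I_2 * 'I_n := (ord0, i0); pose k1 : 'I_2 * 'I_n := (ord_max, i0).
have g0 : gaussian P (bm_increment t k0) a.
  have := gaussian_bm_increment t0 tS k0.
  by rewrite /k0/t/= subr0 sqrtr_sqr gtr0_norm.
have g1 : gaussian P (bm_increment t k1) b.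
  have := gaussian_bm_increment t0 tS k1.
  by rewrite /k1/t/= addrAC subrr add0r sqrtr_sqr gtr0_norm.
exists d, T, P, (bm_increment t k0), (bm_increment t k1); split.
- by split; exact: measurable_bm_increment.
- move=> A C mA mC.
  apply: (@indep_family_cylinders _ T R P _ (bm_increment t) (measurable_bm_increment t0 tS)
    (bm_increment_indep t0 tS) (pred1 k0) (pred1 k1)).
  + by move=> k; rewrite !inE/=; case: (eqVneq k k0) => // ->.
  + apply: sub_sigma_preimage mA.
    by apply: measurable_family_cylinders; exact: eqxx.
  + apply: sub_sigma_preimage mC.
    by apply: measurable_family_cylinders; exact: eqxx.
- by [].
- rewrite (_ : _ \+ _ = (fun w => (B (t 2%N) w - B (t 0%N) w) 0 i0)); last first.
    by apply/funext => w; rewrite /bm_increment/= !mxE; ring.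
  have := @bm_gaussian (t 0%N) (t 2%N) i0 t0; rewrite /t/= subr0; apply.
  by rewrite addr_ge0// sqr_ge0.
Qed.

(** Events on increments from [r0] rather than on values: for the future of [r0], only the
    increments are independent of the past. *)
Definition bm_cylinders r0 (D : set R) :=
  cylinders (fun (ri : R * 'I_n) w => (B ri.1 w - B r0 w) 0 ri.2) [set ri | D ri.1].

Definition bm_past s := bm_cylinders 0 [set r | 0 <= r <= s].

Definition bm_future s := bm_cylinders s [set r | s <= r].

Lemma measurable_bm_cylinders r0 D : 0 <= r0 -> (forall r, D r -> 0 <= r) ->
  bm_cylinders r0 D `<=` measurable.
Proof.
move=> r00 D0; apply: cylinders_measurable => -[r i] A /= /D0 r1 mA.
rewrite -[X in measurable X]setTI; apply: (_ : measurable_fun setT _) => //.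
under eq_fun do rewrite !mxE.
by apply: measurable_funB; exact: bm_measurable_coord.
Qed.

Lemma measurable_bm_past s : bm_past s `<=` measurable.
Proof. by apply: measurable_bm_cylinders => // r /andP[]. Qed.

Lemma measurable_bm_future s : 0 <= s -> bm_future s `<=` measurable.
Proof. by move=> s0; apply: measurable_bm_cylinders => // r; exact: le_trans. Qed.

(** Two cylinders involve finitely many times. Merged into one partition that contains 0 and [s],
    these times express both events through disjoint blocks of the same independent family of
    increments. *)
Lemma bm_indep_past_future s : (0 < n)%N -> 0 <= s ->
  indep_classes P <<s bm_past s >> <<s bm_future s >>.
Proof.
move=> n0 s0; pose i0 := Ordinal n0; pose j0 : R * 'I_n := (0, i0).
apply: indep_sigma.
- exact: measurable_bm_past.
- exact: measurable_bm_future.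
- exact: cylindersI.
- exact: cylindersI.
- exact: cylindersT.
- exact: cylindersT.
move=> G H [m1 [j1 [A1 [H1 GE]]]] [m2 [j2 [A2 [H2 HE]]]].
(* All times of both events together with 0 and [s]; removing duplicates before sorting makes the
   partition strict, as [bm_indep] requires. *)
pose us := 0 :: s :: [seq (j1 k).1 | k <- iota 0 m1] ++ [seq (j2 k).1 | k <- iota 0 m2].
pose ts := sort <=%R (undup us).
pose t k := nth 0 ts k.
pose m := (size ts).-1.
have ts_us x : (x \in ts) = (x \in us) by rewrite mem_sort mem_undup.
have us0 x : x \in us -> 0 <= x.
  rewrite !inE => /or3P[/eqP->//|/eqP->//|]; rewrite mem_cat => /orP[] /mapP[k].
    by rewrite mem_iota/= => km ->; have [/andP[]] := H1 k km.
  rewrite mem_iota/= => km ->; have [/= + _] := H2 k km; exact: le_trans.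
have sts : sorted <%R ts.
  by rewrite lt_sorted_uniq_le sort_uniq undup_uniq/= sort_sorted//; exact: le_total.
have ts_ne : (0 < size ts)%N.
  by rewrite -has_predT; apply/hasP; exists 0 => //; rewrite ts_us inE eqxx.
have szE : size ts = m.+1 by rewrite prednK.
have tlt k l : (l <= m)%N -> (k < l)%N -> t k < t l.
  move=> lm kl; apply: (sorted_ltn_nth lt_trans) => //; rewrite inE szE ltnS//.
  by rewrite (leq_trans (ltnW kl)).
have tS k : (k < m)%N -> t k < t k.+1 by move=> km; apply: tlt.
have tE x : x \in us -> exists2 k, (k <= m)%N & x = t k.
  rewrite -ts_us => xts; exists (index x ts); last by rewrite /t nth_index.
  by rewrite -ltnS -szE index_mem.
have t0E : t 0%N = 0.
  have t0 : 0 <= t 0%N by apply: us0; rewrite -ts_us mem_nth.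
  have [[|k] km E] := tE 0 (mem_head _ _); first by rewrite -E.
  by apply/eqP; rewrite eq_le t0 andbT [leRHS]E ltW// tlt.
have [ks ksm sE] : exists2 k, (k <= m)%N & s = t k by apply: tE; rewrite !inE eqxx orbT.
have t00 : 0 <= t 0%N by rewrite t0E.
have tle k l : (k <= m)%N -> (l <= m)%N -> t k <= t l -> (k <= l)%N.
  by move=> km lm; apply: contraTT; rewrite -ltnNge -ltNge => ?; exact: tlt.
pose J := [pred ki : 'I_m * 'I_n | (ki.1 < ks)%N].
pose K := [pred ki : 'I_m * 'I_n | (ks <= ki.1)%N].
have JK : [predI J & K] =1 pred0 by move=> ki; rewrite !inE /= ltnNge andNb.
have := @indep_family_cylinders _ T R P _ (bm_increment t) (measurable_bm_increment t00 tS)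
  (bm_increment_indep t00 tS) J K JK.
apply.
- rewrite GE.
  apply: (@bigcap_measurableType _ (g_sigma_algebraType (family_cylinders (@bm_increment m t) J))).
  move=> k /= km; have [/= /andP[r0 rs] mA] := H1 k km.
  have [l lm rE] : exists2 l, (l <= m)%N & (j1 k).1 = t l.
    apply: tE; rewrite !inE mem_cat; apply/or3P/Or33/orP; left.
    by apply: map_f; rewrite mem_iota.
  apply: sub_sigma_preimage mA; rewrite rE -[in B 0]t0E.
  apply: measurable_bm_diff => // l'; rewrite inE/= => ll.
  by apply: leq_trans ll _; apply: tle => //; rewrite -rE -sE.
- rewrite HE.
  apply: (@bigcap_measurableType _ (g_sigma_algebraType (family_cylinders (@bm_increment m t) K))).
  move=> k /= km; have [/= rs mA] := H2 k km.
  have [l lm rE] : exists2 l, (l <= m)%N & (j2 k).1 = t l.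
    apply: tE; rewrite !inE mem_cat; apply/or3P/Or33/orP; right.
    by apply: map_f; rewrite mem_iota.
  apply: sub_sigma_preimage mA; rewrite rE [in B s]sE.
  apply: measurable_bm_diff => [|l']; last by rewrite inE/= => /andP[].
  by rewrite lm andbT; apply: tle => //; rewrite -rE -sE.
Qed.

End brownian.

(** * The equation path by path *)

Section uniform_continuity.
Context {R : realType}.

Lemma compact_unif_continuous (V : pseudoMetricType R) (W : normedModType R) (K : set V)
    (g : V -> W) :
  compact K -> {within K, continuous g} ->
  forall e : R, 0 < e -> exists2 dl : R, 0 < dl &
    forall u v, K u -> K v -> ball u dl v -> `|g u - g v| < e.
Proof.
move=> cK /subspace_continuousP cg e e0.
have e2 : 0 < e / 2 by rewrite divr_gt0.
have [dl /= dl0 H] : \forall dl \near (0 : R)^'+, K `<=` (fun u => K u -> forall v, K v ->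
    ball u dl v -> `|g u - g v| < e).
  apply: (compact_near_coveringP K).1 => // x Kx.
  have /cvgrPdist_lt/(_ _ e2) := cg x Kx.
  rewrite near_withinE => /nbhs_ballP [r /= r0 rP].
  have r2 : 0 < r / 2 by rewrite divr_gt0.
  exists (ball x (r / 2), [set dl : R | dl <= r / 2]) => /=.
    split; first exact: nbhsx_ballx.
    exact: nbhs_right_le.
  move=> [u dl] /= [xu dlr] Ku v Kv uv.
  have xv : ball x r v.
    by rewrite [r]splitr; apply: ball_triangle xu _; exact: le_ball uv.
  have xu' : ball x r u by apply: le_ball xu; rewrite ler_pdivrMr// ler_pMr// ler1n.
  have h1 := rP _ xu' Ku; have h2 := rP _ xv Kv.
  rewrite [e]splitr (_ : _ - _ = (g x - g v) - (g x - g u)); last first.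
    by rewrite opprB [RHS]addrC subrKA.
  by rewrite (le_lt_trans (ler_normB _ _))// ltrD.
exists (dl / 2); first by rewrite divr_gt0.
move=> u v Ku Kv uv; apply: (H (dl / 2)) uv => //.
  by rewrite /= sub0r normrN gtr0_norm ?divr_gt0// ltr_pdivrMr// ltr_pMr// ltr1n.
by rewrite divr_gt0.
Qed.

Lemma compact_within_bounded (V : topologicalType) (K : set V) (g : V -> R) :
  compact K -> {within K, continuous g} ->
  exists2 C : R, 0 < C & forall u, K u -> `|g u| <= C.
Proof.
move=> cK cg; have /compact_bounded[M [_ MP]] := continuous_compact cg cK.
exists (Num.max 1 (M + 1)); first by rewrite lt_max ltr01.
move=> u Ku; apply: (MP (Num.max 1 (M + 1))); last by exists u.
by rewrite lt_max ltrDl ltr01 orbT.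
Qed.

End uniform_continuity.

Lemma ger0_derive_le (R : realType) (g dg : R -> R) (a b : R) : a <= b ->
  (forall x : R, a <= x <= b -> is_derive x 1 g (dg x)) ->
  (forall x, a <= x <= b -> 0 <= dg x) -> g a <= g b.
Proof.
move=> ab Dg dg0; rewrite -subr_ge0.
have [||c] := @MVT_segment R g dg a b ab.
- by move=> x; rewrite in_itv/= => h; apply: Dg; lra.
- apply: derivable_within_continuous => x; rewrite in_itv/= => /Dg.
  by case.
- by rewrite in_itv/= => cab ->; rewrite mulr_ge0 ?subr_ge0// dg0.
Qed.

Section riemann_sums.
Context {R : realType}.
Implicit Types s t : R.

Definition upart s t (m k : nat) : R := s + (t - s) * (k%:R / m.+1%:R).

Lemma upart0 s t m : upart s t m 0 = s.
Proof. by rewrite /upart mul0r mulr0 addr0. Qed.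

Lemma upart_last s t m : upart s t m m.+1 = t.
Proof. by rewrite /upart divff ?mulr1 ?subrKC// pnatr_eq0. Qed.

Lemma upartS s t m k : upart s t m k.+1 - upart s t m k = (t - s) / m.+1%:R.
Proof. by rewrite /upart -natr1; field; rewrite addrC natr1 pnatr_eq0. Qed.

Lemma upart_lt s t m k : s < t -> upart s t m k < upart s t m k.+1.
Proof. by move=> st; rewrite -subr_gt0 upartS divr_gt0// subr_gt0. Qed.

Lemma upart_itv s t m k : s <= t -> (k <= m.+1)%N -> s <= upart s t m k <= t.
Proof.
move=> st km; rewrite /upart lerDl mulr_ge0 ?subr_ge0 ?divr_ge0//=.
rewrite -lerBrDl ler_piMr ?subr_ge0// ler_pdivrMr// mul1r ler_nat.
exact: km.
Qed.

(** An error that is o(b - a) uniformly over short intervals adds up to o(1). The condition on the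
    diagonal covers [s = t], where all steps are degenerate. *)
Lemma cvg_upart_sum s t (D : R -> R -> R) : s <= t ->
  (forall e, 0 < e -> exists2 dl : R, 0 < dl & forall a b, s <= a -> a < b -> b <= t ->
    b - a < dl -> `|D a b| <= e * (b - a)) ->
  (forall a, D a a = 0) ->
  \sum_(0 <= k < m.+1) D (upart s t m k) (upart s t m k.+1) @[m --> \oo] --> (0 : R).
Proof.
rewrite le_eqVlt => /predU1P[<- _ D0|st HD _].
  rewrite (_ : (fun m => _) = cst 0); first exact: cvg_cst.
  apply/funext => m; apply: big1 => k _; rewrite /upart subrr !mul0r; exact: D0.
apply/cvgrPdist_le => e e0.
have ts : 0 < t - s by rewrite subr_gt0.
have [dl dl0 HDdl] := HD (e / (t - s)) (divr_gt0 e0 ts).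
near=> m; rewrite sub0r normrN; apply: le_trans (ler_norm_sum _ _ _) _.
apply: (@le_trans _ _ (\sum_(0 <= k < m.+1) e / m.+1%:R)); last first.
  by rewrite sumr_const_nat subn0 -[_ *+ _]mulr_natr divfK// pnatr_eq0.
rewrite big_nat [leRHS]big_nat; apply: ler_sum => k /andP[_ km].
have /andP[h1 h2] := upart_itv (ltW st) (ltnW km).
have /andP[h3 h4] := upart_itv (ltW st) km.
apply: le_trans (HDdl _ _ h1 (upart_lt _ _ st) h4 _) _; rewrite upartS.
  rewrite ltr_pdivrMr// mulrC -ltr_pdivrMr//.
  apply: (@lt_le_trans _ _ m%:R); last by rewrite ler_nat.
  by near: m; exact: nbhs_infty_gtr.
by rewrite mulrA divfK// gt_eqF.
Unshelve. all: by end_near. Qed.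

End riemann_sums.

(** * Integrating factors and the pathwise equation *)

Section integrating_factor.
Context {R : realType}.
Implicit Types f E q y : R -> R.

(* q is the clock of the martingale E y when y solves dy = dB - f y dt. *)
Record integrating_factor f E q : Prop := {
  if_continuous : forall t, -1 < t < 1 -> {for t, continuous f};
  if_ge0 : forall t, 0 <= t < 1 -> 0 <= f t;
  if_derive : forall t : R, -1 < t < 1 -> is_derive t 1 E (f t * E t);
  if_gt0 : forall t, 0 <= t < 1 -> 0 < E t;
  if_clock : forall t : R, -1 < t < 1 -> is_derive t 1 q (E t ^+ 2);
  if_clock0 : q 0 = 0
}.

Variables (f E q : R -> R).
Hypothesis H : integrating_factor f E q.

Lemma if_continuousE t : -1 < t < 1 -> {for t, continuous E}.
Proof.
move=> t1; apply: differentiable_continuous; apply/derivable1_diffP.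
by have [] := if_derive H t1.
Qed.

Lemma if_continuousq t : -1 < t < 1 -> {for t, continuous q}.
Proof.
move=> t1; apply: differentiable_continuous; apply/derivable1_diffP.
by have [] := if_clock H t1.
Qed.

Lemma if_within_continuous (g : R -> R) T : (forall t, -1 < t < 1 -> {for t, continuous g}) ->
  T < 1 -> {within `[0, T], continuous g}.
Proof.
move=> cg T1; apply: continuous_in_subspaceT => t; rewrite inE/= in_itv/= => /andP[t0 tT].
by apply: cg; rewrite (lt_le_trans _ t0) ?ltrN10// (le_lt_trans tT).
Qed.

Lemma if_clock_le s t : 0 <= s -> s <= t -> t < 1 -> q s <= q t.
Proof.
move=> s0 st t1.
apply: (ger0_derive_le (dg := fun x => E x ^+ 2) st) => x xst; last exact: sqr_ge0.
by apply: (if_clock H); lra.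
Qed.

Lemma cvg_clock_sum s t : 0 <= s -> s <= t -> t < 1 ->
  \sum_(0 <= k < m.+1) E (upart s t m k) ^+ 2 * (upart s t m k.+1 - upart s t m k)
    @[m --> \oo] --> q t - q s.
Proof.
move=> s0 st t1.
have cE := if_within_continuous if_continuousE t1.
have cq := if_within_continuous if_continuousq t1.
have [C C0 EC] := compact_within_bounded (@segment_compact R 0 t) cE.
pose D (a b : R) := (q b - q a) - E a ^+ 2 * (b - a).
have : \sum_(0 <= k < m.+1) D (upart s t m k) (upart s t m k.+1) @[m --> \oo] --> (0 : R).
  apply: cvg_upart_sum => //; last by move=> a; rewrite /D !subrr mulr0 subrr.
  move=> e e0.
  (* [2 * C] bounds [E c + E a] in the factorisation of the difference of squares. *)
  have [dl dl0 dlP] := compact_unif_continuous (@segment_compact R 0 t) cE (divr_gt0 e0 (mulr_gt0 (ltr0n R 2) C0)).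
  exists dl => // a b sa ab bt bad.
  have [x||c cab qE] := @MVT R q (fun x => E x ^+ 2) a b ab.
  - rewrite in_itv/= => /andP[ax xb]; apply: (if_clock H).
    by lra.
  - apply: continuous_subspaceW cq; apply: subset_itv; rewrite bnd_simp//.
    exact: le_trans sa.
  rewrite /D qE -mulrBl normrM [`|b - a|]ger0_norm ?subr_ge0 ?(ltW ab)// ler_pM2r ?subr_gt0//.
  move: cab; rewrite in_itv/= => /andP[ac cb].
  have c_t : `[0, t]%classic c by rewrite /= in_itv/=; lra.
  have a_t : `[0, t]%classic a by rewrite /= in_itv/=; lra.
  have := dlP c a c_t a_t; rewrite /ball/= gtr0_norm ?subr_gt0// => /(_ ltac:(lra)) h.
  have := EC c c_t; have := EC a a_t => h1 h2.
  rewrite subr_sqr normrM.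
  have h3 : `|E c + E a| <= 2 * C by rewrite (le_trans (ler_normD _ _))//; lra.
  apply: (@le_trans _ _ (e / (2 * C) * (2 * C))); first by rewrite ler_pM// ltW.
  by rewrite divfK// gt_eqF// mulr_gt0.
move/(cvgB (cvg_cst (q t - q s))); rewrite subr0; apply: cvg_trans; apply: near_eq_cvg.
apply: nearW => m; rewrite !fctE /D/= sumrB (telescope_sumr (fun k => q (upart s t m k)))//.
by rewrite upart0 upart_last opprB addrC subrK.
Qed.

Section path.
Variables y B : R -> R.
Hypothesis cy : {within `[0, 1[, continuous y}.
Hypothesis yE : forall t, 0 <= t < 1 ->
  y t = B t - \int[lebesgue_measure]_(s in `[0, t]) (f s * y s).

Let U (t : R) : R := \int[lebesgue_measure]_(s in `[0, t]) (f s * y s).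

Let cyT T : T < 1 -> {within `[0, T], continuous y}.
Proof.
by move=> T1; apply: continuous_subspaceW cy; apply: subset_itvl; rewrite bnd_simp.
Qed.

Let cfyT T : T < 1 -> {within `[0, T], continuous (fun s => f s * y s)}.
Proof.
move=> T1 x; apply: cvgM; last exact: cyT.
by apply: if_within_continuous => //; exact: if_continuous H.
Qed.

Let ifyT T : T < 1 ->
  lebesgue_measure.-integrable `[0, T] (EFin \o (fun s => f s * y s)).
Proof.
by move=> T1; apply: continuous_compact_integrable; [exact: segment_compact|exact: cfyT].
Qed.

Let cU T : T < 1 -> {within `[0, T], continuous U}.
Proof.
move=> T1; have [T0|T0] := leP 0 T; first by apply: parameterized_integral_continuous => //; exact: ifyT.
rewrite set_itv_ge ?bnd_simp -?ltNge//.
by apply: continuous_in_subspaceT => x; rewrite inE.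
Qed.

Let dU (t : R) : 0 < t < 1 -> is_derive t 1 U (f t * y t).
Proof.
move=> /andP[t0 t1].
pose T := (t + 1) / 2.
have tT : t < T by rewrite /T; lra.
have T1 : T < 1 by rewrite /T; lra.
have ct : {for t, continuous (fun s => f s * y s)}.
  apply: (@within_continuous_continuous _ _ _ 0 T) => //; [lra|exact: cfyT|].
  by rewrite in_itv/= t0.
have [dU eU] := continuous_FTC1_closed tT (ifyT T1) t0 ct.
by rewrite derive1E in eU; exact: (DeriveDef dU eU).
Qed.

(** Since [B] is not differentiable, it is eliminated through [y = B - U]. The left-hand side is
    then the increment of a function of [r] in which [y b] and [E a] are frozen and only [E] and [U]
    vary, and the mean value theorem applies. *)
Lemma sde_local a b : 0 <= a -> a < b -> b < 1 ->
  exists2 c, a < c < b & E b * y b - E a * y a - E a * (B b - B a) =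
    f c * (E c * y b - E a * y c) * (b - a).
Proof.
move=> a0 ab b1.
have [x||c cab] := @MVT R (fun r => E r * y b - E a * U r)
    (fun c => f c * (E c * y b - E a * y c)) a b ab.
- rewrite in_itv/= => /andP[ax xb].
  have dE : is_derive x 1 E (f x * E x) by apply: (if_derive H); lra.
  have dUx : is_derive x 1 U (f x * y x) by apply: dU; lra.
  apply: is_derive_eq.
  by rewrite /GRing.scale/= !(mulr0, addr0, scaler0); ring.
- apply: continuous_subspaceW (_ : `[a, b] `<=` `[0, b]) _.
    by apply: subset_itvr; rewrite bnd_simp.
  move=> x; apply: cvgB; apply: cvgM; try exact: cvg_cst.
    by apply: if_within_continuous => //; exact: if_continuousE.
  exact: cU.
move: cab; rewrite in_itv/= => cab' h; exists c => //; rewrite -h.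
have := yE (t := a) ltac:(lra); have := yE (t := b) ltac:(lra).
by rewrite -/(U a) -/(U b) => -> ->; ring.
Qed.

(** Pathwise form of d(E y) = E dB. By [sde_local] the error of one step is its length times a
    quantity that is small by uniform continuity of [E] and [y]. *)
Lemma cvg_sde_sum s t : 0 <= s -> s <= t -> t < 1 ->
  \sum_(0 <= k < m.+1) E (upart s t m k) * (B (upart s t m k.+1) - B (upart s t m k))
    @[m --> \oo] --> E t * y t - E s * y s.
Proof.
move=> s0 st t1.
have cE := if_within_continuous if_continuousE t1.
have cf := if_within_continuous (if_continuous H) t1.
have [C C0 EC] := compact_within_bounded (@segment_compact R 0 t) cE.
have [F F0 fF] := compact_within_bounded (@segment_compact R 0 t) cf.
have [Y Y0 yY] := compact_within_bounded (@segment_compact R 0 t) (cyT t1).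
pose D (a b : R) := E b * y b - E a * y a - E a * (B b - B a).
have : \sum_(0 <= k < m.+1) D (upart s t m k) (upart s t m k.+1) @[m --> \oo] --> (0 : R).
  apply: cvg_upart_sum => //; last by move=> a; rewrite /D !subrr mulr0 subrr.
  move=> e e0.
  (* [F], [C] and [Y] bound [f], [E] and [y]; the local error is [f c] times a sum of two products,
     bounded by [(C + Y) * e']. *)
  pose e' := e / (F * (C + Y)).
  have e'0 : 0 < e' by rewrite divr_gt0// mulr_gt0// addr_gt0.
  have [d1 d10 d1P] := compact_unif_continuous (@segment_compact R 0 t) cE e'0.
  have [d2 d20 d2P] := compact_unif_continuous (@segment_compact R 0 t) (cyT t1) e'0.
  exists (Num.min d1 d2); first by rewrite lt_min d10.
  move=> a b sa ab bt; rewrite lt_min => /andP[ad1 ad2].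
  have a0 : 0 <= a by exact: le_trans sa.
  have [c /andP[ac cb] DE] := sde_local a0 ab (le_lt_trans bt t1).
  rewrite /D DE normrM [`|b - a|]ger0_norm ?subr_ge0 ?(ltW ab)// ler_pM2r ?subr_gt0//.
  have c_t : `[0, t]%classic c by rewrite /= in_itv/=; lra.
  have a_t : `[0, t]%classic a by rewrite /= in_itv/=; lra.
  have b_t : `[0, t]%classic b by rewrite /= in_itv/=; lra.
  have := d1P c a c_t a_t; rewrite /ball/= gtr0_norm ?subr_gt0// => /(_ ltac:(lra)) h1.
  have := d2P b c b_t c_t; rewrite /ball/= gtr0_norm ?subr_gt0// => /(_ ltac:(lra)) h2.
  have := EC c c_t; have := fF c c_t; have := yY c c_t => hy hf hE.
  have -> : E c * y b - E a * y c = E c * (y b - y c) + y c * (E c - E a) by ring.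
  rewrite normrM.
  have h3 : `|E c * (y b - y c) + y c * (E c - E a)| <= (C + Y) * e'.
    rewrite (le_trans (ler_normD _ _))// !normrM mulrDl.
    by apply: lerD; apply: ler_pM => //; exact: ltW.
  apply: (@le_trans _ _ (F * ((C + Y) * e'))); first by rewrite ler_pM.
  by rewrite /e' mulrA [_ * (e / _)]mulrC divfK// gt_eqF// mulr_gt0// addr_gt0.
move/(cvgB (cvg_cst (E t * y t - E s * y s))); rewrite subr0.
apply: cvg_trans; apply: near_eq_cvg.
apply: nearW => m; rewrite !fctE /D/= sumrB.
rewrite (telescope_sumr (fun k => E (upart s t m k) * y (upart s t m k)))//.
by rewrite upart0 upart_last opprB addrC subrK.
Qed.

(* With u = y - B and w = u + B 1, the function E (w + e) is nondecreasing and
   E (w - e) nonincreasing near 1, because |B - B 1| <= e there. *)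
Lemma sde_end : {within `[0, +oo[, continuous B} ->
  E t @[t --> 1^'-] --> +oo -> y t @[t --> 1^'-] --> (0 : R).
Proof.
move=> cB Eoo.
have B1 : B t @[t --> 1^'-] --> B 1.
  move: cB => /continuous_within_itvcyP[/(_ 1) + _].
  by rewrite in_itv/= ltr01 => /(_ isT) /cvg_at_left_filter.
apply/cvgrPdist_le => e e0.
have e4 : 0 < e / 4 by rewrite divr_gt0.
have /cvgrPdist_le/(_ _ e4) hB := B1.
have [t0 [t00 t01 ht0]] : exists t0 : R, [/\ 0 < t0, t0 < 1 &
    forall t, t0 <= t -> t < 1 -> `|B 1 - B t| <= e / 4].
  move: hB => [r /= r0 hr]; exists (Num.max (1 - r / 2) 2^-1); split.
  - by rewrite lt_max invr_gt0 ltr0n orbT.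
  - by rewrite gt_max invf_lt1 ?ltr1n// andbT; lra.
  - move=> t; rewrite ge_max => /andP[h1 h2] t1; apply: hr => //=.
    by rewrite gtr0_norm ?subr_gt0//; lra.
(* The sign [sg] treats both monotone functions at once: the derivative is [E f] times
   [sg * (B 1 - B) + e / 4], which is nonnegative beyond [t0]. *)
have mono (sg : R) : sg ^+ 2 = 1 -> forall t, t0 <= t -> t < 1 ->
    E t0 * (sg * (B 1 - U t0) + e / 4) <= E t * (sg * (B 1 - U t) + e / 4).
  move=> sg2 t tt0 t1.
  have sg1 : `|sg| = 1.
    by apply/eqP; rewrite -(@eqrXn2 _ 2)// ?real_normK ?num_real// sg2 expr1n.
  apply: (@ger0_derive_le _ (fun x => E x * (sg * (B 1 - U x) + e / 4))
    (fun x => E x * f x * (sg * (B 1 - B x) + e / 4)) _ _ tt0) => x /andP[ax xb].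
    have dE : is_derive x 1 E (f x * E x) by apply: (if_derive H); lra.
    have dUx : is_derive x 1 U (f x * y x) by apply: dU; lra.
    apply: is_derive_eq.
    rewrite /GRing.scale/= !(mulr0, addr0, scaler0).
    have -> : y x = B x - U x by apply: yE; lra.
    by ring.
  have E0 : 0 < E x by apply: (if_gt0 H); lra.
  have f0 : 0 <= f x by apply: (if_ge0 H); lra.
  apply: mulr_ge0; first by rewrite mulr_ge0// ltW.
  have := ht0 x ax (le_lt_trans xb t1).
  rewrite -[`|_|]mul1r -sg1 -normrM ler_norml => /andP[]; lra.
(* Both monotone functions start from a value at least [- K]; after division by [E t >= 4 * K / e]
   this costs at most [e / 4]. *)
pose K := `|E t0 * (B 1 - U t0)|.
near=> t.
have t1 : t < 1 by near: t; exact: nbhs_left_lt.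
have tt0 : t0 <= t by near: t; exact: nbhs_left_ge.
have E0 : 0 < E t by apply: (if_gt0 H); lra.
have EK : 4 * K / e <= E t by near: t; move/cvgryPge : Eoo; exact.
have hK : K <= e / 4 * E t.
  by move: EK; rewrite ler_pdivrMr// mulrC; lra.
have lo (sg : R) : sg ^+ 2 = 1 -> - K <= sg * (E t0 * (B 1 - U t0)) -> - (e / 2) <= sg * (B 1 - U t).
  move=> sg2 hsg; have h := mono sg sg2 t tt0 t1.
  have Ee : 0 <= E t0 * (e / 4) by rewrite mulr_ge0 ?ltW// (if_gt0 H)//; lra.
  have : - (e / 4 * E t) <= E t * (sg * (B 1 - U t) + e / 4) by lra.
  rewrite [E t * _]mulrC -mulNr ler_pM2r//; lra.
have /andP[k1 k2] : - K <= E t0 * (B 1 - U t0) <= K by rewrite -ler_norml.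
have := lo 1 (expr1n _ _) ltac:(lra).
have := lo (- 1) ltac:(by rewrite sqrrN expr1n) ltac:(lra) => l2 l1.
have := ht0 t tt0 t1; rewrite ler_norml => /andP[b1 b2].
rewrite sub0r normrN (yE (t := t) ltac:(lra)) -/(U t) ler_norml.
by apply/andP; split; lra.
Unshelve. all: by end_near. Qed.

End path.

End integrating_factor.

(** * The Gaussian martingale *)

Lemma cvg_sum (R : realType) (V : normedModType R) (T I : Type) (F : set_system T)
    (r : seq I) (f : I -> T -> V) (a : I -> V) : Filter F ->
  (forall i, f i x @[x --> F] --> a i) ->
  \sum_(i <- r) f i x @[x --> F] --> \sum_(i <- r) a i.
Proof.
move=> FF fa; apply: (@cvg_big _ _ _ _ predT) => //; exact: add_continuous.
Qed.

Section ae.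
Context d (T : measurableType d) (R : realType) (P : probability T R).

Lemma ae_eq_measure (A B : set T) : measurable A -> measurable B ->
  {ae P, forall w, A w <-> B w} -> P A = P B.
Proof.
move=> mA mB [N [mN N0 sub]].
have key (C D : set T) : measurable C -> measurable D ->
    (forall w, ~ N w -> C w -> D w) -> (P C <= P D)%E.
  move=> mC mD h; apply: (@le_trans _ _ (P (D `|` N))).
    apply: le_measure; rewrite ?inE//; first exact: measurableU.
    by move=> w Cw; have [Nw|nNw] := pselect (N w); [right|left; exact: h].
  by rewrite measureU0.
have h w : ~ N w -> (A w <-> B w).
  by move=> nN; apply: contrapT => nAB; apply: nN; exact: sub.
by apply/eqP; rewrite eq_le !key// => w /h[].
Qed.

Lemma ae_gaussian (X Y : T -> R) s : measurable_fun setT X -> measurable_fun setT Y ->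
  {ae P, forall w, X w = Y w} -> gaussian P X s -> gaussian P Y s.
Proof.
move=> mX mY XY gX A mA; rewrite -gX//.
apply: ae_eq_measure.
- by rewrite -[X in measurable X]setTI; exact: mY.
- by rewrite -[X in measurable X]setTI; exact: mX.
- by apply: filterS XY => w E; rewrite /preimage/= E.
Qed.

End ae.

Section limit_version.
Context {R : realType}.

(** A representative of a limit that exists only almost everywhere. As an upper limit it is
    measurable for the very sigma-algebra of the approximations, with no completion. *)
Definition limit_version (T : Type) (X : nat -> T -> R) (w : T) : R :=
  fine (limn_esup (fun m => (X m w)%:E)).

Lemma measurable_limit_version d (T : measurableType d) (X : nat -> T -> R) :
  (forall m, measurable_fun setT (X m)) -> measurable_fun setT (limit_version X).
Proof.
move=> mX; apply: (measurableT_comp (fine_measurable measurableT)).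
by apply: (@measurable_fun_limn_esup _ T R setT (fun m w => (X m w)%:E)) => m; exact/measurable_EFinP.
Qed.

Lemma limit_versionE T (X : nat -> T -> R) w l : X m w @[m --> \oo] --> l ->
  limit_version X w = l.
Proof.
move=> Xl.
have Xl' : (X m w)%:E @[m --> \oo] --> l%:E by apply: (cvg_comp _ EFin Xl).
by rewrite /limit_version limn_esup_lim; have /cvg_lim -> := cvg_esups Xl'.
Qed.

End limit_version.

Section martingale.
Context {R : realType} (n : nat) d (T : measurableType d) (P : probability T R).
Variables (B y : R -> T -> 'rV[R]_n) (f E q : R -> R).
Hypothesis bm : brownian_motion P B.
Hypothesis sde : sde_solution P B f y.
Hypothesis ifE : integrating_factor f E q.
Hypothesis n_gt0 : (0 < n)%N.

(** The value 0 outside [0, 1[ makes every coordinate measurable for all [t], where the equation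
    gives no information on [y]. *)
Definition sde_martingale (t : R) (w : T) : 'rV[R]_n :=
  if 0 <= t < 1 then E t *: y t w else 0.
Let M := sde_martingale.

Lemma measurable_sde_coord t i : 0 <= t < 1 -> measurable_fun setT (fun w => y t w 0 i).
Proof.
move=> t01.
exact: (measurableT_comp (@measurable_coord R n i) (sde_measurable sde t01)).
Qed.

Lemma measurable_martingale_coord t i : measurable_fun setT (fun w => M t w 0 i).
Proof.
have [t01|/negbTE t01] := boolP (0 <= t < 1); last first.
  under eq_fun do rewrite /M /sde_martingale t01 mxE; exact: measurable_cst.
under eq_fun do rewrite /M /sde_martingale t01 mxE.
by apply: measurable_funM; [exact: measurable_cst|exact: measurable_sde_coord].
Qed.

Lemma measurable_martingale_diff s t :
  measurable_fun setT ((fun w => M t w - M s w) : T -> borelType 'rV[R]_n).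
Proof.
apply: measurable_rV => i; under eq_fun do rewrite !mxE.
by apply: measurable_funB; exact: measurable_martingale_coord.
Qed.

Lemma sde_path_ae : {ae P, forall w, forall i,
  [/\ {within `[0, 1[, continuous (fun t => y t w 0 i)},
      {within `[0, +oo[, continuous (fun t => B t w 0 i)} &
      forall t, 0 <= t < 1 -> y t w 0 i =
        B t w 0 i - \int[lebesgue_measure]_(s in `[0, t]) (f s * y s w 0 i)]}.
Proof.
have cont (D : set R) (g : R -> 'rV[R]_n) i : {within D, continuous g} ->
    {within D, continuous (fun t => g t 0 i)}.
  move=> cg x; apply: (cvg_comp g (fun u : 'rV[R]_n => u 0 i)); first exact: cg.
  exact: coord_continuous.
move: (sde_continuous sde) (bm_continuous bm) (sde_equation sde).
apply: filterS3 => w h1 h2 h3 i; split; [exact: cont|exact: cont|].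
by move=> t t01; exact: h3.
Qed.

Definition riemann_increment s t i (m : nat) (w : T) : R :=
  \sum_(0 <= k < m.+1) E (upart s t m k) *
    (B (upart s t m k.+1) w - B (upart s t m k) w) 0 i.

Lemma cvg_riemann_increment s t : 0 <= s -> s <= t -> t < 1 ->
  {ae P, forall w, forall i, riemann_increment s t i m w @[m --> \oo] -->
    (M t w - M s w) 0 i}.
Proof.
move=> s0 st t1; apply: filterS sde_path_ae => w h i; have [cy cB yE] := h i.
have := cvg_sde_sum ifE cy yE s0 st t1.
rewrite /M /sde_martingale s0 (le_lt_trans st t1) (le_trans s0 st) t1/= !mxE.
apply: cvg_trans; apply: near_eq_cvg; apply: nearW => m.
by apply: eq_bigr => k _; rewrite !mxE.
Qed.

Lemma martingale0_ae : {ae P, forall w, M 0 w = 0}.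
Proof.
apply: filterS (sde_start sde) => w y0.
by rewrite /M /sde_martingale lexx ltr01/= y0 scaler0.
Qed.

(** The variances of the Riemann sums converge to the clock by [cvg_clock_sum] and to the variance
    of the limit by [gaussian_limit]. Taking all linear combinations of coordinates makes the
    increment an isotropic Gaussian vector. *)
Lemma gaussian_martingale_increment s t (c : 'I_n -> R) : 0 <= s -> s <= t -> t < 1 ->
  gaussian P (fun w => \sum_i c i * (M t w - M s w) 0 i)
    (Num.sqrt ((\sum_i c i ^+ 2) * (q t - q s))).
Proof.
move=> s0; rewrite le_eqVlt => /predU1P[<- _|st t1].
  rewrite subrr mulr0 sqrtr0 (_ : (fun w => _) = cst 0); first exact: gaussian0.
  by apply/funext => w; rewrite subrr big1// => i _; rewrite mxE mulr0.
pose X m w := \sum_i c i * riemann_increment s t i m w.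
pose sd m := Num.sqrt ((\sum_i c i ^+ 2) *
  \sum_(0 <= k < m.+1) E (upart s t m k) ^+ 2 * (upart s t m k.+1 - upart s t m k)).
have up0 m : 0 <= upart s t m 0 by rewrite upart0.
have upS m k : (k < m.+1)%N -> upart s t m k < upart s t m k.+1 by move=> _; exact: upart_lt.
pose inc m (ki : 'I_m.+1 * 'I_n) := bm_increment B (upart s t m) ki.
have XE m : X m = (fun w => \sum_(ki : 'I_m.+1 * 'I_n) (E (upart s t m ki.1) * c ki.2) * inc m ki w).
  apply/funext => w; rewrite /X /riemann_increment.
  under eq_bigr do rewrite big_mkord mulr_sumr.
  rewrite exchange_big pair_bigA/=; apply: eq_bigr => ki _.
  by rewrite /inc /bm_increment; ring.
have gX m : gaussian P (X m) (sd m).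
  rewrite XE.
  have := gaussian_indep_sum (fun ki : 'I_m.+1 * 'I_n => E (upart s t m ki.1) * c ki.2)
    (bm_normal_convolution bm n_gt0) (measurable_bm_increment bm (up0 m) (upS m))
    (bm_increment_indep bm (up0 m) (upS m)) (gaussian_bm_increment bm (up0 m) (upS m)).
  congr (gaussian P _ (Num.sqrt _)).
  rewrite big_mkord mulr_suml.
  under [RHS]eq_bigr do rewrite mulr_sumr.
  rewrite [RHS]exchange_big pair_bigA/=; apply: eq_bigr => ki _.
  rewrite !exprMn sqr_sqrtr; first by ring.
  by rewrite subr_ge0 ltW// upS.
have mX m : measurable_fun setT (X m).
  rewrite XE; apply: measurable_sum => ki; apply: measurable_funM => //.
  exact: (measurable_bm_increment bm (up0 m) (upS m)).
have mL : measurable_fun setT (fun w => \sum_i c i * (M t w - M s w) 0 i).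
  apply: measurable_sum => i; apply: measurable_funM => //.
  under eq_fun do rewrite !mxE.
  by apply: measurable_funB; exact: measurable_martingale_coord.
have cX : {ae P, forall w, X m w @[m --> \oo] --> \sum_i c i * (M t w - M s w) 0 i}.
  apply: filterS (cvg_riemann_increment s0 (ltW st) t1) => w h.
  by apply: cvg_sum => i; apply: cvgMr; exact: h.
have [s' [s'0 cs gL]] := gaussian_limit mX mL gX cX.
have csd : sd m ^+ 2 @[m --> \oo] --> (\sum_i c i ^+ 2) * (q t - q s).
  rewrite (_ : (fun m => _) = (fun m => (\sum_i c i ^+ 2) *
    \sum_(0 <= k < m.+1) E (upart s t m k) ^+ 2 * (upart s t m k.+1 - upart s t m k))).
    by apply: cvgMr; apply: (cvg_clock_sum ifE) => //; exact: ltW.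
  apply/funext => m; rewrite sqr_sqrtr// mulr_ge0//.
    by apply: sumr_ge0 => i _; exact: sqr_ge0.
  apply: sumr_ge0 => k _; rewrite mulr_ge0 ?sqr_ge0// subr_ge0 ltW//.
  exact: upart_lt.
have -> : (\sum_i c i ^+ 2) * (q t - q s) = s' ^+ 2 by apply: cvg_unique csd cs.
by rewrite sqrtr_sqr ger0_norm.
Qed.

Lemma measurable_bm_cylinders_diff r0 (D : set R) u v i : D u -> D v ->
  measurable_fun setT ((fun w => (B u w - B v w) 0 i) :
    g_sigma_algebraType (bm_cylinders B r0 D) -> R).
Proof.
pose V (r : R) (w : T) : R := (B r w - B r0 w) 0 i.
have mV r : D r -> measurable_fun setT (V r : g_sigma_algebraType (bm_cylinders B r0 D) -> R).
  move=> Dr _ A mA; rewrite setTI; apply: sub_sigma_algebra.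
  exact: (@cylinders1 (R * 'I_n) T _ _ (fun ri w => (B ri.1 w - B r0 w) 0 ri.2) _ (r, i)).
move=> Du Dv; rewrite (_ : (fun w => _) = V u \- V v).
  by apply: measurable_funB; exact: mV.
by apply/funext => w; rewrite /V/= !mxE; ring.
Qed.

(** Up to null sets, the values of [y] before [s] are functions of Brownian increments before [s],
    and the martingale increment is a function of those after [s]. Independence is transported from
    the Brownian sigma-algebras through these versions. *)
Lemma martingale_indep_increment s t (G : set T) (A : set (borelType 'rV[R]_n)) :
  0 <= s -> s <= t -> t < 1 -> natural_filtration (extend_at_1 y) s G ->
  measurable A ->
  (P (G `&` [set w | A (M t w - M s w)%R]) = P G * P [set w | A (M t w - M s w)%R])%E.
Proof.
move=> s0 st t1 FG mA.
have s1 : s < 1 by exact: le_lt_trans t1.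
pose C := cylinders (fun r w => (y r w : borelType 'rV[R]_n)) [set r | 0 <= r <= s].
have sC : <<s C >> G.
  apply: sub_sigma_algebra2 FG => _ [r [D [/andP[r0 rs] mD ->]]].
  rewrite /extend_at_1 (le_lt_trans rs s1).
  by apply: (@cylinders1 _ _ _ _ (fun r w => (y r w : borelType 'rV[R]_n))) => //=; rewrite r0.
have mMD := measurable_martingale_diff s t.
have mH : measurable [set w | A (M t w - M s w)%R].
  by rewrite -[X in measurable X]setTI; exact: mMD.
have mC : C `<=` measurable.
  apply: cylinders_measurable => r D /= /andP[r0 rs] mD.
  rewrite -[X in measurable X]setTI; apply: (sde_measurable sde) => //.
  by rewrite r0 (le_lt_trans rs).
apply: (indep_sigma_half mC _ _ mH _ sC); [exact: cylindersI|exact: cylindersT 0|].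
move=> _ [m [r [D [HD ->]]]].
pose T1 := g_sigma_algebraType (bm_past B s).
pose T2 := g_sigma_algebraType (bm_future B s).
(* Since [M 0] vanishes almost everywhere, dividing the increment from 0 to [r] by [E r] recovers
   [y r]. *)
pose V r w : 'rV[R]_n := \row_i (limit_version (riemann_increment 0 r i) w / E r).
pose W w : 'rV[R]_n := \row_i limit_version (riemann_increment s t i) w.
have mV r' : 0 <= r' <= s -> measurable_fun setT (V r' : T1 -> borelType 'rV[R]_n).
  move=> /andP[r0 rs]; apply: measurable_rV => i; under eq_fun do rewrite mxE.
  apply: measurable_funM; last exact: measurable_cst.
  apply: measurable_limit_version => k; rewrite /riemann_increment.
  under eq_fun do rewrite big_mkord.
  apply: measurable_sum => j; apply: measurable_funM; first exact: measurable_cst.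
  have /andP[a1 a2] := upart_itv r0 (ltnW (ltn_ord j)).
  have /andP[b1 b2] := upart_itv r0 (ltn_ord j).
  by apply: measurable_bm_cylinders_diff; rewrite /= ?a1 ?b1/= (le_trans _ rs).
have mW : measurable_fun setT (W : T2 -> borelType 'rV[R]_n).
  apply: measurable_rV => i; under eq_fun do rewrite mxE.
  apply: measurable_limit_version => k; rewrite /riemann_increment.
  under eq_fun do rewrite big_mkord.
  apply: measurable_sum => j; apply: measurable_funM; first exact: measurable_cst.
  have /andP[a1 a2] := upart_itv st (ltnW (ltn_ord j)).
  have /andP[b1 b2] := upart_itv st (ltn_ord j).
  exact: measurable_bm_cylinders_diff.
have ae_W : {ae P, forall w, M t w - M s w = W w}.
  apply: filterS (cvg_riemann_increment s0 st t1) => w h.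
  by apply/rowP => i; rewrite [RHS]mxE (limit_versionE (h i)).
have aeV : {ae P, forall w, forall k, (k < m)%N -> y (r k) w = V (r k) w}.
  apply: ae_foralln => k; have [km|_] := boolP (k < m)%N; last exact: aeW.
  have [/= /andP[r0 rs] _] := HD k km.
  have r1 : r k < 1 by exact: le_lt_trans s1.
  apply: filterS2 martingale0_ae (cvg_riemann_increment (lexx 0) r0 r1) => w M0 h _.
  apply/rowP => i; rewrite [RHS]mxE (limit_versionE (h i)) M0 subr0.
  rewrite /M /sde_martingale r0 r1/= mxE mulrAC divff ?mul1r// gt_eqF//.
  by apply: (if_gt0 ifE); rewrite r0.
set G0 := \bigcap_(k in _) _.
pose G' := \bigcap_(k in [set k | (k < m)%N]) (V (r k) @^-1` D k).
pose H' := W @^-1` A.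
have sG' : <<s bm_past B s >> G'.
  apply: (@bigcap_measurableType _ T1) => k /= km.
  have [rs mD] := HD k km.
  by rewrite -[X in measurable X]setTI; exact: mV.
have sH' : <<s bm_future B s >> H' by exact: (sub_sigma_preimage mW).
have mG' : measurable G' := sub_sigma_measurable (@measurable_bm_past _ _ _ _ _ _ bm s) sG'.
have mH' : measurable H' := sub_sigma_measurable (@measurable_bm_future _ _ _ _ _ _ bm s s0) sH'.
have mG0 : measurable G0 by apply: mC; exists m, r, D.
have EG : P G0 = P G'.
  apply: ae_eq_measure => //; apply: filterS aeV => w h; split => h' k /= km.
    by rewrite /preimage/= -h//; exact: h'.
  by rewrite /preimage/= h//; exact: h'.
have EH : P [set w | A (M t w - M s w)%R] = P H'.
  by apply: ae_eq_measure => //; apply: filterS ae_W => w h; rewrite /= h.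
have EGH : P (G0 `&` [set w | A (M t w - M s w)%R]) = P (G' `&` H').
  apply: ae_eq_measure; [exact: measurableI|exact: measurableI|].
  apply: filterS2 aeV ae_W => w h1 h2; rewrite /H' /setI/= h2.
  split=> -[h3 h4]; split => // k /= km.
    by rewrite /preimage/= -h1//; exact: h3.
  by rewrite /preimage/= h1//; exact: h3.
rewrite EG EH EGH.
exact: (bm_indep_past_future bm n_gt0 s0).
Qed.

Lemma measurable_martingale_filtration s r i : 0 <= r <= s -> s < 1 ->
  measurable_fun setT ((fun w => M r w 0 i) : g_sigma_algebraType
    [set G | exists (r : R) (A : set (borelType 'rV[R]_n)),
       [/\ 0 <= r <= s, measurable A & G = extend_at_1 y r @^-1` A]] -> R).
Proof.
move=> /andP[r0 rs] s1.
have r1 : r < 1 by exact: le_lt_trans s1.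
rewrite (_ : (fun w => M r w 0 i) = (fun w => E r * y r w 0 i)); last first.
  by apply/funext => w; rewrite /M /sde_martingale r0 r1/= mxE.
apply: measurable_funM; first exact: measurable_cst.
apply: (measurableT_comp (@measurable_coord R n i)).
move=> _ D mD; rewrite setTI; apply: sub_sigma_algebra.
by exists r, D; split; rewrite ?r0// /extend_at_1 r1.
Qed.

(** Induction on [p]: the partial sum is measurable for the filtration at [t p], hence independent
    of the last increment. Coefficients may vary with the step, which summation by parts will
    require. *)
Lemma gaussian_martingale_sum p (t : nat -> R) (c : nat -> 'I_n -> R) :
  0 <= t 0%N -> (forall k, (k < p)%N -> t k <= t k.+1) -> t p < 1 ->
  gaussian P (fun w => \sum_(0 <= k < p) \sum_i c k i * (M (t k.+1) w - M (t k) w) 0 i)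
    (Num.sqrt (\sum_(0 <= k < p) (\sum_i c k i ^+ 2) * (q (t k.+1) - q (t k)))).
Proof.
move=> t0; elim: p => [_ _|p IH tS t1].
  rewrite big_geq// sqrtr0 (_ : (fun w => _) = cst 0); first exact: gaussian0.
  by apply/funext => w; rewrite big_geq.
have tmono j k : (j <= k)%N -> (k <= p.+1)%N -> t j <= t k.
  elim: k => [|k IHk]; first by rewrite leqn0 => /eqP->.
  rewrite leq_eqVlt => /predU1P[->//|jk] kp.
  by apply: le_trans (tS k kp); apply: IHk => //; exact: ltnW.
have tp0 : 0 <= t p by apply: le_trans t0 _; exact: tmono.
have tpp : t p <= t p.+1 by exact: tS.
have tp1 : t p < 1 by exact: le_lt_trans t1.
have {}IH := IH (fun k kp => tS k (ltnW kp)) tp1.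
set X := (fun w => _) in IH.
pose Y w := \sum_i c p i * (M (t p.+1) w - M (t p) w) 0 i.
rewrite (_ : (fun w => _) = X \+ Y); last first.
  by apply/funext => w; rewrite big_nat_recr.
have qpos k : (k <= p)%N -> 0 <= (\sum_i c k i ^+ 2) * (q (t k.+1) - q (t k)).
  move=> kp; rewrite mulr_ge0//; first by apply: sumr_ge0 => i _; exact: sqr_ge0.
  rewrite subr_ge0; apply: (if_clock_le ifE); [|exact: tS|].
    by apply: le_trans t0 _; apply: tmono => //; exact: leqW.
  by apply: le_lt_trans t1; exact: tmono.
rewrite big_nat_recr//=.
have mX : measurable_fun setT X.
  rewrite /X; under eq_fun do rewrite big_mkord.
  apply: measurable_sum => k; apply: measurable_sum => i; apply: measurable_funM => //.
  under eq_fun do rewrite !mxE.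
  by apply: measurable_funB; exact: measurable_martingale_coord.
have mL : measurable_fun setT ((fun u : 'rV[R]_n => \sum_i c p i * u 0 i) : borelType 'rV[R]_n -> R).
  apply: measurable_sum => i; apply: measurable_funM => //; exact: measurable_coord.
have mY : measurable_fun setT Y.
  exact: (measurableT_comp mL (measurable_martingale_diff (t p) (t p.+1))).
have gY := gaussian_martingale_increment (c p) tp0 tpp t1.
rewrite -/Y in gY.
have ind : forall A1 A2 : set R, measurable A1 -> measurable A2 ->
    P (X @^-1` A1 `&` Y @^-1` A2) = (P (X @^-1` A1) * P (Y @^-1` A2))%E.
  move=> A1 A2 mA1 mA2.
  rewrite (_ : Y @^-1` A2 = [set w | ((fun u : 'rV[R]_n => \sum_i c p i * u 0 i) @^-1` A2)
    (M (t p.+1) w - M (t p) w)])//.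
  apply: (martingale_indep_increment tp0 tpp t1); last first.
    by rewrite -[X in measurable X]setTI; exact: mL.
  pose C := [set G | exists (r : R) (A : set (borelType 'rV[R]_n)),
         [/\ 0 <= r <= t p, measurable A & G = extend_at_1 y r @^-1` A]].
  have mXF : measurable_fun setT (X : g_sigma_algebraType C -> R).
    rewrite /X; under eq_fun do rewrite big_mkord.
    apply: measurable_sum => k; apply: measurable_sum => i; apply: measurable_funM => //.
    under eq_fun do rewrite !mxE.
    have mk j : (j <= p)%N -> 0 <= t j <= t p.
      move=> jp; rewrite (tmono j p)// ?andbT; apply: le_trans t0 _.
      by apply: tmono => //; exact: leqW.
    apply: measurable_funB; apply: (measurable_martingale_filtration (s := t p)) => //.
      exact: (mk _ (ltn_ord k)).
    exact: (mk _ (ltnW (ltn_ord k))).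
  exact: (sub_sigma_preimage mXF).
have := gaussianD (bm_normal_convolution bm n_gt0) mX mY ind IH gY.
rewrite !sqr_sqrtr//; first exact: qpos.
by rewrite big_mkord; apply: sumr_ge0 => k _; exact/qpos/ltnW.
Qed.

End martingale.

(** * The Markov property *)

Section random_map_kernel.
Context d d1 d2 (T : measurableType d) (X : measurableType d1) (Y : measurableType d2)
  (R : realType) (P : probability T R) (g : X -> T -> Y).
Hypothesis mg : measurable_fun setT (fun xw : X * T => g xw.1 xw.2).

Let mgx x : measurable_fun setT (g x).
Proof. exact: (measurableT_comp mg (measurable_pair1 x)). Qed.

(** The law of [g x]; joint measurability of [g] gives measurability in [x] through sections. *)
Definition random_map_kernel (x : X) : {measure set Y -> \bar R} :=
  measure_function_pushforward__canonical__measure_function_Measure P (mgx x).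

Let measurable_random_map_kernel U : measurable U ->
  measurable_fun setT (random_map_kernel ^~ U).
Proof.
move=> mU.
have mC : measurable [set xw : X * T | U (g xw.1 xw.2)].
  by rewrite -[X in measurable X]setTI; exact: mg.
have := measurable_fun_xsection P mC; apply: eq_measurable_fun => x _ /=.
by congr (P _); apply/seteqP; split => w; rewrite /xsection/= inE.
Qed.

HB.instance Definition _ :=
  isKernel.Build _ _ _ _ _ random_map_kernel measurable_random_map_kernel.

Let random_map_kernel1 x : random_map_kernel x setT = 1%E.
Proof. exact: probability_setT. Qed.

HB.instance Definition _ :=
  Kernel_isProbability.Build _ _ _ _ _ random_map_kernel random_map_kernel1.

End random_map_kernel.

Section markov.
Context {R : realType} (n : nat) d (T : measurableType d) (P : probability T R).
Variables (B y : R -> T -> 'rV[R]_n) (f E q : R -> R).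
Hypothesis bm : brownian_motion P B.
Hypothesis sde : sde_solution P B f y.
Hypothesis ifE : integrating_factor f E q.
Hypothesis n_gt0 : (0 < n)%N.
Let V := borelType 'rV[R]_n.
Let M := sde_martingale y E.

Definition bridge_flow (s t : R) (x u : V) : V :=
  (E t)^-1 *: (E s *: (x : 'rV[R]_n) + (u : 'rV[R]_n)).

Lemma measurable_bridge_flow s t d' (T' : measurableType d') (X U : T' -> V) :
  measurable_fun setT X -> measurable_fun setT U ->
  measurable_fun setT (fun w => bridge_flow s t (X w) (U w)).
Proof.
move=> mX mU; apply: measurable_rV => i; under eq_fun do rewrite !mxE.
apply: measurable_funM => //; apply: measurable_funD.
  apply: measurable_funM => //.
  exact: (measurableT_comp (@measurable_coord R n i) mX).
exact: (measurableT_comp (@measurable_coord R n i) mU).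
Qed.

(** The identity outside the meaningful range, so that a kernel is defined for all pairs of
    times. *)
Definition bridge_map (s t : R) (x : V) (w : T) : V :=
  if [&& 0 <= s, s <= t & t < 1] then bridge_flow s t x (M t w - M s w) else x.

Lemma measurable_bridge_map s t :
  measurable_fun setT (fun xw : V * T => bridge_map s t xw.1 xw.2).
Proof.
rewrite /bridge_map; case: [&& _, _ & _]; last exact: measurable_fst.
apply: measurable_bridge_flow; first exact: measurable_fst.
exact: (measurableT_comp (measurable_martingale_diff E sde s t) measurable_snd).
Qed.

Definition bridge_kernel : transition_family R n :=
  fun s t => random_map_kernel P (@measurable_bridge_map s t).

Lemma bridge_kernelE s t x A : 0 <= s -> s <= t -> t < 1 ->
  bridge_kernel s t x A = P [set w | A (bridge_flow s t x (M t w - M s w))].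
Proof.
move=> s0 st t1; rewrite /bridge_kernel/= /random_map_kernel/= /pushforward/=.
by congr (P _); rewrite /preimage /bridge_map s0 st t1.
Qed.

Lemma measurable_bridge_map_filtration s t x : 0 <= s -> s <= t -> t < 1 ->
  measurable_fun setT ((fun w => bridge_flow s t x (M t w - M s w)) : g_sigma_algebraType
    [set G | exists (r : R) (A : set V),
       [/\ 0 <= r <= t, measurable A & G = extend_at_1 y r @^-1` A]] -> V).
Proof.
move=> s0 st t1.
apply: (measurable_bridge_flow _ _ (measurable_cst _)).
apply: measurable_rV => i.
rewrite (_ : (fun w => _) = (fun w => M t w 0 i - M s w 0 i)); last first.
  by apply/funext => w; rewrite !mxE.
by apply: measurable_funB; apply: (measurable_martingale_filtration _ (s := t)) => //;
  rewrite ?s0 ?st ?lexx ?(le_trans s0 st).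
Qed.

(** Given the past, only the martingale increment is integrated and [X] is frozen. With [X] the
    process at time [s] this is the Markov property; with [X] an earlier flow it is the
    Chapman-Kolmogorov equation. *)
Lemma bridge_pair s t (G : set T) (X : T -> V) (A : set V) : 0 <= s -> s <= t -> t < 1 ->
  natural_filtration (extend_at_1 y) s G ->
  measurable_fun setT (X : g_sigma_algebraType
    [set G | exists (r : R) (A : set V),
       [/\ 0 <= r <= s, measurable A & G = extend_at_1 y r @^-1` A]] -> V) ->
  measurable A ->
  (P (G `&` [set w | A (bridge_flow s t (X w) (M t w - M s w)%R)]) =
   \int[P]_(w in G) bridge_kernel s t (X w) A)%E.
Proof.
move=> s0 st t1 FG FX mA.
have FM : natural_filtration (extend_at_1 y) s `<=` measurable.
  apply: smallest_sub; first exact: sigma_algebra_measurable.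
  move=> _ [r [D [/andP[r0 rs] mD ->]]]; rewrite /extend_at_1.
  have r1 := le_lt_trans rs (le_lt_trans st t1).
  rewrite r1 -[X in measurable X]setTI; apply: (sde_measurable sde) => //.
  by rewrite r0 r1.
have mX : measurable_fun setT X.
  by move=> _ D mD; rewrite setTI; apply: FM; exact: (sub_sigma_preimage FX).
have mC : measurable [set vz : V * V | A (bridge_flow s t vz.1 vz.2)].
  rewrite -[X in measurable X]setTI.
  exact: (measurable_bridge_flow s t measurable_fst measurable_snd).
have ind (A1 A2 : set V) : measurable A1 -> measurable A2 ->
    (P (G `&` X @^-1` A1 `&` (fun w => M t w - M s w) @^-1` A2)%R =
     P (G `&` X @^-1` A1) * P ((fun w => M t w - M s w)%R @^-1` A2))%E.
  move=> mA1 mA2.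
  apply: (martingale_indep_increment bm sde ifE n_gt0 s0 st t1) => //.
  apply: (@measurableI _ (g_sigma_algebraType _)) => //.
  exact: (sub_sigma_preimage FX).
rewrite (indep_pair mX (measurable_martingale_diff E sde s t) (FM _ FG) ind mC).
by apply: eq_integral => w _; rewrite bridge_kernelE.
Qed.

Lemma bridge_chapman_kolmogorov : chapman_kolmogorov bridge_kernel.
Proof.
split=> [t x A /andP[t0 t1] mA|s t u x A s0 st tu u1 mA].
  rewrite bridge_kernelE//.
  rewrite (_ : [set w | _] = if x \in A then setT else set0); last first.
    have Et : E t != 0 by rewrite gt_eqF// (if_gt0 ifE)// t0.
    rewrite (_ : [set w | _] = [set _ | A x]).
      by case: ifPn; rewrite (inE, notin_setE) => h; apply/seteqP; split => w.
    by apply/funext => w /=; rewrite /bridge_flow subrr addr0 scalerA mulVf// scale1r.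
  by rewrite diracE; case: ifPn => _; rewrite ?probability_setT ?measure0.
have t0 := le_trans s0 st; have t1 := le_lt_trans tu u1; have su := le_trans st tu.
have mK : measurable_fun setT (bridge_kernel t u ^~ A) by exact: measurable_kernel.
have mb : measurable_fun setT (fun w => bridge_flow s t x (M t w - M s w)).
  apply: (measurable_bridge_flow _ _ (measurable_cst _)).
  exact: (measurable_martingale_diff E sde s t).
have := bridge_pair t0 tu u1 _ (measurable_bridge_map_filtration x s0 st t1) mA.
move=> /(_ setT (@measurableT _ (g_sigma_algebraType _))).
rewrite setTI => e.
rewrite bridge_kernelE//.
(* Flow property: the two steps driven by the same martingale compose to one step from [s] to
   [u]. *)
transitivity (P [set w | A (bridge_flow t u (bridge_flow s t x (M t w - M s w)) (M u w - M t w))]).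
  have Et : E t != 0 by rewrite gt_eqF// (if_gt0 ifE)// t0.
  congr (P _); apply/funext => w /=; congr (A _); rewrite /bridge_flow.
  by rewrite scalerA divff// scale1r -addrA (addrC (M t w - _)) subrKA.
rewrite e.
transitivity (\int[pushforward P (fun w => bridge_flow s t x (M t w - M s w))%R]_v
  bridge_kernel t u v A)%E.
  by rewrite ge0_integral_pushforward.
apply: eq_measure_integral => D mD _.
by rewrite bridge_kernelE.
Qed.

Lemma bridge_markov_property : markov_property P bridge_kernel (extend_at_1 y).
Proof.
move=> s t A G s0 st t1 mA FG; have s1 := le_lt_trans st t1.
rewrite -(bridge_pair s0 st t1 FG _ mA); last first.
  move=> _ D mD; rewrite setTI; apply: sub_sigma_algebra.
  by exists s, D; rewrite s0 lexx.
congr (P (_ `&` _)); apply/funext => w; rewrite /preimage/=; congr (A _).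
have Et : E t != 0 by rewrite gt_eqF// (if_gt0 ifE)// t1 (le_trans s0).
rewrite /extend_at_1 t1 s1 /bridge_flow /M /sde_martingale s0 s1 t1 (le_trans s0 st)/=.
by rewrite addrC subrK scalerA mulVf// scale1r.
Qed.

End markov.

(** * The generator *)

Section coord_norm.
Context {R : realType} (n : nat).
Implicit Types x : 'rV[R]_n.

Lemma coord_le_norm x i : `|x 0 i| <= `|x|.
Proof.
rewrite [leRHS]/Num.norm/= mx_normrE.
exact: (le_bigmax _ (fun ij : 'I_1 * 'I_n => `|x ij.1 ij.2|) (0, i)).
Qed.

Lemma norm_le_coord x c : 0 <= c -> (forall i, `|x 0 i| <= c) -> `|x| <= c.
Proof.
move=> c0 xc; rewrite [leLHS]/Num.norm/= mx_normrE.
by apply: bigmax_le => // -[a i] _ /=; rewrite ord1.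
Qed.

Lemma norm_lt_coord x c : 0 < c -> (forall i, `|x 0 i| < c) -> `|x| < c.
Proof.
move=> c0 xc; rewrite [ltLHS]/Num.norm/= mx_normrE.
by apply: bigmax_lt => // -[a i] _ /=; rewrite ord1.
Qed.

Lemma compact_cube c : compact [set x : 'rV[R]_n | forall i, `[- c, c]%classic (x 0 i)].
Proof. exact: (@rV_compact R n (fun=> `[- c, c]%classic) (fun=> @segment_compact _ _ _)). Qed.

End coord_norm.

Section compact_support.
Context {R : realType} (n : nat) (g : 'rV[R]_n -> R) (M : R).
Hypothesis g0 : forall x, M < `|x| -> g x = 0.
Hypothesis cg : continuous g.

Lemma compact_support_bounded : exists2 C : R, 0 < C & forall x, `|g x| <= C.
Proof.
have [C C0 gC] := compact_within_bounded (compact_cube (c := `|M| + 1)) (continuous_subspaceT cg).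
exists C => // x; have [xM|Mx] := lerP `|x| `|M|; last first.
  by rewrite g0 ?normr0 ?ltW// (le_lt_trans (ler_norm _) Mx).
apply: gC => i /=; rewrite in_itv/= -ler_norml.
by apply: le_trans (coord_le_norm x i) _; lra.
Qed.

Lemma compact_support_unif_continuous e : 0 < e -> exists2 dl : R, 0 < dl &
  forall u v : 'rV[R]_n, (forall i, `|u 0 i - v 0 i| < dl) -> `|g u - g v| <= e.
Proof.
move=> e0.
have [dl dl0 H] := compact_unif_continuous (compact_cube (c := `|M| + 1))
  (continuous_subspaceT cg) e0.
exists (Num.min dl 1); first by rewrite lt_min dl0 ltr01.
have key (u v : 'rV[R]_n) : `|u| <= `|M| -> (forall i, `|u 0 i - v 0 i| < Num.min dl 1) -> `|g u - g v| <= e.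
  move=> uM uv; apply/ltW/H => [i|i|].
  - rewrite /= in_itv/= -ler_norml; apply: le_trans (coord_le_norm u i) _; lra.
  - rewrite /= in_itv/= -ler_norml.
    have -> : v 0 i = u 0 i - (u 0 i - v 0 i) by ring.
    apply: le_trans (ler_normB _ _) _; apply: lerD.
      exact: le_trans (coord_le_norm u i) _.
    by have := uv i; rewrite lt_min => /andP[_ /ltW].
  - rewrite -ball_normE /=; apply: norm_lt_coord => // i; rewrite !mxE.
    by have := uv i; rewrite lt_min => /andP[].
move=> u v uv; have [uM|Mu] := lerP `|u| `|M|; first exact: key.
have [vM|Mv] := lerP `|v| `|M|.
  by rewrite distrC; apply: key => // i; rewrite distrC.
by rewrite !g0 ?subrr ?normr0 ?ltW// (le_lt_trans (ler_norm _)).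
Qed.

(** A dilation moves [x] by at most |a - 1| |x|, which uniform continuity controls for bounded [x].
    If |x| exceeds [D] then |a| > 1/2 keeps both points outside the support. *)
Lemma compact_support_scale e : 0 < e -> exists2 dl : R, 0 < dl &
  forall (a : R) (x : 'rV[R]_n), `|a - 1| < dl -> `|g (a *: x) - g x| <= e.
Proof.
move=> e0; have [dl dl0 H] := compact_support_unif_continuous e0.
pose D := (2 * (`|M| + 1)).
have D0 : 0 < D by have := normr_ge0 M; rewrite /D; lra.
exists (Num.min 2^-1 (dl / D)); first by rewrite lt_min divr_gt0//; lra.
move=> a x; rewrite lt_min => /andP[a1 a2].
have [xM|Mx] := lerP `|x| D.
  apply: H => i; rewrite !mxE -[X in _ - X]mul1r -mulrBl normrM.
  move: a2; rewrite ltr_pdivlMr//; apply: le_lt_trans.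
  by rewrite ler_wpM2l//; apply: le_trans (coord_le_norm x i) _.
have a2' : 2^-1 < `|a|.
  by move: a1; rewrite ltr_norml => /andP[a3 a4]; rewrite ger0_norm; lra.
rewrite !g0 ?subrr ?normr0 ?ltW//.
  by apply: le_lt_trans (ler_norm M) _; apply: lt_trans Mx; have := normr_ge0 M; rewrite /D; lra.
rewrite normrZ; apply: le_lt_trans (ler_norm M) _.
apply: lt_le_trans (_ : 2^-1 * D <= _); first by rewrite /D; lra.
by apply: ler_pM; rewrite ?ltW//; lra.
Qed.

Lemma compact_support_partial i x : M < `|x| -> partial i g x = 0.
Proof.
move=> Mx; rewrite /partial.
have gx : \forall u \near x, g u = 0.
  have : \forall u \near x, M < `|u|.
    exact: (cvgr_gt _ (@norm_continuous _ _ x)).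
  by apply: filterS => u; exact: g0.
rewrite (@near_eq_derive _ _ _ g (cst 0))//; last first.
by rewrite derive_cst.
Qed.

End compact_support.

(** * Taylor expansion along the coordinates *)

Section taylor.
Context {R : realType} (n : nat).
Implicit Types (psi phi : 'rV[R]_n -> R) (x u z v : 'rV[R]_n).

Lemma line_derive psi u v (s : R) : derivable psi (u + s *: v) v ->
  is_derive s 1 (fun r : R => psi (u + r *: v)) ('D_v psi (u + s *: v)).
Proof.
have E : (fun h : R => h^-1 *: (((fun r : R => psi (u + r *: v)) \o shift s) (h *: 1) - psi (u + s *: v)))
   = (fun h : R => h^-1 *: ((psi \o shift (u + s *: v)) (h *: v) - psi (u + s *: v))).
  apply/funext => h /=; congr (_ *: (psi _ - _)).
  by rewrite /shift/= [h%R *: 1]mulr1 scalerDl addrCA.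
by move=> dpsi; apply: DeriveDef; [rewrite /derivable E|rewrite /derive E].
Qed.

Lemma ler_mean_value (g dg : R -> R) (b eps : R) :
  (forall s : R, `|s| <= `|b| -> is_derive s 1 g (dg s)) ->
  (forall s, `|s| <= `|b| -> `|dg s| <= eps) -> `|g b - g 0| <= eps * `|b|.
Proof.
move=> Dg ge.
have cg (l r : R) : (forall s : R, l <= s <= r -> `|s| <= `|b|) ->
    {within `[l, r], continuous g}.
  move=> lr; apply: derivable_within_continuous => s; rewrite in_itv/= => /lr sb.
  by have [] := Dg s sb.
have [b0|b0|->] := ltgtP b 0; last by rewrite subrr !normr0 mulr0.
- have sb s : b <= s <= 0 -> `|s| <= `|b| by move=> h; rewrite !ler0_norm; lra.
  have [||c] := @MVT R g dg b 0 b0; [|exact: cg|].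
    by move=> s; rewrite in_itv/= => h; apply/Dg/sb; lra.
  rewrite in_itv/= => h; rewrite distrC => ->.
  by rewrite sub0r normrM normrN ler_wpM2r// ge// sb//; lra.
- have sb s : 0 <= s <= b -> `|s| <= `|b| by move=> h; rewrite !ger0_norm; lra.
  have [||c] := @MVT R g dg 0 b b0; [|exact: cg|].
    by move=> s; rewrite in_itv/= => h; apply/Dg/sb; lra.
  rewrite in_itv/= => h ->.
  by rewrite subr0 normrM ler_wpM2r// ge// sb//; lra.
Qed.

Lemma coord_taylor1 psi u k (b c eps : R) :
  (forall x, derivable psi x (delta_mx 0 k)) ->
  (forall s : R, `|s| <= `|b| -> `|partial k psi (u + s *: delta_mx 0 k) - c| <= eps) ->
  `|psi (u + b *: delta_mx 0 k) - psi u - b * c| <= eps * `|b|.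
Proof.
move=> dpsi H.
pose g s := psi (u + s *: delta_mx 0 k) - s * c.
have -> : psi (u + b *: delta_mx 0 k) - psi u - b * c = g b - g 0.
  by rewrite /g scale0r addr0 mul0r subr0; ring.
apply: (@ler_mean_value g (fun s => partial k psi (u + s *: delta_mx 0 k) - c)) => // s _.
have D1 := line_derive (dpsi (u + s *: delta_mx 0 k)).
have D2 : is_derive s 1 (fun s : R => s * c) c.
  by apply: is_derive_eq; rewrite /= [_ *: 1]mulr1 scaler0 add0r.
exact: is_deriveB.
Qed.

(** The derivative in [s] of the remainder is a first order remainder of [partial k psi], so the
    mean value inequality is used twice; hence [eps] without a factor 1/2. *)
Lemma coord_taylor2 psi u k (b c eps : R) :
  (forall x, derivable psi x (delta_mx 0 k)) ->
  (forall x, derivable (partial k psi) x (delta_mx 0 k)) ->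
  (forall s : R, `|s| <= `|b| ->
    `|partial k (partial k psi) (u + s *: delta_mx 0 k) - c| <= eps) ->
  `|psi (u + b *: delta_mx 0 k) - psi u - b * partial k psi u - 2^-1 * (b ^+ 2 * c)|
    <= eps * b ^+ 2.
Proof.
move=> dpsi dpsi2 H.
pose g s := psi (u + s *: delta_mx 0 k) - (s * partial k psi u + 2^-1 * (s ^+ 2 * c)).
have -> : psi (u + b *: delta_mx 0 k) - psi u - b * partial k psi u - 2^-1 * (b ^+ 2 * c)
    = g b - g 0.
  by rewrite /g scale0r addr0 mul0r expr0n/= mul0r mulr0 addr0 subr0; ring.
rewrite -real_normK ?num_real// expr2 mulrA.
apply: (@ler_mean_value g (fun s => partial k psi (u + s *: delta_mx 0 k) -
  (partial k psi u + s * c))) => // s sb; last first.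
  have := @coord_taylor1 (partial k psi) u k s c eps dpsi2.
  move=> h; rewrite opprD addrA; apply: le_trans (h _) _.
    by move=> r rs; apply: H; exact: le_trans sb.
  have eps0 : 0 <= eps by apply: le_trans (H 0 _); rewrite ?normr0.
  by rewrite ler_wpM2l.
have D1 := line_derive (dpsi (u + s *: delta_mx 0 k)).
have D2 : is_derive s 1 (fun s : R => s * partial k psi u + 2^-1 * (s ^+ 2 * c))
   (partial k psi u + s * c).
  apply: is_derive_eq; rewrite /GRing.scale/= !mulr1 ?mulr0 ?mul0r ?addr0 ?add0r.
  by field.
exact: is_deriveB.
Qed.

(** Vertices of a path from 0 to [z] that changes one coordinate at a time, so that only partial
    derivatives along coordinate axes are needed. *)
Definition trunc (k : nat) z : 'rV[R]_n := \row_i (if (i < k)%N then z 0 i else 0).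

Lemma trunc0 z : trunc 0 z = 0.
Proof. by apply/rowP => i; rewrite !mxE. Qed.

Lemma truncn z : trunc n z = z.
Proof. by apply/rowP => i; rewrite !mxE ltn_ord. Qed.

Lemma truncS (k : 'I_n) z : trunc k.+1 z = trunc k z + z 0 k *: delta_mx 0 k.
Proof.
apply/rowP => i; rewrite !mxE/= ltnS leq_eqVlt -val_eqE/=.
have [e|ne] /= := eqVneq (i : nat) k; last by rewrite mulr0 addr0.
by rewrite e ltnn mulr1 add0r (ord_inj e).
Qed.

Lemma trunc_coord_le k z i : `|trunc k z 0 i| <= `|z 0 i|.
Proof. by rewrite mxE; case: ifP => //; rewrite normr0. Qed.

Lemma trunc_step_le (k : 'I_n) z (s : R) i : `|s| <= `|z 0 k| ->
  `|(trunc k z + s *: delta_mx 0 k) 0 i| <= `|z 0 i|.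
Proof.
rewrite !mxE/= => sz; have [->|ik] := eqVneq i k.
  by rewrite ltnn add0r mulr1.
by rewrite mulr0 addr0; case: ifP => //; rewrite normr0.
Qed.

Lemma trunc_telescope psi x z : psi (x + z) - psi x =
  \sum_(k < n) (psi (x + trunc k z + z 0 k *: delta_mx 0 k) - psi (x + trunc k z)).
Proof.
transitivity (\sum_(0 <= k < n) (psi (x + trunc k.+1 z) - psi (x + trunc k z))).
  by rewrite telescope_sumr// truncn trunc0 addr0.
by rewrite big_mkord; apply: eq_bigr => k _; rewrite truncS addrA.
Qed.

Lemma taylor1 psi x z eps : (forall k u, derivable psi u (delta_mx 0 k)) ->
  (forall k v, (forall i, `|v 0 i| <= `|z 0 i|) ->
     `|partial k psi (x + v) - partial k psi x| <= eps) ->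
  `|psi (x + z) - psi x - \sum_k z 0 k * partial k psi x| <= eps * \sum_k `|z 0 k|.
Proof.
move=> dpsi H; rewrite trunc_telescope -sumrB mulr_sumr.
apply: le_trans (ler_norm_sum _ _ _) _; apply: ler_sum => k _.
apply: coord_taylor1 => // s sz; rewrite -addrA; apply: H => i.
exact: trunc_step_le.
Qed.

(** The sum over [j < k] of the mixed second order terms: [trunc k z] has coordinate [z 0 j] exactly
    for these [j]. In this ordered form no symmetry of the second derivatives is used. *)
Definition cross_term phi x z : R := \sum_k \sum_j
  z 0 k * (trunc k z 0 j * partial j (partial k phi) x).

(** Step [k] of the coordinate path is expanded to second order, and its slope, taken at the vertex,
    is expanded to first order around [x]. Each of these two errors is at most [eps] times [|z 0 k|]
    times the sum of absolute values, whence the factor 2. *)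
Lemma taylor2 phi x z eps : C2_compact_support phi ->
  (forall k j v, (forall i, `|v 0 i| <= `|z 0 i|) ->
     `|partial j (partial k phi) (x + v) - partial j (partial k phi) x| <= eps) ->
  `|phi (x + z) - phi x - \sum_k z 0 k * partial k phi x
    - \sum_k 2^-1 * (z 0 k ^+ 2 * partial k (partial k phi) x) - cross_term phi x z|
  <= 2 * eps * (\sum_k `|z 0 k|) ^+ 2.
Proof.
move=> C2 H; set S := \sum_k `|z 0 k|.
rewrite trunc_telescope -!sumrB expr2 mulrA [X in _ <= X](_ : _ =
    \sum_(k < n) (2 * eps * S * `|z 0 k|)); last by rewrite -mulr_sumr.
apply: le_trans (ler_norm_sum _ _ _) _; apply: ler_sum => k _.
have eps0 : 0 <= eps by apply: le_trans (H k k 0 _); rewrite // => i; rewrite mxE normr0.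
have zS : `|z 0 k| <= S by rewrite /S (bigD1 k)//= lerDl sumr_ge0.
have tS : \sum_j `|trunc k z 0 j| <= S by apply: ler_sum => j _; exact: trunc_coord_le.
have h1 := @coord_taylor2 phi (x + trunc k z) k (z 0 k) (partial k (partial k phi) x) eps
  (@c2_derivable _ _ _ C2 k) (@c2_derivable2 _ _ _ C2 k k).
have := @taylor1 (partial k phi) x (trunc k z) eps (@c2_derivable2 _ _ _ C2 k).
move=> h2.
rewrite (_ : _ - _ = (phi (x + trunc k z + z 0 k *: delta_mx 0 k) - phi (x + trunc k z)
    - z 0 k * partial k phi (x + trunc k z)
    - 2^-1 * (z 0 k ^+ 2 * partial k (partial k phi) x)) +
  z 0 k * (partial k phi (x + trunc k z) - partial k phi x -
    \sum_j trunc k z 0 j * partial j (partial k phi) x)); last first.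
  by rewrite -mulr_sumr; ring.
apply: le_trans (ler_normD _ _) _.
apply: (@le_trans _ _ (eps * z 0 k ^+ 2 + `|z 0 k| * (eps * \sum_j `|trunc k z 0 j|))).
  apply: lerD.
    by apply: h1 => s sz; rewrite -addrA; apply: H => i; exact: trunc_step_le.
  rewrite normrM ler_wpM2l//; apply: h2 => j v vz; apply: H => i.
  exact: le_trans (vz i) (trunc_coord_le _ _ _).
rewrite -real_normK ?num_real//.
have -> : 2 * eps * S * `|z 0 k| = eps * (`|z 0 k| * S) + `|z 0 k| * (eps * S) by ring.
by apply: lerD; rewrite ?expr2 ler_wpM2l// ?ler_wpM2l.
Qed.

End taylor.

Section gaussian_has_mean.
Context d (T : measurableType d) (R : realType) (P : probability T R).
Implicit Types X : T -> R.

Lemma gaussian_has_mean_pow2 X s : measurable_fun setT X -> gaussian P X s ->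
  has_mean P (fun w => X w ^+ 2) (s ^+ 2).
Proof.
move=> mX gX; apply: ge0_has_mean (gaussian_pow2 mX gX).
  exact: measurable_funX.
by move=> w; exact: sqr_ge0.
Qed.

Lemma gaussian_has_mean_pow4 X s : measurable_fun setT X -> gaussian P X s ->
  has_mean P (fun w => X w ^+ 4) (s ^+ 4 * gauss_pow4).
Proof.
move=> mX gX; apply: ge0_has_mean (gaussian_pow4 mX gX).
  exact: measurable_funX.
by move=> w; exact: exprn_even_ge0.
Qed.

(** [X] and [- X] have the same law. The comparison uses the nonnegative function x + |x|, because
    equality of integrals is available for nonnegative functions. *)
Lemma gaussian_has_mean X s : measurable_fun setT X -> gaussian P X s -> has_mean P X 0.
Proof.
move=> mX gX.
have dom : has_mean P (fun w => 1 + X w ^+ 2) (1 + s ^+ 2).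
  exact: has_meanD (has_mean_cst P 1) (gaussian_has_mean_pow2 mX gX).
have le_dom w : `|X w| <= 1 + X w ^+ 2.
  rewrite -real_normK ?num_real//; have := sqr_ge0 (`|X w| - 1); nra.
have mnX : measurable_fun setT (fun w => `|X w|) by exact: measurableT_comp.
have [m hm] := dominated_has_mean mX dom le_dom.
have [a ha] : exists a, has_mean P (fun w => `|X w|) a.
  by apply: dominated_has_mean mnX dom _ => w; rewrite normr_id.
have gNX : gaussian P (fun w => - X w) s.
  have h := gaussian_norm (gaussianZ (-1) gX).
  have h' := gaussian_norm gX.
  move=> A mA; rewrite -(gX A mA) (h' A mA); have := h A mA.
  rewrite normrM normrN1 mul1r => <-; congr (P _).
  by apply/seteqP; split => w /=; rewrite mulN1r.
have e1 := (has_meanD hm ha).2.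
have e2 := (has_meanD (has_meanN hm) ha).2.
have mphi : measurable_fun setT (fun x : R => (x + `|x|)%:E).
  apply/measurable_EFinP; apply: measurable_funD; first exact: measurable_id.
  exact: normr_measurable.
have phi0 (x : R) : (0 <= (x + `|x|)%:E)%E.
  by rewrite lee_fin -[X in _ <= X + _]opprK addrC subr_ge0 -normrN ler_norm.
have mNX : measurable_fun setT (fun w => - X w) by exact: measurableT_comp.
have E1 := gaussian_integral mX gX mphi phi0.
have E2 := gaussian_integral mNX gNX mphi phi0.
have : ((m + a)%:E = (- m + a)%:E)%E.
  rewrite -e1 -e2 [LHS]E1 -E2; apply: eq_integral => w _.
  by rewrite normrN.
move=> [] /(congr1 (fun x => x - a)); rewrite !addrK => mm.
by have -> : 0 = m by lra.
Qed.

End gaussian_has_mean.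

(** Expansion of the nonnegative double sum of the squares of [a i - a j]. *)
Lemma sqr_sum_le (R : realType) (n : nat) (a : 'I_n -> R) :
  (\sum_i a i) ^+ 2 <= n%:R * \sum_i a i ^+ 2.
Proof.
have : 0 <= \sum_i \sum_j (a i - a j) ^+ 2.
  by apply: sumr_ge0 => i _; apply: sumr_ge0 => j _; exact: sqr_ge0.
under eq_bigr => i _.
  rewrite (_ : \sum_j _ = n%:R * a i ^+ 2 + \sum_j a j ^+ 2 - 2 * (a i * \sum_j a j)); last first.
    transitivity (\sum_j (a i ^+ 2 + a j ^+ 2 - 2 * (a i * a j))).
      by apply: eq_bigr => j _; ring.
    by rewrite sumrB big_split/= sumr_const card_ord -!mulr_sumr [n%:R * _]mulr_natl.
  over.
rewrite sumrB big_split/= -mulr_sumr sumr_const card_ord -mulr_sumr -mulr_suml -mulr_natl expr2.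
lra.
Qed.

(** * Isotropic Gaussian vectors *)

Section isotropic.
Context {R : realType} (n : nat) d (T : measurableType d) (P : probability T R).
Variables (N : T -> borelType 'rV[R]_n) (v : R).
Hypothesis mN : measurable_fun setT N.
Hypothesis v0 : 0 <= v.
Hypothesis gN : forall c : 'I_n -> R,
  gaussian P (fun w => \sum_i c i * N w 0 i) (Num.sqrt ((\sum_i c i ^+ 2) * v)).

Let mNi i : measurable_fun setT (fun w => N w 0 i).
Proof. exact: (measurableT_comp (@measurable_coord R n i) mN). Qed.

Let gNi i : gaussian P (fun w => N w 0 i) (Num.sqrt v).
Proof.
have := gN (fun j => (j == i)%:R); congr (gaussian P _ (Num.sqrt _)).
  apply/funext => w; rewrite (bigD1 i)//= eqxx mul1r big1 ?addr0// => j /negbTE->.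
  by rewrite mul0r.
rewrite (bigD1 i)//= eqxx expr1n big1 ?addr0 ?mul1r// => j /negbTE->.
by rewrite expr0n.
Qed.

Lemma isotropic_mean i : has_mean P (fun w => N w 0 i) 0.
Proof. exact: gaussian_has_mean (mNi i) (gNi i). Qed.

Lemma isotropic_pow2 i : has_mean P (fun w => N w 0 i ^+ 2) v.
Proof. by have := gaussian_has_mean_pow2 (mNi i) (gNi i); rewrite sqr_sqrtr. Qed.

Lemma isotropic_pow4 i : has_mean P (fun w => N w 0 i ^+ 4) (v ^+ 2 * gauss_pow4).
Proof.
have := gaussian_has_mean_pow4 (mNi i) (gNi i).
by rewrite -[4%N]/(2 * 2)%N exprM sqr_sqrtr.
Qed.

(** Polarisation: the sum of two distinct coordinates is Gaussian with variance [2 * v]. *)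
Lemma isotropic_mul i j : i != j -> has_mean P (fun w => N w 0 i * N w 0 j) 0.
Proof.
move=> ij; have ji : j != i by rewrite eq_sym.
have gS : gaussian P (fun w => N w 0 i + N w 0 j) (Num.sqrt (2 * v)).
  have := gN (fun k => (k == i)%:R + (k == j)%:R); congr (gaussian P _ (Num.sqrt (_ * _))).
    apply/funext => w; rewrite (bigD1 i)//= (bigD1 j)//= !eqxx (negbTE ij) (negbTE ji).
    rewrite addr0 add0r !mul1r big1 ?addr0// => k /andP[/negbTE-> /negbTE->].
    by rewrite addr0 mul0r.
  rewrite (bigD1 i)//= (bigD1 j)//= !eqxx (negbTE ij) (negbTE ji).
  rewrite addr0 add0r !expr1n big1 ?addr0// => k /andP[/negbTE-> /negbTE->].
  by rewrite addr0 expr0n.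
have mS : measurable_fun setT (fun w => N w 0 i + N w 0 j) by exact: measurable_funD.
have := gaussian_has_mean_pow2 mS gS; rewrite sqr_sqrtr ?mulr_ge0// => h.
have := has_meanZ 2^-1 (has_meanD h (has_meanN (has_meanD (isotropic_pow2 i) (isotropic_pow2 j)))).
congr (has_mean P _ _); last by ring.
by apply/funext => w; field.
Qed.

(** With a modulus of this form the Taylor remainder is at most twice eta S^2 + C S^4, with S the
    sum of absolute values of the coordinates. Second and fourth moments bound its mean, so large
    displacements need no separate treatment; linear and mixed terms have mean 0. *)
Lemma isotropic_taylor (phi : 'rV[R]_n -> R) (y : 'rV[R]_n) (eta C : R) :
  C2_compact_support phi ->
  (forall k j (x u z : 'rV[R]_n), (forall i, `|u 0 i| <= `|z 0 i|) ->
     `|partial j (partial k phi) (x + u) - partial j (partial k phi) x|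
       <= eta + C * (\sum_i `|z 0 i|) ^+ 2) -> 0 <= eta -> 0 <= C ->
  exists2 m, has_mean P (fun w => phi (y + N w)) m &
    `|m - phi y - 2^-1 * (v * \sum_k partial k (partial k phi) y)| <=
      2 * (eta * n%:R ^+ 2 * v + C * n%:R ^+ 4 * gauss_pow4 * v ^+ 2).
Proof.
move=> C2 H eta0 C0.
have [M phiM] := c2_support C2.
have [K _ phiK] := compact_support_bounded phiM (c2_continuous C2).
have mphi : measurable_fun setT (fun w => phi (y + N w)).
  have mc : continuous (phi : 'rV[R]_n -> R) := c2_continuous C2.
  apply: (measurableT_comp (continuous_borel_measurable mc)).
  apply: measurable_rV => i; under eq_fun do rewrite mxE.
  by apply: measurable_funD.
have [m hm] := bounded_has_mean P mphi (fun w => phiK _).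
exists m => //.
pose Rem w := phi (y + N w) - phi y - \sum_k (N w : 'rV[R]_n) 0 k * partial k phi y
  - \sum_k 2^-1 * ((N w : 'rV[R]_n) 0 k ^+ 2 * partial k (partial k phi) y) - cross_term phi y (N w).
(* S^2 and S^4 are bounded by [n] times the sum of squares and [n ^ 3] times the sum of fourth
   powers. *)
pose Bd w := 2 * (eta * n%:R * (\sum_k (N w : 'rV[R]_n) 0 k ^+ 2)
   + C * n%:R ^+ 3 * \sum_k (N w : 'rV[R]_n) 0 k ^+ 4).
have hBd : has_mean P Bd (2 * (eta * n%:R ^+ 2 * v + C * n%:R ^+ 4 * gauss_pow4 * v ^+ 2)).
  have := has_meanZ 2 (has_meanD
    (has_meanZ (eta * n%:R) (has_mean_sum (index_enum 'I_n) isotropic_pow2))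
    (has_meanZ (C * n%:R ^+ 3) (has_mean_sum (index_enum 'I_n) isotropic_pow4))).
  by congr (has_mean P _ _); rewrite !sumr_const card_ord -(mulr_natl v) -(mulr_natl (v ^+ 2 * _)); ring.
have RB w : `|Rem w| <= Bd w.
  apply: le_trans (taylor2 C2 (fun k j u => @H k j y u (N w))) _.
  set S := \sum_k `|_|.
  have S2 : S ^+ 2 <= n%:R * \sum_k (N w : 'rV[R]_n) 0 k ^+ 2.
    apply: le_trans (sqr_sum_le _) _; rewrite ler_wpM2l//.
    by apply: ler_sum => i _; rewrite real_normK// num_real.
  have S4 : S ^+ 2 * S ^+ 2 <= n%:R ^+ 3 * \sum_k (N w : 'rV[R]_n) 0 k ^+ 4.
    rewrite -expr2; apply: (@le_trans _ _ ((n%:R * \sum_k (N w : 'rV[R]_n) 0 k ^+ 2) ^+ 2)).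
      by rewrite ler_sqr ?nnegrE ?sqr_ge0// (le_trans _ S2)// sqr_ge0.
    rewrite exprMn (exprSr _ 2) -mulrA ler_wpM2l ?exprn_ge0//.
    apply: le_trans (sqr_sum_le _) _; rewrite ler_wpM2l//.
    by apply: ler_sum => i _; rewrite -exprM.
  rewrite /Bd -!mulrA ler_wpM2l// mulrDl; apply: lerD; first by rewrite ler_wpM2l.
  by have := ler_wpM2l C0 S4; rewrite !exprS !expr0 ?mulr1 -!mulrA.
have hRem : has_mean P Rem (m - phi y - 2^-1 * (v * \sum_k partial k (partial k phi) y)).
  have h1 := has_mean_sum (index_enum 'I_n) (fun k => has_meanZ (partial k phi y) (isotropic_mean k)).
  have h2 := has_mean_sum (index_enum 'I_n) (fun k => has_meanZ (2^-1 * partial k (partial k phi) y) (isotropic_pow2 k)).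
  have h3 : has_mean P (fun w => cross_term phi y (N w)) (\sum_(k < n) \sum_(j < n) 0).
    apply: has_mean_sum => k; apply: has_mean_sum => j.
    have [jk|jk] := ltnP j k.
      have kj : k != j by rewrite -val_eqE/= gtn_eqF.
      have := has_meanZ (partial j (partial k phi) y) (isotropic_mul kj).
      rewrite mulr0; congr (has_mean P _ _).
      by apply/funext => w; rewrite mxE jk; ring.
    have := has_mean_cst P 0; congr (has_mean P _ _).
    by apply/funext => w; rewrite mxE ltnNge jk/= mul0r mulr0.
  have := has_meanD (has_meanD (has_meanD (has_meanD hm (has_mean_cst P (- phi y))) (has_meanN h1))
    (has_meanN h2)) (has_meanN h3).
  congr (has_mean P _ _).
    apply/funext => w; rewrite /Rem /cst; congr (_ - _ - _ - _).
      by apply: eq_bigr => k _; rewrite mulrC.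
    by apply: eq_bigr => k _; ring.
  rewrite (_ : \sum_(k < n) _ * 0 = 0); last by rewrite big1// => k _; rewrite mulr0.
  rewrite (_ : \sum_(k < n) \sum_(j < n) 0 = 0); last by rewrite !(big1, sumr_const, mul0rn).
  rewrite subr0 subr0 mulrA mulr_sumr; congr (_ - _); apply: eq_bigr => k _; ring.
rewrite ler_norml; apply/andP; split.
  apply: has_mean_le (has_meanN hBd) hRem _ => w.
  by have := RB w; rewrite ler_norml => /andP[].
apply: has_mean_le hRem hBd _ => w.
by have := RB w; rewrite ler_norml => /andP[].
Qed.

End isotropic.

Lemma lt_minl (R : realType) (x y z : R) : x < Num.min y z -> x < y.
Proof. by rewrite lt_min => /andP[]. Qed.

Lemma lt_minr (R : realType) (x y z : R) : x < Num.min y z -> x < z.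
Proof. by rewrite lt_min => /andP[]. Qed.

Lemma dist_1_le2 (R : realType) (x y : R) : `|x - 1| < Num.min 1 y -> x <= 2.
Proof. by move=> /lt_minl; rewrite ltr_norml => /andP[_]; lra. Qed.

(** With [a] the dilation factor, [v] the variance, [m] the mean, [pa] and [la] taken at the dilated
    point, the five errors are: Taylor remainder, displacement of the Laplacian, [v / h] against 1,
    first order expansion along the dilation, and [(a - 1) / h] against [- f]. *)
Lemma generator_split (R : realType) (h m pa p v la l f r a : R) : h != 0 ->
  (m - p) / h - (2^-1 * l - f * r) =
  (m - pa - 2^-1 * (v * la)) / h + 2^-1 * (v / h) * (la - l) + 2^-1 * (v / h - 1) * l
  + (pa - p - (a - 1) * r) / h + ((a - 1) / h - - f) * r.
Proof. by move=> h0; field. Qed.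

Lemma frac8_le (R : realType) (e m b : R) : 0 <= e -> 0 <= b -> b <= m -> 0 < m ->
  e / (8 * m) * b <= e / 8.
Proof.
move=> e0 b0 bm m0; rewrite (_ : e / (8 * m) * b = e / 8 * (b / m)); last first.
  by field; rewrite gt_eqF.
by rewrite ler_piMr ?divr_ge0// ler_pdivrMr ?mul1r.
Qed.

Section moduli.
Context {R : realType} (n : nat).

Lemma is_derive_right (F : R -> R) (t l : R) : is_derive t 1 F l ->
  (F (t + h) - F t) / h @[h --> 0^'+] --> l.
Proof.
move=> [dF <-].
have sub : (0 : R)^'+ `=>` (0 : R)^'.
  by move=> A; rewrite /dnbhs /at_right /within/=; apply: filterS => u Au u0; apply: Au; rewrite gt_eqF.
have := cvg_trans (cvg_app _ sub) dF; apply: cvg_trans; apply: near_eq_cvg.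
by apply: nearW => h; rewrite [LHS]mulrC /= [h%:A]mulr1 (addrC h).
Qed.

(** If every coordinate of [u] is below [dl], uniform continuity gives [eta]. Otherwise the sum over
    [z] is at least [dl], and its square times [C] exceeds the trivial bound [2 * K]. *)
Lemma compact_support_modulus (g : 'rV[R]_n -> R) M eta :
  (forall x, M < `|x| -> g x = 0) -> continuous g -> 0 < eta ->
  exists2 C : R, 0 <= C & forall x u z : 'rV[R]_n, (forall i, `|u 0 i| <= `|z 0 i|) ->
    `|g (x + u) - g x| <= eta + C * (\sum_i `|z 0 i|) ^+ 2.
Proof.
move=> g0 cg eta0.
have [dl dl0 H] := compact_support_unif_continuous g0 cg eta0.
have [K K0 gK] := compact_support_bounded g0 cg.
exists (2 * K / dl ^+ 2) => [|x u z uz]; first by rewrite divr_ge0 ?sqr_ge0// mulr_ge0// ltW.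
set S := \sum_i _; have S0 : 0 <= S by exact: sumr_ge0.
have [/forallP small|/forallPn[i]] := boolP [forall i, `|u 0 i| < dl].
  apply: le_trans (H (x + u) x _) _; last by rewrite lerDl mulr_ge0 ?sqr_ge0// divr_ge0 ?sqr_ge0// mulr_ge0// ltW.
  by move=> i; rewrite mxE addrAC subrr add0r.
rewrite -leNgt => dlu.
have dS : dl <= S.
  by apply: le_trans dlu _; apply: le_trans (uz i) _; rewrite /S (bigD1 i)//= lerDl sumr_ge0.
apply: (@le_trans _ _ (2 * K)).
  apply: le_trans (ler_normB _ _) _.
  by rewrite mulr_natl mulr2n lerD.
rewrite -mulrA ler_wpDl ?(ltW eta0)// ler_peMr//; first by rewrite mulr_ge0// ltW.
rewrite mulrC ler_pdivlMr ?exprn_gt0// mul1r ler_sqr// nnegrE ltW//.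
Qed.

Lemma compact_support_moduli (I : finType) (g : I -> 'rV[R]_n -> R) M eta :
  (forall i x, M < `|x| -> g i x = 0) -> (forall i, continuous (g i)) -> 0 < eta ->
  exists2 C : R, 0 <= C & forall j (x u z : 'rV[R]_n), (forall i, `|u 0 i| <= `|z 0 i|) ->
    `|g j (x + u) - g j x| <= eta + C * (\sum_i `|z 0 i|) ^+ 2.
Proof.
move=> g0 cg eta0.
have /choice[C HC] : forall j, exists C : R, 0 <= C /\ forall x u z : 'rV[R]_n,
    (forall i, `|u 0 i| <= `|z 0 i|) ->
    `|g j (x + u) - g j x| <= eta + C * (\sum_i `|z 0 i|) ^+ 2.
  by move=> j; have [C C0 H] := compact_support_modulus (@g0 j) (cg j) eta0; exists C.
exists (\sum_j C j); first by apply: sumr_ge0 => j _; have [] := HC j.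
move=> j x u z uz; have [_ H] := HC j; apply: le_trans (H x u z uz) _.
rewrite lerD2l ler_wpM2r ?sqr_ge0// (bigD1 j)//= lerDl.
by apply: sumr_ge0 => k _; have [] := HC k.
Qed.

End moduli.

Section generator.
Context {R : realType} (n : nat).
Variable phi : 'rV[R]_n -> R.
Hypothesis C2 : C2_compact_support phi.
Implicit Type x : 'rV[R]_n.

Definition laplacian x := \sum_i partial i (partial i phi) x.
Definition radial x := \sum_i x 0 i * partial i phi x.

Lemma partial_support : exists M, [/\ forall x, M < `|x| -> phi x = 0,
  forall i x, M < `|x| -> partial i phi x = 0 &
  forall i j x, M < `|x| -> partial j (partial i phi) x = 0].
Proof.
have [M phiM] := c2_support C2; exists M.
have p1 i x : M < `|x| -> partial i phi x = 0 by apply: compact_support_partial.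
split => // i j x; apply: compact_support_partial => //; exact: p1.
Qed.

Lemma continuous_laplacian : continuous laplacian.
Proof. by move=> x; apply: (@cvg_sum _ _ _ _ (nbhs x)) => i; exact: (@c2_continuous2 _ _ _ C2 i i). Qed.

Lemma continuous_radial : continuous radial.
Proof.
move=> x; apply: (@cvg_sum _ _ _ _ (nbhs x)) => i; apply: cvgM; first exact: coord_continuous.
exact: (@c2_continuous1 _ _ _ C2 i).
Qed.

Lemma laplacian_bounded : exists2 K : R, 0 < K & forall x, `|laplacian x| <= K.
Proof.
have [M [_ _ p2]] := partial_support.
apply: (@compact_support_bounded _ _ _ M) continuous_laplacian.
by move=> x Mx; rewrite /laplacian big1// => i _; exact: p2 Mx.
Qed.

Lemma radial_bounded : exists2 K : R, 0 < K & forall x, `|radial x| <= K.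
Proof.
have [M [_ p1 _]] := partial_support.
apply: (@compact_support_bounded _ _ _ M) continuous_radial.
by move=> x Mx; rewrite /radial big1// => i _; rewrite (p1 _ _ Mx) mulr0.
Qed.

Lemma laplacian_scale e : 0 < e -> exists2 dl : R, 0 < dl &
  forall (a : R) x, `|a - 1| < dl -> `|laplacian (a *: x) - laplacian x| <= e.
Proof.
have [M [_ _ p2]] := partial_support.
apply: (@compact_support_scale _ _ _ M) continuous_laplacian _.
by move=> x Mx; rewrite /laplacian big1// => i _; exact: p2 Mx.
Qed.

(** First order expansion of [phi] along [(a - 1) *: x]. It is uniform in [x] because for |x| > [D]
    all terms vanish, while for |x| <= [D] the displacement is of order |a - 1|. *)
Lemma radial_taylor e : 0 < e -> exists2 dl : R, 0 < dl &
  forall (a : R) x, `|a - 1| < dl ->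
    `|phi (a *: x) - phi x - (a - 1) * radial x| <= e * `|a - 1|.
Proof.
move=> e0.
have [M [p0 p1 _]] := partial_support.
pose D := 2 * (`|M| + 1).
have D0 : 0 < D by have := normr_ge0 M; rewrite /D; lra.
pose m := n%:R + 1 : R.
have m0 : 0 < m by rewrite ltr_wpDl.
(* The error will be [2 * eta] times [m * D] times |a - 1|; [m] exceeds [n] so that it is
   positive. *)
pose eta := e / (2 * (m * D)).
have eta0 : 0 < eta by rewrite divr_gt0// !mulr_gt0.
have [C C0 HC] := compact_support_moduli p1 (@c2_continuous1 _ _ _ C2) eta0.
(* For |a - 1| < [b] and at most 1, the quadratic part of the modulus is at most [eta] as well. *)
pose b := eta / ((C + 1) * (m * D) ^+ 2).
have b0 : 0 < b by rewrite divr_gt0// mulr_gt0 ?exprn_gt0 ?mulr_gt0// ltr_wpDl.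
exists (Num.min 2^-1 (Num.min 1 b)); first by rewrite !lt_min b0 ltr01; lra.
move=> a x; rewrite !lt_min => /and3P[a1 a2 a3].
have [xD|Dx] := lerP `|x| D; last first.
  have Mx : M < `|x|.
    by apply: le_lt_trans (ler_norm M) _; apply: lt_trans Dx; have := normr_ge0 M; rewrite /D; lra.
  have Max : M < `|a *: x|.
    rewrite normrZ; apply: le_lt_trans (ler_norm M) _.
    have a2' : 2^-1 < `|a|.
      by move: a1; rewrite ltr_norml => /andP[a4 a5]; rewrite ger0_norm; lra.
    apply: lt_le_trans (_ : 2^-1 * D <= _); first by rewrite /D; lra.
    by apply: ler_pM; rewrite ?ltW//; lra.
  rewrite !p0// /radial big1; last by move=> i _; rewrite p1// mulr0.
  by rewrite mulr0 !subr0 normr0 mulr_ge0// ltW.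
pose z := (a - 1) *: x.
set S := \sum_i `|z 0 i|.
have S0 : 0 <= S by exact: sumr_ge0.
have Sle : S <= m * D * `|a - 1|.
  apply: (@le_trans _ _ (\sum_(i < n) (D * `|a - 1|))).
    apply: ler_sum => i _; rewrite mxE normrM mulrC ler_wpM2r//.
    exact: le_trans (coord_le_norm x i) xD.
  rewrite sumr_const card_ord -mulr_natl mulrA ler_wpM2r// ler_wpM2r// ?ltW//.
  by rewrite /m; lra.
have -> : a *: x = x + z by rewrite /z scalerBl scale1r addrC subrK.
rewrite (_ : (a - 1) * radial x = \sum_k z 0 k * partial k phi x); last first.
  by rewrite /radial mulr_sumr; apply: eq_bigr => k _; rewrite mxE mulrA.
apply: le_trans (taylor1 (@c2_derivable _ _ _ C2) (fun k u => @HC k x u z)) _.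
have SC : C * S ^+ 2 <= eta.
  apply: (@le_trans _ _ ((C + 1) * (m * D * `|a - 1|) ^+ 2)).
    apply: ler_pM => //; first exact: sqr_ge0.
      by rewrite lerDl.
    by rewrite ler_sqr ?nnegrE// (le_trans S0).
  rewrite exprMn mulrA -ler_pdivlMl; last first.
    by rewrite mulr_gt0 ?exprn_gt0 ?mulr_gt0// ltr_wpDl.
  rewrite mulrC -/b; apply: le_trans (ltW a3).
  by rewrite expr2 ler_piMr// ltW.
apply: (@le_trans _ _ ((2 * eta) * (m * D * `|a - 1|))).
  apply: ler_pM => //; last by rewrite mulr_natl mulr2n lerD2l.
  by rewrite addr_ge0 ?(ltW eta0)// mulr_ge0// sqr_ge0.
rewrite /eta le_eqVlt; apply/orP; left; apply/eqP; field.
by rewrite !gt_eqF.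
Qed.

End generator.

Section markov_generator.
Context {R : realType} (n : nat) d (T : measurableType d) (P : probability T R).
Variables (B y : R -> T -> 'rV[R]_n) (f E q : R -> R).
Hypothesis bm : brownian_motion P B.
Hypothesis sde : sde_solution P B f y.
Hypothesis ifE : integrating_factor f E q.
Hypothesis n_gt0 : (0 < n)%N.
Let V := borelType 'rV[R]_n.
Let M := sde_martingale y E.

Lemma bridge_kernel_mean s t x (phi : 'rV[R]_n -> R) m : 0 <= s -> s <= t -> t < 1 ->
  continuous phi ->
  has_mean P (fun w => phi ((E s / E t) *: x + (E t)^-1 *: (M t w - M s w))) m ->
  \int[bridge_kernel E sde s t x]_u phi u = m.
Proof.
move=> s0 st t1 cphi [iphi ephi].
have flowE w : bridge_map y E s t x w = (E s / E t) *: x + (E t)^-1 *: (M t w - M s w).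
  by rewrite /bridge_map s0 st t1/= /bridge_flow scalerDr scalerA mulrC.
have mphi : measurable_fun setT (fun u : V => (phi u)%:E).
  by apply/measurable_EFinP; exact: continuous_borel_measurable.
rewrite /Rintegral.
rewrite -[X in fine X]/(\int[pushforward P (bridge_map y E s t x)]_u (phi u)%:E)%E.
rewrite (integral_pushforward _ mphi)//.
- by rewrite preimage_setT /comp; under eq_integral do rewrite flowE; rewrite ephi.
- rewrite /bridge_map s0 st t1/=; apply: measurable_bridge_flow; first exact: measurable_cst.
  exact: (measurable_martingale_diff E sde s t).
- rewrite preimage_setT; apply: eq_integrable iphi => //.
  by move=> w _; rewrite /= flowE.
Qed.

(** From [x] at time [t], the state at [t + h] is [a h *: x] plus an isotropic Gaussian vector of
    variance [v h], with [(a h - 1) / h] tending to [- f t] and [v h / h] to 1. Compact support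
    makes the remaining errors uniform in [x]. *)
Lemma bridge_has_generator :
  has_generator (bridge_kernel E sde) (bridge_generator f).
Proof.
move=> t phi /andP[t0 t1] C2 e e0.
have Et0 : 0 < E t by apply: (if_gt0 ifE); rewrite t0.
have t11 : -1 < t < 1 by rewrite t1 andbT; apply: lt_le_trans t0; lra.
pose a h := E t / E (t + h); pose v h := (q (t + h) - q t) / E (t + h) ^+ 2.
have near1 : \forall h \near (0 : R)^'+, t + h < 1.
  near=> h; rewrite addrC -ltrBrDr; near: h.
  by apply: nbhs_right_lt; rewrite subr_gt0.
have near0 : \forall h \near (0 : R)^'+, 0 < h by exact: nbhs_right_gt.
have cE : E (t + h) @[h --> (0 : R)^'+] --> E t.
  apply: cvg_at_right_filter.
  have := if_continuousE ifE t11; rewrite -{1}(addr0 t) => cE0.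
  apply: (@cvg_comp _ _ _ (fun h : R => t + h) E _ (nbhs (t + 0))); last by rewrite addr0 in cE0 *.
  by apply: cvgD; [exact: cvg_cst|exact: cvg_id].
have c_a : (a h - 1) / h @[h --> (0 : R)^'+] --> - f t.
  have := is_derive_right (if_derive ifE t11) => dE.
  have : - ((E (t + h) - E t) / h) / E (t + h) @[h --> (0 : R)^'+] --> - (f t * E t) / E t.
    by apply: cvgM; [exact: cvgN|apply: cvgV => //; rewrite gt_eqF].
  rewrite mulNr mulfK ?gt_eqF//; apply: cvg_trans; apply: near_eq_cvg.
  near=> h; rewrite /a.
  have h0 : 0 < h by near: h.
  have th1 : t + h < 1 by near: h.
  have Eh0 : 0 < E (t + h) by apply: (if_gt0 ifE); rewrite th1 addr_ge0// ltW.
  by field; rewrite !gt_eqF.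
have c_v : v h / h @[h --> (0 : R)^'+] --> (1 : R).
  have := is_derive_right (if_clock ifE t11) => dq.
  have : (q (t + h) - q t) / h / (E (t + h) * E (t + h)) @[h --> (0 : R)^'+] -->
      E t ^+ 2 / (E t * E t).
    by apply: cvgM => //; apply: cvgV; [rewrite gt_eqF// mulr_gt0|exact: cvgM].
  rewrite -expr2 divff ?expf_neq0 ?gt_eqF//; apply: cvg_trans; apply: near_eq_cvg.
  near=> h; rewrite /v.
  have h0 : 0 < h by near: h.
  have th1 : t + h < 1 by near: h.
  have Eh0 : 0 < E (t + h) by apply: (if_gt0 ifE); rewrite th1 addr_ge0// ltW.
  by field; rewrite !gt_eqF.
have c_h : h @[h --> (0 : R)^'+] --> (0 : R) by exact: cvg_at_right_filter.
have c_a1 : a h - 1 @[h --> (0 : R)^'+] --> (0 : R).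
  have : h * ((a h - 1) / h) @[h --> (0 : R)^'+] --> 0 * - f t by exact: cvgM.
  rewrite mul0r; apply: cvg_trans; apply: near_eq_cvg.
  near=> h; have h0 : 0 < h by near: h.
  by rewrite /= mulrC divfK// gt_eqF.
have c_v1 : v h @[h --> (0 : R)^'+] --> (0 : R).
  have : h * (v h / h) @[h --> (0 : R)^'+] --> (0 * 1 : R) by exact: cvgM.
  rewrite mul0r; apply: cvg_trans; apply: near_eq_cvg.
  near=> h; have h0 : 0 < h by near: h.
  by rewrite /= mulrC divfK// gt_eqF.
have [K K0 lK] := laplacian_bounded C2.
have [K' K'0 rK] := radial_bounded C2.
have [M0 [p0 p1 p2]] := partial_support C2.
(* One fifth for each error of [generator_split]. *)
pose e5 := e / 5; have e50 : 0 < e5 by rewrite divr_gt0.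
pose F := `|f t| + 1; have F0 : 0 < F by rewrite ltr_wpDl.
(* The quotient controls the errors multiplied by the bounds [K] and [K']; the bound 1 keeps
   [v h / h] below 2 and [(a h - 1) / h] below [F] in absolute value. *)
pose k := Num.min 1 (e5 / (K + K')).
have k0 : 0 < k by rewrite lt_min ltr01 divr_gt0// addr_gt0.
have [dl1 dl10 Hl] := laplacian_scale C2 e50.
have [dl2 dl20 Hr] := radial_taylor C2 (divr_gt0 e50 F0).
(* [eta] and [c] make each half of the Taylor remainder at most [e5 / 8]; its factor 2 and
   [v h / h <= 2] restore [e5]. *)
pose eta := e5 / (8 * (n%:R ^+ 2 + 1)).
have n2 : 0 < n%:R ^+ 2 + 1 :> R by rewrite ltr_wpDl ?sqr_ge0.
have eta0 : 0 < eta by rewrite divr_gt0// mulr_gt0.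
have [C C0 HC] := @compact_support_moduli R n ('I_n * 'I_n)%type
   (fun ij => partial ij.2 (partial ij.1 phi)) M0 eta
   (fun ij x => @p2 ij.1 ij.2 x) (fun ij => @c2_continuous2 _ _ _ C2 ij.1 ij.2) eta0.
pose G := C * n%:R ^+ 4 * gauss_pow4 : R.
have G0 : 0 <= G by rewrite !mulr_ge0 ?exprn_ge0// gauss_pow4_ge0.
pose c := e5 / (8 * (G + 1)).
have c0 : 0 < c by rewrite divr_gt0// mulr_gt0// ltr_wpDl.
near=> h.
have h0 : 0 < h by near: h.
have th1 : t + h < 1 by near: h.
have Eh0 : 0 < E (t + h).
  by apply: (if_gt0 ifE); rewrite th1 andbT addr_ge0// ltW.
have tth : t <= t + h by rewrite lerDl ltW.
have ha : `|(a h - 1) / h - - f t| < k.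
  rewrite distrC; near: h; move/cvgrPdist_lt: c_a; exact.
have hv : `|v h / h - 1| < k.
  rewrite distrC; near: h; move/cvgrPdist_lt: c_v; exact.
have ha1 : `|a h - 1| < Num.min dl1 dl2.
  rewrite -[X in `|X|]subr0 distrC; near: h; move/cvgrPdist_lt: c_a1; apply.
  by rewrite lt_min dl10.
have hv1 : `|v h| < c.
  rewrite -[X in `|X|]subr0 distrC; near: h; move/cvgrPdist_lt: c_v1; exact.
have v0 : 0 <= v h.
  rewrite divr_ge0 ?sqr_ge0// subr_ge0; exact: (if_clock_le ifE).
move=> x.
pose N w : V := (E (t + h))^-1 *: (M (t + h) w - M t w).
have mN : measurable_fun setT N.
  apply: measurable_rV => i; under eq_fun do rewrite mxE.
  apply: measurable_funM => //.
  exact: (measurableT_comp (@measurable_coord R n i) (measurable_martingale_diff E sde t (t + h))).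
have gN (b : 'I_n -> R) : gaussian P (fun w => \sum_i b i * N w 0 i)
    (Num.sqrt ((\sum_i b i ^+ 2) * v h)).
  have := gaussianZ (E (t + h))^-1 (gaussian_martingale_increment bm sde ifE n_gt0 b t0 tth th1).
  congr (gaussian P _ _).
    apply/funext => w; rewrite mulr_sumr; apply: eq_bigr => i _.
    by rewrite [N w 0 i]mxE mulrCA.
  have Ei0 : 0 <= (E (t + h))^-1 by rewrite invr_ge0 ltW.
  rewrite -{1}(ger0_norm Ei0) -sqrtr_sqr -sqrtrM ?sqr_ge0//.
  by congr Num.sqrt; rewrite /v exprVn; ring.
have [m hm mle] := isotropic_taylor mN v0 gN (a h *: x) C2
  (fun k j => @HC (k, j)) (ltW eta0) C0.
rewrite (@bridge_kernel_mean t (t + h) x phi m)//; last exact: (c2_continuous C2).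
have -> : bridge_generator f t phi x = 2^-1 * laplacian phi x - f t * radial phi x by [].
rewrite -/(laplacian phi _) -/G in mle.
have := Hl (a h) x (lt_minl ha1).
have := Hr (a h) x (lt_minr ha1).
move: hm mle => _; set A := a h in ha *; set Ax := A *: x.
move=> T1 T4 T2.
have vh : v h / h <= 2.
  exact: dist_1_le2 hv.
have vh0 : 0 <= v h / h by rewrite divr_ge0// ltW.
have kK : k * (K + K') <= e5 by rewrite -ler_pdivlMr ?addr_gt0// ge_min lexx orbT.
have kK1 : k * K <= e5 by apply: le_trans kK; rewrite ler_wpM2l ?(ltW k0)// lerDl ltW.
have kK2 : k * K' <= e5 by apply: le_trans kK; rewrite ler_wpM2l ?(ltW k0)// lerDr ltW.
have -> : (m - phi x) / h - (2^-1 * laplacian phi x - f t * radial phi x) =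
  (m - phi Ax - 2^-1 * (v h * laplacian phi Ax)) / h
  + 2^-1 * (v h / h) * (laplacian phi Ax - laplacian phi x)
  + 2^-1 * (v h / h - 1) * laplacian phi x
  + (phi Ax - phi x - (A - 1) * radial phi x) / h
  + ((A - 1) / h - - f t) * radial phi x.
  exact: generator_split (lt0r_neq0 h0).
rewrite (_ : e = e5 + e5 + e5 + e5 + e5); last by rewrite /e5; field.
apply: le_trans (ler_normD _ _) _; apply: lerD.
apply: le_trans (ler_normD _ _) _; apply: lerD.
apply: le_trans (ler_normD _ _) _; apply: lerD.
apply: le_trans (ler_normD _ _) _; apply: lerD.
- rewrite normrM normfV (gtr0_norm h0) ler_pdivrMr//.
  apply: le_trans T1 _.
  have -> : 2 * (eta * n%:R ^+ 2 * v h + G * v h ^+ 2) =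
     2 * (eta * n%:R ^+ 2 + G * v h) * (v h / h) * h.
    by field; rewrite gt_eqF.
  rewrite ler_wpM2r ?(ltW h0)//.
  have b1 : eta * n%:R ^+ 2 <= e5 / 8.
    by apply: frac8_le => //; rewrite ?sqr_ge0 ?lerDl ?(ltW e50).
  have b2 : G * v h <= e5 / 8.
    apply: (@le_trans _ _ (G * c)).
      by rewrite ler_wpM2l//; apply: le_trans (ler_norm _) (ltW hv1).
    by rewrite mulrC; apply: frac8_le => //; rewrite ?lerDl ?(ltW e50) ?ltr_wpDl.
  apply: (@le_trans _ _ (2 * (e5 / 8 + e5 / 8) * 2)); last first.
    by rewrite (_ : 2 * (e5 / 8 + e5 / 8) * 2 = e5)//; field.
  apply: ler_pM => //; last by rewrite ler_wpM2l// lerD.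
  apply: mulr_ge0 => //; apply: addr_ge0; last exact: mulr_ge0.
  exact: mulr_ge0 (ltW eta0) (sqr_ge0 _).
- have vh2 : 0 <= 2^-1 * (v h / h) by rewrite mulr_ge0.
  rewrite normrM (ger0_norm vh2) -[leRHS]mul1r; apply: ler_pM => //.
  by rewrite ler_pdivrMl// mulr1.
- rewrite -mulrA normrM (normrM (_ - _)) ger0_norm// -[leRHS]mul1r; apply: ler_pM => //.
    by rewrite invf_le1 ?ler1n.
  by apply: le_trans kK1; apply: ler_pM => //; exact: ltW.
- rewrite normrM normfV (gtr0_norm h0).
  apply: (@le_trans _ _ (e5 / F * (`|A - 1| / h))).
    by rewrite mulrA ler_wpM2r// invr_ge0 ltW.
  rewrite -mulrA ler_piMr ?(ltW e50)// mulrC ler_pdivrMr// mul1r.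
  have -> : `|A - 1| / h = `|(A - 1) / h| by rewrite normrM normfV (gtr0_norm h0).
  have -> : (A - 1) / h = ((A - 1) / h - - f t) - f t by ring.
  apply: le_trans (ler_normB _ _) _; rewrite addrC lerD2l.
  by apply: le_trans (ltW ha) _; by rewrite ge_min lexx.
- rewrite normrM; apply: le_trans kK2.
  by apply: ler_pM => //; exact: ltW.
Unshelve. all: by end_near.
Qed.

End markov_generator.

(** * The law on the loop space *)

Section tent.
Context {R : realType}.

Definition tent (u : R) : R := Num.max 0 (1 - `|u|).

Lemma tent_ge0 u : 0 <= tent u.
Proof. by rewrite le_max lexx. Qed.

Lemma tent_eq0 u : 1 <= `|u| -> tent u = 0.
Proof. by move=> u1; apply: max_l; lra. Qed.

Lemma continuous_tent : continuous tent.
Proof.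
move=> u; apply: (@continuous_max R R (fun=> 0) (fun u => 1 - `|u|)).
  exact: cvg_cst.
by apply: cvgB; [exact: cvg_cst|exact: norm_continuous].
Qed.

(** The partial sums form a plateau of height 1 followed by a ramp; this closed form carries the
    induction behind the partition of unity. *)
Lemma sum_tent (N : nat) (s : R) : 0 <= s ->
  \sum_(k < N.+1) tent (s - k%:R) = Num.min 1 (Num.max 0 (N%:R + 1 - s)).
Proof.
move=> s0; elim: N => [|N IH].
  rewrite big_ord1/= subr0 /tent ger0_norm// add0r.
  by rewrite [RHS]min_r// ge_max ler01/=; lra.
rewrite big_ord_recr/= IH /tent -natr1.
have [sN|Ns] := lerP s N%:R.
  rewrite (max_r (x := 0)); last by lra.
  rewrite (min_l (x := 1)); last by lra.
  rewrite max_l; last by rewrite ltr0_norm; lra.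
  by rewrite (max_r (x := 0)) ?min_l; lra.
have [sN|Ns1] := lerP s (N%:R + 1).
  rewrite (max_r (x := 0)); last by lra.
  rewrite (min_r (x := 1)); last by lra.
  rewrite (max_r (x := 0)); last by lra.
  rewrite (max_r (x := 0)); last by lra.
  by rewrite (min_l (x := 1)); lra.
rewrite (max_l (x := 0)); last by lra.
rewrite (min_r (x := 1)) ?ler01// add0r.
rewrite [RHS]min_r; first by congr Num.max; ring.
by rewrite ge_max ler01; lra.
Qed.

Lemma tent_partition (N : nat) (s : R) : 0 <= s -> s <= N%:R ->
  \sum_(k < N.+1) tent (s - k%:R) = 1.
Proof. by move=> s0 sN; rewrite sum_tent// max_r ?min_l; lra. Qed.

End tent.

(** * Interpolation of loops by tents *)

Section loop_interpolation.
Context {R : realType} (n : nat).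
Implicit Types (s : loopSpace R n) (x : 'rV[R]_n).

(** Interior nodes only: loops vanish at both ends, and the tents at these nodes are loops
    themselves. *)
Definition node (m i : nat) : R := i.+1%:R / m.+1%:R.

Lemma is_loop_tent m (i : 'I_m) x :
  (fun t : R => tent (m.+1%:R * t - i.+1%:R) *: x) \in is_loop R n.
Proof.
have big u : 1 <= `|u| -> tent u *: x = 0 by move=> u1; rewrite tent_eq0// scale0r.
have im : (i.+1%:R + 1 <= m.+1%:R :> R) by rewrite natr1 ler_nat ltnS.
have i1 : (1 <= i.+1%:R :> R) by rewrite ler1n.
apply/mem_set; split.
- apply: continuous_subspaceT => t; apply: cvgZl.
  apply: (@continuous_comp _ _ _ (fun t : R => m.+1%:R * t - i.+1%:R) tent);
    last exact: continuous_tent.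
  by apply: cvgB; [apply: cvgMr; exact: cvg_id|exact: cvg_cst].
- by rewrite big// mulr0 sub0r normrN ger0_norm.
- by rewrite big// mulr1 ger0_norm; lra.
- move=> t; rewrite in_itv/= negb_and -!ltNge => /orP[t0|t1]; apply: big.
    have h : m.+1%:R * t < 0 by rewrite pmulr_rlt0.
    by rewrite ler0_norm; lra.
  have h : m.+1%:R < m.+1%:R * t by rewrite ltr_pMr.
  by rewrite ger0_norm; lra.
Qed.

Definition tent_loop m (i : 'I_m) x : loopSpace R n :=
  exist (fun f => f \in is_loop R n) _ (is_loop_tent i x).

Lemma val_tent_loop m i x t :
  val (@tent_loop m i x) t = tent (m.+1%:R * t - i.+1%:R) *: x.
Proof. by []. Qed.

Lemma val_loop_sum (I : Type) (r : seq I) (f : I -> loopSpace R n) t :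
  val (\sum_(i <- r) f i) t = \sum_(i <- r) val (f i) t.
Proof. by elim/big_rec2: _ => // i u v _ <-. Qed.

Lemma val_loopZ (a : R) s t : val (a *: s) t = a *: val s t.
Proof. by []. Qed.

Lemma val_loopB s1 s2 t : val (s1 - s2) t = val s1 t - val s2 t.
Proof. by []. Qed.

Lemma loop_out s t : t \notin `[0, 1] -> val s t = 0.
Proof. by have [_ _ _] := set_mem (valP s); exact. Qed.

(** A finite combination of fixed loops whose coefficients are evaluations. It serves to prove
    measurability of loop-valued maps and to reduce continuous functionals to evaluations. *)
Definition interpolate m s : loopSpace R n :=
  \sum_(i < m) \sum_(j < n) val s (node m i) 0 j *: tent_loop i (delta_mx 0 j).

Lemma val_interpolate m s t : 0 <= t <= 1 ->
  val (interpolate m s) t =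
  \sum_(k < m.+2) tent (m.+1%:R * t - k%:R) *: val s (k%:R / m.+1%:R).
Proof.
move=> t01; have [_ s0 s1 _] := set_mem (valP s).
rewrite big_ord_recl big_ord_recr/= mul0r s0 scaler0 add0r /bump leq0n add1n divff// s1 scaler0 addr0.
rewrite /interpolate val_loop_sum; apply: eq_bigr => i _.
rewrite val_loop_sum [in RHS](row_sum_delta (val s _)) scaler_sumr.
apply: eq_bigr => j _; rewrite val_loopZ val_tent_loop/= scalerA mulrC -scalerA.
by rewrite add1n.
Qed.

Lemma loop_norm_le_val s c : 0 <= c -> (forall t, 0 <= t <= 1 -> `|val s t| <= c) -> `|s| <= c.
Proof.
move=> c0 sc; apply: loop_norm_le => t.
by have [t01|t01] := boolP (t \in `[0, 1]); [exact: sc|rewrite loop_out// normr0].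
Qed.

Lemma cvg_interpolate s : interpolate m s @[m --> \oo] --> s.
Proof.
have [cs _ _ _] := set_mem (valP s).
apply/cvgrPdist_le => e e0.
have [dl dl0 H] := compact_unif_continuous (@segment_compact _ _ _) cs e0.
near=> m.
apply: loop_norm_le_val; first exact: ltW.
move=> t /andP[t0 t1]; rewrite val_loopB val_interpolate ?t0//.
have mt : m.+1%:R * t <= m.+1%:R by rewrite ger_pMr.
have mt0 : 0 <= m.+1%:R * t by rewrite mulr_ge0.
rewrite (_ : val s t - _ = \sum_(k < m.+2) (tent (m.+1%:R * t - k%:R) *: val s t -
    tent (m.+1%:R * t - k%:R) *: val s (k%:R / m.+1%:R))); last first.
  by rewrite sumrB -scaler_suml tent_partition// scale1r.
apply: le_trans (ler_norm_sum _ _ _) _.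
apply: (@le_trans _ _ (\sum_(k < m.+2) tent (m.+1%:R * t - k%:R) * e)); last first.
  by rewrite -mulr_suml tent_partition// mul1r.
apply: ler_sum => k _; rewrite -scalerBr normrZ ger0_norm ?tent_ge0//.
(* Only nodes within [m.+1%:R^-1] of [t] contribute, and there uniform continuity applies. *)
have [far|near] := lerP 1 `|m.+1%:R * t - k%:R|; first by rewrite tent_eq0// !mul0r.
rewrite ler_wpM2l ?tent_ge0//; apply/ltW/H.
- by rewrite /= in_itv/= t0.
- by rewrite /= in_itv/= divr_ge0//= ler_pdivrMr// mul1r ler_nat -ltnS.
- rewrite /ball/=; apply: (@lt_trans _ _ m.+1%:R^-1).
    rewrite -(ltr_pM2l (ltr0Sn R m)) divff//.
    rewrite -[X in X * _](ger0_norm (ler0n R m.+1)) -normrM mulrBr.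
    by rewrite [_ * (k%:R / _)]mulrC divfK.
  by near: m; exact: near_infty_natSinv_lt (PosNum dl0).
Unshelve. all: by end_near.
Qed.

End loop_interpolation.

Section borel_maps.
Context {R : realType} d (T : measurableType d).

(** The map factors through a continuous map from a finite-dimensional space. This avoids adding
    Borel maps into [V], which is not assumed separable. *)
Lemma measurable_lincomb (V : normedModType R) (I : finType) (X : I -> T -> R) (b : I -> V) :
  (forall i, measurable_fun setT (X i)) ->
  measurable_fun setT ((fun w => \sum_i X i w *: b i) : T -> borelType V).
Proof.
move=> mX.
pose L (v : 'rV[R]_#|I|) : V := \sum_i v 0 (enum_rank i) *: b i.
pose W w : 'rV[R]_#|I| := \row_k X (enum_val k) w.
have cL : continuous L.
  move=> v; apply: (@cvg_sum R V _ _ (nbhs v)) => i; apply: cvgZr_tmp.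
  exact: coord_continuous.
have mW : measurable_fun setT (W : T -> borelType 'rV[R]_#|I|).
  by apply: measurable_rV => k; under eq_fun do rewrite mxE; exact: mX.
rewrite (_ : (fun w => _) = L \o W); last first.
  by apply/funext => w; apply: eq_bigr => i _; rewrite mxE enum_rankK.
apply: measurable_borel => A oA.
rewrite comp_preimage -[X in measurable X]setTI; apply: mW => //.
by apply: sub_sigma_algebra; move/continuousP: cL; exact.
Qed.

(** For open [A], the limit lies in [A] iff, for some [k], the approximations eventually lie in the
    open set [A_ k] of points that are well inside [A]. *)
Lemma measurable_cvg_borel (V : normedModType R) (X_ : nat -> T -> V) (X : T -> V) :
  (forall m, measurable_fun setT (X_ m : T -> borelType V)) ->
  (forall w, X_ m w @[m --> \oo] --> X w) -> measurable_fun setT (X : T -> borelType V).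
Proof.
move=> mX cX; apply: measurable_borel => A oA.
pose r k : R := k.+1%:R^-1.
have r0 k : 0 < r k by rewrite invr_gt0.
pose A_ k := interior [set x | ball x (r k) `<=` A].
rewrite (_ : X @^-1` A = \bigcup_k \bigcup_N \bigcap_(m in [set m | (N <= m)%N]) (X_ m @^-1` A_ k)).
  apply: bigcupT_measurable => k; apply: bigcupT_measurable => N.
  apply: bigcap_measurableType => m _.
  rewrite -[X in measurable X]setTI; apply: mX => //.
  by apply: sub_sigma_algebra; exact: open_interior.
apply/seteqP; split => w.
  move=> AX; have /nbhs_ballP[e /= e0 eA] : nbhs (X w) A by exact: open_nbhs_nbhs.
  have [k _ rk] : \forall k \near \oo, r k < e / 2.
    by apply: near_infty_natSinv_lt (PosNum (_ : 0 < e / 2)); rewrite divr_gt0.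
  have {}rk := rk k (leqnn _).
  exists k => //; have [N _ HN] : \forall m \near \oo, ball (X w) (r k) (X_ m w).
    by apply: cX; exact: nbhsx_ballx.
  exists N => // m /= Nm.
  have : nbhs (X_ m w) (ball (X w) (r k)).
    by apply: open_nbhs_nbhs; split; [exact: ball_open|exact: HN].
  rewrite /A_ /interior /preimage/=; apply: filterS => x xr z xz; apply: eA.
  by rewrite (splitr e); apply: ball_triangle (le_ball (ltW rk) xr) (le_ball (ltW rk) xz).
move=> [k _ [N _ HN]].
have [N' _ HN'] : \forall m \near \oo, ball (X w) (r k) (X_ m w).
  by apply: cX; exact: nbhsx_ballx.
have := HN _ (leq_maxl N N') => /interior_subset; apply.
by apply: ball_sym; apply: HN'; exact: leq_maxr.
Qed.

(** Interpolations are measurable finite combinations and converge to the loop, so measurable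
    evaluations suffice. *)
Lemma measurable_loop (n : nat) (Z : T -> loopSpace R n) :
  (forall t j, measurable_fun setT (fun w => val (Z w) t 0 j)) ->
  measurable_fun setT (Z : T -> borelType (loopSpace R n)).
Proof.
move=> mZ; apply: (@measurable_cvg_borel _ (fun m w => interpolate m (Z w))); last first.
  by move=> w; exact: cvg_interpolate.
move=> m; rewrite (_ : (fun w => _) = (fun w => \sum_(ij : 'I_m * 'I_n)
    val (Z w) (node m ij.1) 0 ij.2 *: tent_loop ij.1 (delta_mx 0 ij.2))); last first.
  by apply/funext => w; rewrite /interpolate pair_bigA.
exact: measurable_lincomb.
Qed.

Lemma pushforward_probability d' (U : measurableType d') (P : probability T R) (X : T -> U) :
  measurable_fun setT X ->
  exists mu : probability U R, forall A, measurable A -> mu A = P (X @^-1` A).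
Proof.
move=> mX.
pose mX_mixin := isMeasurableFun.Build _ _ _ _ _ mX.
pose X' : {mfun T >-> U} := MeasurableFun.Pack (MeasurableFun.Class mX_mixin).
by exists (distribution P X').
Qed.

End borel_maps.

Section loop_eval.
Context {R : realType} (n : nat) (t : R) (j : 'I_n).

Definition loop_eval (s : loopSpace R n) : R^o := val s t 0 j.

Lemma loop_eval_is_linear : linear loop_eval.
Proof. by move=> a u v; rewrite /loop_eval -[val _ t]/(a *: val u t + val v t) !mxE. Qed.

HB.instance Definition _ := GRing.isLinear.Build R (loopSpace R n) R^o _ loop_eval
  loop_eval_is_linear.

Lemma loop_eval_continuous : continuous loop_eval.
Proof.
move=> s; apply/(@cvgrPdist_lt _ _ _ (nbhs s)) => e e0.
have : nbhs s (ball s e) by exact: nbhsx_ballx.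
apply: filterS => u; rewrite -ball_normE /= => su.
rewrite -[X in `|X|]/(loop_eval s - loop_eval u) -linearB.
apply: le_lt_trans (coord_le_norm _ _) _.
exact: le_lt_trans (loop_norm_ub _ _) su.
Qed.

End loop_eval.

Section paths.
Context {R : realType} (n : nat).

Lemma cvg_rV (T : Type) (F : set_system T) (f : T -> 'rV[R]_n) (a : 'rV[R]_n) :
  Filter F -> (forall i, f x 0 i @[x --> F] --> a 0 i) -> f x @[x --> F] --> a.
Proof.
move=> FF fa; apply/cvgrPdist_le => e e0.
have : \forall x \near F, forall i, `|a 0 i - f x 0 i| <= e.
  by apply: filter_forall => i; move/cvgrPdist_le: (fa i); exact.
apply: filterS => x xe; apply: norm_le_coord; first exact: ltW.
by move=> i; rewrite !mxE.
Qed.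

Lemma continuous_extend0 (u : R -> R) : {within `[0, 1[, continuous u} ->
  u t @[t --> 1^'-] --> (0 : R) ->
  {within `[0, 1], continuous (fun t => if 0 <= t < 1 then u t else 0)}.
Proof.
move=> cu u1.
have key (b : R) : 0 < b < 1 -> {in `]0, b[, continuous u} /\ u t @[t --> 0^'+] --> u 0.
  move=> /andP[b0 b1].
  have : {within `[0, b], continuous u}.
    by apply: continuous_subspaceW cu => x /=; rewrite !in_itv/=; lra.
  by move/continuous_within_itvP => /(_ b0)[].
apply/continuous_within_itvP => //; split.
- move=> x; rewrite in_itv/= => /andP[x0 x1].
  have [|+ _] := key ((x + 1) / 2); first by lra.
  move=> /(_ x); rewrite in_itv/= x0/= => /(_ _) cux.
  have {}cux : u t @[t --> x] --> u x by apply: cux; lra.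
  rewrite /continuous_at (ltW x0) x1/=; apply: cvg_trans cux; apply: near_eq_cvg.
  near=> t; rewrite ifT//; apply/andP; split; last by near: t; exact: lt_nbhsl.
  by apply: ltW; near: t; exact: lt_nbhsr.
- rewrite lexx ltr01/=; have [|_ cu0] := key 2^-1; first by lra.
  apply: cvg_trans cu0; apply: near_eq_cvg; near=> t; rewrite ifT//.
  by apply/andP; split; near: t; [exact: nbhs_right_ge|exact: nbhs_right_lt].
- rewrite ltxx andbF; apply: cvg_trans u1; apply: near_eq_cvg; near=> t; rewrite ifT//.
  by apply/andP; split; near: t; [exact: nbhs_left_ge|exact: nbhs_left_lt].
Unshelve. all: by end_near.
Qed.

End paths.

Section loop_law.
Context {R : realType} (n : nat) d (T : measurableType d) (P : probability T R).
Variables (B y : R -> T -> 'rV[R]_n) (f E q : R -> R).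
Hypothesis bm : brownian_motion P B.
Hypothesis sde : sde_solution P B f y.
Hypothesis ifE : integrating_factor f E q.
Hypothesis Eoo : E t @[t --> 1^'-] --> +oo.
Hypothesis n_gt0 : (0 < n)%N.

Lemma sde_coord_end_ae : {ae P, forall w, forall i, y t w 0 i @[t --> 1^'-] --> (0 : R)}.
Proof.
apply: filterS (sde_path_ae bm sde) => w h i; have [cy cB yE] := h i.
exact: (sde_end ifE cy yE cB Eoo).
Qed.

Lemma extend_at_1_end : {ae P, forall w, extend_at_1 y t w @[t --> 1^'-] --> (0 : 'rV[R]_n)}.
Proof.
apply: filterS sde_coord_end_ae => w h; apply: cvg_rV => i; rewrite mxE.
apply: cvg_trans (h i); apply: near_eq_cvg; near=> t.
by rewrite /extend_at_1 ifT//; near: t; exact: nbhs_left_lt.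
Unshelve. all: by end_near.
Qed.

Definition sde_loop_path w : R -> 'rV[R]_n := fun t => if 0 <= t < 1 then y t w else 0.

Lemma sde_loop_path_ae : {ae P, forall w, sde_loop_path w \in is_loop R n}.
Proof.
apply: filterS3 sde_coord_end_ae (sde_path_ae bm sde) (sde_start sde) => w h1 h2 y0.
apply/mem_set; split.
- apply/subspace_continuousP => x x01; apply: cvg_rV => i.
  have [cy _ _] := h2 i.
  have e : (fun t => sde_loop_path w t 0 i) = (fun t => if 0 <= t < 1 then y t w 0 i else 0).
    by apply/funext => t; rewrite /sde_loop_path; case: ifP => // _; rewrite mxE.
  have := continuous_extend0 cy (h1 i); rewrite -e.
  by move=> /subspace_continuousP/(_ x x01).
- by rewrite /sde_loop_path lexx ltr01.
- by rewrite /sde_loop_path ltxx andbF.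
- move=> t; rewrite in_itv/= /sde_loop_path => /negbTE t01; rewrite ifF//.
  by apply/negP => /andP[t0 /ltW t1]; rewrite t0 t1 in t01.
Qed.

Lemma sde_loop_law : exists mu, loop_law P (extend_at_1 y) mu.
Proof.
have [N [mN N0 sN]] := sde_loop_path_ae.
(* [N] is a measurable null set outside of which the path is a loop; the zero loop on [N] keeps [Z]
   measurable and loop-valued everywhere. *)
pose g w : R -> 'rV[R]_n := if w \in N then 0 else sde_loop_path w.
have loop_g w : g w \in is_loop R n.
  rewrite /g; case: ifPn => [_|]; first exact: rpred0.
  by rewrite notin_setE => nN; apply: contrapT => h; exact/nN/sN.
pose Z w : loopSpace R n := exist (fun f => f \in is_loop R n) _ (loop_g w).
have mZ : measurable_fun setT (Z : T -> borelType (loopSpace R n)).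
  apply: measurable_loop => t j.
  rewrite (_ : (fun w => _) = (fun w => \1_(~` N) w *
      (if 0 <= t < 1 then y t w else 0) 0 j)); last first.
    apply/funext => w; rewrite /Z/= /g indicE in_setC.
    by case: ifPn => _; rewrite ?mul0r ?mul1r// mxE.
  apply: measurable_funM; first exact/measurable_indic/measurableC.
  have [t01|_] := boolP (0 <= t < 1); first exact: (measurable_sde_coord sde).
  by under eq_fun do rewrite mxE; exact: measurable_cst.
have [mu muE] := pushforward_probability P mZ.
exists mu, Z; split => //.
exists N; split => // w; apply: contra_notP => nN t /andP[t0 t1].
by rewrite /Z/= /g memNset//= /sde_loop_path /extend_at_1 t0/=.
Qed.



End loop_law.

Lemma abel_sum (R : pzRingType) (p : nat) (a X : nat -> R) : X 0%N = 0 ->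
  \sum_(0 <= k < p) a k * X k.+1 =
  \sum_(0 <= k < p) (\sum_(k <= l < p) a l) * (X k.+1 - X k).
Proof.
move=> X0; elim: p => [|p IH]; first by rewrite !big_geq.
rewrite [LHS]big_nat_recr//= IH [RHS]big_nat_recr//=.
rewrite [in RHS]big_nat1.
under [in RHS]eq_big_nat => k /andP[_ kp].
  rewrite big_nat_recr ?(ltnW kp)//= mulrDl; over.
rewrite big_split/= -addrA; congr (_ + _).
rewrite -mulr_sumr telescope_sumr// X0 subr0 -mulrDr.
by rewrite addrC subrK.
Qed.

(** * Continuous functionals of a bridge *)

Section bridge_functional.
Context {R : realType} (n : nat) d (T : measurableType d) (P : probability T R).
Variables (B y : R -> T -> 'rV[R]_n) (f E q : R -> R).
Hypothesis bm : brownian_motion P B.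
Hypothesis sde : sde_solution P B f y.
Hypothesis ifE : integrating_factor f E q.
Hypothesis n_gt0 : (0 < n)%N.

(* Summation by parts rewrites a combination of values of y, with coefficients
   c, as one of increments of the martingale E y, with these coefficients. *)
Definition dual_coef (p : nat) (t : nat -> R) (c : nat -> 'I_n -> R) k i : R :=
  \sum_(k <= l < p) c l i / E (t l.+1).

Definition dual_variance p t c : R :=
  \sum_(0 <= k < p) (\sum_i dual_coef p t c k i ^+ 2) * (q (t k.+1) - q (t k)).

(** Stated for any [u] that vanishes at the first node, as it is applied both to random paths of [y]
    and to a fixed loop tested for Cameron-Martin membership. *)
Lemma dual_sum p (t : nat -> R) (c : nat -> 'I_n -> R) (u : R -> 'I_n -> R) :
  (forall k, (k < p)%N -> E (t k.+1) != 0) -> (forall i, u (t 0%N) i = 0) ->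
  \sum_(0 <= k < p) \sum_i c k i * u (t k.+1) i =
  \sum_(0 <= k < p) \sum_i dual_coef p t c k i *
    (E (t k.+1) * u (t k.+1) i - E (t k) * u (t k) i).
Proof.
move=> Et u0; rewrite exchange_big [RHS]exchange_big/=; apply: eq_bigr => i _.
rewrite -(@abel_sum _ p (fun l => c l i / E (t l.+1)) (fun k => E (t k) * u (t k) i)); last first.
  by rewrite u0 mulr0.
apply: eq_big_nat => k /andP[_ kp]; rewrite mulrA divfK//; exact: Et.
Qed.

Lemma gaussian_bridge_sum p (t : nat -> R) (c : nat -> 'I_n -> R) :
  t 0%N = 0 -> (forall k, (k < p)%N -> t k <= t k.+1) -> t p < 1 ->
  gaussian P (fun w => \sum_(0 <= k < p) \sum_i c k i * y (t k.+1) w 0 i)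
    (Num.sqrt (dual_variance p t c)).
Proof.
move=> t0 tS tp.
have tmono j k : (j <= k)%N -> (k <= p)%N -> t j <= t k.
  elim: k => [|k IHk]; first by rewrite leqn0 => /eqP->.
  rewrite leq_eqVlt => /predU1P[->//|jk] kp.
  by apply: le_trans (tS k kp); apply: IHk => //; exact: ltnW.
have t01 k : (k <= p)%N -> 0 <= t k < 1.
  by move=> kp; rewrite -{1}t0 tmono//= (le_lt_trans _ tp)// tmono.
have t00 : 0 <= t 0%N by rewrite t0.
have g := gaussian_martingale_sum bm sde ifE n_gt0 (dual_coef p t c) t00 tS tp.
apply: ae_gaussian g.
- under eq_fun do rewrite big_mkord.
  apply: measurable_sum => k; apply: measurable_sum => i; apply: measurable_funM => //.
  under eq_fun do rewrite !mxE.
  by apply: measurable_funB; exact: (measurable_martingale_coord E sde).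
- under eq_fun do rewrite big_mkord.
  apply: measurable_sum => k; apply: measurable_sum => i; apply: measurable_funM => //.
  by apply: (measurable_sde_coord sde); apply: t01.
- apply: filterS (sde_start sde) => w y0.
  rewrite (@dual_sum p t c (fun r i => y r w 0 i)); last first.
    by move=> i; rewrite t0 y0 mxE.
    by move=> k kp; rewrite gt_eqF// (if_gt0 ifE)// t01.
  apply: eq_big_nat => k /andP[_ kp]; apply: eq_bigr => i _.
  by rewrite /sde_martingale !t01// ?(ltnW kp)// !mxE.
Qed.

Variable l : {linear loopSpace R n -> R^o}.
Hypothesis cl : continuous l.

Definition grid (m k : nat) : R := k%:R / m.+1%:R.

(** Values of [l] on the tents, extended by 0 to all [k] so as to fit sums over natural numbers. *)
Definition tent_coef (m k : nat) (j : 'I_n) : R :=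
  oapp (fun i : 'I_m => l (tent_loop i (delta_mx 0 j))) 0 (insub k).

Lemma linear_interpolate m s : l (interpolate m s) =
  \sum_(0 <= k < m) \sum_j tent_coef m k j * val s (grid m k.+1) 0 j.
Proof.
rewrite big_mkord /interpolate linear_sum; apply: eq_bigr => i _.
rewrite linear_sum; apply: eq_bigr => j _.
by rewrite linearZ /tent_coef valK/= mulrC.
Qed.

Lemma grid0 m : grid m 0 = 0.
Proof. by rewrite /grid mul0r. Qed.

Lemma grid_le m k : grid m k <= grid m k.+1.
Proof. by rewrite /grid ler_pM2r ?invr_gt0// ler_nat. Qed.

Lemma grid_lt1 m k : (k <= m)%N -> grid m k < 1.
Proof. by move=> km; rewrite /grid ltr_pdivrMr// mul1r ltr_nat ltnS. Qed.

Lemma grid_itv m k : (k <= m)%N -> 0 <= grid m k < 1.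
Proof. by move=> km; rewrite grid_lt1// andbT divr_ge0. Qed.

(** The variance of [l] at the interpolated bridge. It is determined by [E], [q] and [l], without
    reference to a probability space. *)
Definition loop_variance m : R := dual_variance m (grid m) (tent_coef m).

Lemma dual_variance_ge0 m c : 0 <= dual_variance m (grid m) c.
Proof.
rewrite /dual_variance big_nat sumr_ge0// => k /andP[_ km].
rewrite mulr_ge0//; first by apply: sumr_ge0 => i _; exact: sqr_ge0.
rewrite subr_ge0; apply: (if_clock_le ifE); [|exact: grid_le|exact: grid_lt1].
by have /andP[] := grid_itv (ltnW km).
Qed.

Variable Z : T -> borelType (loopSpace R n).
Hypothesis mZ : measurable_fun setT Z.
Hypothesis Zy : {ae P, forall w, forall t : R, 0 <= t <= 1 ->
  val (Z w : loopSpace R n) t = extend_at_1 y t w}.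

Lemma measurable_functional : measurable_fun setT ((fun w => l (Z w)) : T -> R).
Proof. exact: (measurableT_comp (continuous_borel_measurable cl) mZ). Qed.

(** On interpolated loops [l] is a finite combination of values of [y], hence Gaussian;
    [gaussian_limit] passes to the loop itself. *)
Lemma gaussian_functional : exists s : R, [/\ 0 <= s,
  loop_variance m @[m --> \oo] --> s ^+ 2 & gaussian P (fun w => l (Z w)) s].
Proof.
pose X m w : R := l (interpolate m (Z w)).
have mX m : measurable_fun setT (X m).
  rewrite (_ : X m = (fun w => \sum_(k < m) \sum_j tent_coef m k j *
      val (Z w : loopSpace R n) (grid m k.+1) 0 j)); last first.
    by apply/funext => w; rewrite /X linear_interpolate big_mkord.
  apply: measurable_sum => k; apply: measurable_sum => j; apply: measurable_funM => //.
  have me := continuous_borel_measurable (@loop_eval_continuous R n (grid m k.+1) j).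
  exact: measurableT_comp me mZ.
have gX m : gaussian P (X m) (Num.sqrt (loop_variance m)).
  have := gaussian_bridge_sum (tent_coef m) (grid0 m) (fun k _ => grid_le m k) (grid_lt1 (leqnn m)).
  apply: ae_gaussian => //.
    under eq_fun do rewrite big_mkord.
    apply: measurable_sum => k; apply: measurable_sum => i; apply: measurable_funM => //.
    by apply: (measurable_sde_coord sde); apply: grid_itv.
  apply: filterS Zy => w h; rewrite /X linear_interpolate.
  apply: eq_big_nat => k /andP[_ km]; apply: eq_bigr => j _; congr (_ * _).
  have /andP[g0 g1] := grid_itv km.
  by rewrite h ?g0 ?ltW// /extend_at_1 g1.
have cX : {ae P, forall w, X m w @[m --> \oo] --> l (Z w)}.
  apply: aeW => w; apply: continuous_cvg; first exact: cl.
  exact: cvg_interpolate.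
have [s [s0 cs gs]] := gaussian_limit mX measurable_functional gX cX.
exists s; split => //; apply: cvg_trans cs; apply: near_eq_cvg; apply: nearW => m.
by rewrite sqr_sqrtr// dual_variance_ge0.
Qed.

End bridge_functional.

Section loop_law_gaussian.
Context {R : realType} (n : nat) d (T : measurableType d) (P : probability T R).
Variables (B y : R -> T -> 'rV[R]_n) (f E q : R -> R).
Hypothesis bm : brownian_motion P B.
Hypothesis sde : sde_solution P B f y.
Hypothesis ifE : integrating_factor f E q.
Hypothesis n_gt0 : (0 < n)%N.
Variable mu : probability (borelType (loopSpace R n)) R.
Hypothesis law : loop_law P (extend_at_1 y) mu.

Lemma loop_law_functional (l : {linear loopSpace R n -> R^o}) : continuous l ->
  exists s : R, [/\ 0 <= s, loop_variance E q l m @[m --> \oo] --> s ^+ 2 &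
    gaussian mu (l : borelType (loopSpace R n) -> R) s].
Proof.
move=> cl; have [Z [mZ Zy muE]] := law.
have [s [s0 cs gs]] := gaussian_functional bm sde ifE n_gt0 cl mZ Zy.
exists s; split => // A mA; rewrite -gs// muE//.
by rewrite -[X in measurable X]setTI; exact: (continuous_borel_measurable cl).
Qed.

Lemma loop_law_centred_gaussian : centred_gaussian mu.
Proof.
move=> l cl; have [s [s0 _ gs]] := loop_law_functional cl.
by exists s; split => //; apply/gaussian_centred_normal.
Qed.

Lemma loop_law_eval t j : 0 <= t < 1 ->
  gaussian mu (@loop_eval R n t j : borelType (loopSpace R n) -> R) (Num.sqrt (q t) / E t).
Proof.
move=> /andP[t0 t1]; have [Z [mZ Zy muE]] := law => A mA.
have meval := continuous_borel_measurable (@loop_eval_continuous R n t j).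
rewrite muE//; last by rewrite -[X in measurable X]setTI; exact: meval.
move: A mA; rewrite -/(gaussian P (fun w => loop_eval t j (Z w)) _).
have Et : 0 < E t by rewrite (if_gt0 ifE)// t0.
have := gaussianZ (E t)^-1 (gaussian_martingale_increment bm sde ifE n_gt0
  (fun i => (i == j)%:R) (lexx 0) t0 t1).
rewrite (bigD1 j)//= eqxx expr1n big1 ?addr0; last first.
  by move=> i /negbTE ->; rewrite expr0n.
rewrite (if_clock0 ifE) subr0 mul1r mulrC.
apply: ae_gaussian.
- apply: measurable_funM => //; apply: measurable_sum => i; apply: measurable_funM => //.
  under eq_fun do rewrite !mxE.
  by apply: measurable_funB; exact: (measurable_martingale_coord E sde).
- exact: measurableT_comp meval mZ.
- apply: filterS2 Zy (sde_start sde) => w h y0.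
  rewrite (bigD1 j)//= eqxx mul1r big1 ?addr0; last by move=> i /negbTE ->; rewrite mul0r.
  rewrite /loop_eval h ?t0 ?ltW// /extend_at_1 t1 /sde_martingale lexx ltr01 t0 t1/= y0.
  by rewrite scaler0 subr0 mxE mulKf// gt_eqF.
Qed.

Lemma Lnorm_gaussian (l : borelType (loopSpace R n) -> R) (s : R) :
  measurable_fun setT l -> gaussian mu l s -> ('N[mu]_2%:E [EFin \o l] = `|s|%:E)%E.
Proof.
move=> ml gl; rewrite unlock /Lnorm.
rewrite (_ : (\int[mu]_x _)%E = (s ^+ 2)%:E); last first.
  rewrite -(gaussian_pow2 ml gl); apply: eq_integral => x _ /=.
  by rewrite powR_mulrn// real_normK// num_real.
by rewrite poweR_EFin powR12_sqrt ?sqr_ge0// sqrtr_sqr.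
Qed.

End loop_law_gaussian.

(** * Singularity and Cameron-Martin spaces *)

Section singular.
Context {R : realType}.

(** Borel-Cantelli along eps = 2^-(k+1): the upper limit of the sets is [mu]-null, and its
    complement is a union of intersections that are [nu]-null, each being contained in complements
    of arbitrarily small measure. *)
Lemma mutually_singular_approx d (T : measurableType d) (mu nu : probability T R) :
  (forall eps : R, 0 < eps -> exists A, [/\ measurable A, (mu A <= eps%:E)%E &
     (nu (~` A) <= eps%:E)%E]) ->
  mutually_singular mu nu.
Proof.
move=> H.
pose e k : R := 1 / (2 ^ k.+1)%:R.
have e0 k : 0 < e k by rewrite divr_gt0// ltr0n expn_gt0.
have /choice[A HA] k := H (e k) (e0 k).
have mA k : measurable (A k) by have [] := HA k.
have ce : e k @[k --> \oo] --> (0 : R).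
  rewrite (_ : e = geometric 2^-1 2^-1); first by apply: cvg_geometric; rewrite ger0_norm// invf_lt1// ltr1n.
  by apply/funext => k; rewrite /e /geometric/= natrX -exprS exprVn mul1r.
have mL : measurable (lim_sup_set A).
  by apply: bigcap_measurableType => // k _; apply: bigcup_measurable => j _.
exists (lim_sup_set A); split => //.
  apply: lim_sup_set_cvg0 => //.
  apply: (@le_lt_trans _ _ 1%:E); last exact: ltry.
  apply: le_trans (epsilon_trick0 xpredT (ler01 : (0 : R) <= 1)).
  by apply: lee_nneseries => // k _; have [] := HA k.
apply: measure_negligible; first exact: measurableC.
rewrite /lim_sup_set setC_bigcap; apply: negligible_bigcup => k.
rewrite setC_bigcup; set S := \bigcap_(j in _) _.
have mS : measurable S by apply: bigcap_measurableType => j _; exact: measurableC.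
apply/negligibleP => //; apply/eqP; rewrite eq_le measure_ge0 andbT.
have fS : nu S \is a fin_num by exact: fin_num_measure.
apply: (@le_trans _ _ (fine (nu S))%:E); first by rewrite fineK.
rewrite lee_fin.
apply: ler_cvg_to (cvg_cst (fine (nu S))) ce _; exists k => // j /= kj.
rewrite -lee_fin fineK//; have [_ _] := HA j; apply: le_trans.
apply: le_measure; rewrite ?inE//; first exact: measurableC.
exact: bigcap_inf.
Qed.

(** A threshold between the two scales separates the laws: [X] rarely exceeds it under [mu] by the
    tail bound, and rarely stays below it under [nu] by the small ball bound. *)
Lemma gaussian_singular d (T : measurableType d) (mu nu : probability T R) (I : Type)
    (X : I -> T -> R) (s1 s2 : I -> R) : (forall i, measurable_fun setT (X i)) ->
  (forall eps : R, 0 < eps -> exists i, [/\ gaussian mu (X i) (s1 i), gaussian nu (X i) (s2 i),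
     0 < s2 i & s1 i ^+ 2 <= eps * s2 i ^+ 2]) ->
  mutually_singular mu nu.
Proof.
move=> mX H; apply: mutually_singular_approx => e e0.
(* With [c = e * s2 i / 4], the tail bound becomes [e] and the small ball bound [e / 2]. *)
have [|i [g1 g2 s20 s12]] := H (e ^+ 3 / 16); first by rewrite divr_gt0// exprn_gt0.
pose c := e * s2 i / 4.
have c0 : 0 < c by rewrite divr_gt0// mulr_gt0.
have mnX : measurable_fun setT (fun w => `|X i w|) by exact: measurableT_comp.
have mA : measurable [set w | c <= `|X i w|].
  rewrite -[X in measurable X]setTI.
  exact: (measurable_fun_le (f := cst c) (g := fun w => `|X i w|)).
exists [set w | c <= `|X i w|]; split => //.
  apply: le_trans (gaussian_tail (mX i) g1 c0) _; rewrite lee_fin.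
  rewrite ler_pdivrMr ?exprn_gt0//; apply: le_trans s12 _.
  by rewrite /c le_eqVlt; apply/orP; left; apply/eqP; field.
have := gaussian_small_ball g2 s20 (ltW c0).
rewrite (_ : 2 * c / s2 i = e / 2); last by rewrite /c; field; rewrite gt_eqF.
move=> le2; apply: (@le_trans _ _ (e / 2)%:E); last by rewrite lee_fin; lra.
apply: le_trans le2; apply: le_measure; rewrite ?inE//; first exact: measurableC.
  rewrite -[X in measurable X]setTI.
  exact: (measurable_fun_le (g := cst c) (f := fun w => `|X i w|)).
by move=> w /= /negP; rewrite -ltNge => /ltW.
Qed.

End singular.

Section cameron_martin.
Context {R : realType} (n : nat).
Variable mu : probability (borelType (loopSpace R n)) R.
Variables (E q : R -> R).
Hypothesis ev : forall t j, 0 <= t < 1 ->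
  gaussian mu (@loop_eval R n t j : borelType (loopSpace R n) -> R) (Num.sqrt (q t) / E t).
Hypothesis fn : forall l : {linear loopSpace R n -> R^o}, continuous l ->
    exists s : R, [/\ 0 <= s, loop_variance E q l m @[m --> \oo] --> s ^+ 2 &
    gaussian mu (l : borelType (loopSpace R n) -> R) s].

(** Evaluations divided by their deviation have norm 1 in L2, and the hypothesis makes their values
    at [h] unbounded. *)
Lemma not_in_cameron_martin (h : loopSpace R n) j :
  (forall M : R, exists t, [/\ 0 <= t < 1, 0 < q t, 0 < E t &
      M * (Num.sqrt (q t) / E t) < `|val h t 0 j|]) ->
  ~ cameron_martin_space mu h.
Proof.
move=> H; rewrite /cameron_martin_space/=; set S := [set _ | _ in _] => supS.
have inS t : 0 <= t < 1 -> 0 < q t -> 0 < E t ->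
    S (`|val h t 0 j| / (Num.sqrt (q t) / E t))%:E.
  move=> t01 qt Et; set s := Num.sqrt (q t) / E t.
  have s0 : 0 < s by rewrite divr_gt0// sqrtr_gt0.
  pose l : {linear loopSpace R n -> R^o} := s^-1 \*: @loop_eval R n t j.
  have cl : continuous l.
    move=> u; apply: (@cvgZl_tmp R R^o (loopSpace R n) (nbhs u)).
    exact: loop_eval_continuous.
  exists l; last by rewrite /l/= /GRing.scale/= normrM normfV (gtr0_norm s0) mulrC.
  split => //.
  rewrite (Lnorm_gaussian (continuous_borel_measurable cl) (s := 1)).
    by rewrite normr1.
  have := gaussianZ s^-1 (ev j t01); rewrite -/s mulVf ?gt_eqF//.
have [M SM] : exists M : R, forall x, S x -> (x <= M%:E)%E.
  (* One admissible functional exists, so the supremum is not minus infinity and [fine] keeps its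
     value. *)
  have [t [t01 qt Et _]] := H 0.
  have h0 := ereal_sup_ubound (inS t t01 qt Et).
  exists (fine (ereal_sup S)) => x Sx; rewrite fineK ?ereal_sup_ubound//.
  rewrite fin_numE -ltey supS andbT; apply/negP => /eqP e.
  by move: h0; rewrite e leeNy_eq.
have [t [t01 qt Et Mt]] := H M.
have s0 : 0 < Num.sqrt (q t) / E t by rewrite divr_gt0// sqrtr_gt0.
have := SM _ (inS t t01 qt Et).
by rewrite lee_fin ler_pdivrMr// leNgt Mt.
Qed.

(* The assumption on h stands for a finite energy: with D = E h it follows from
   2 a dD <= a^2 dq + dD^2 / dq, where S is the integral of (D')^2 / q'.  Summed
   over a grid, it bounds 2 |l h| by the variance of l plus K. *)
Lemma in_cameron_martin (h : loopSpace R n) (S : R -> R) (K : R) :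
  (forall t, 0 <= t < 1 -> E t != 0) ->
  (forall (a : 'I_n -> R) s t, 0 <= s -> s <= t -> t < 1 ->
    2 * (\sum_j a j * (E t * val h t 0 j - E s * val h s 0 j)) <=
      (\sum_j a j ^+ 2) * (q t - q s) + (S t - S s)) ->
  (forall t, 0 <= t < 1 -> S t - S 0 <= K) ->
  cameron_martin_space mu h.
Proof.
move=> E0 inc SK.
have key (l : {linear loopSpace R n -> R^o}) : continuous l ->
    ('N[mu]_2%:E [EFin \o l] <= 1)%E -> `|l h| <= (1 + K) / 2.
  move=> cl; have [s [s0 cs gs]] := fn cl.
  rewrite (Lnorm_gaussian (continuous_borel_measurable cl) gs) lee_fin ger0_norm// => s1.
  have h0 : val h 0 = 0 by have [] := set_mem (valP h).
  have ds m : l (interpolate m h) = \sum_(0 <= k < m) \sum_i dual_coef E m (grid m) (tent_coef l m) k i *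
    (E (grid m k.+1) * val h (grid m k.+1) 0 i - E (grid m k) * val h (grid m k) 0 i).
    rewrite linear_interpolate.
    rewrite (@dual_sum _ _ E m (grid m) (tent_coef l m) (fun t i => val h t 0 i))//.
      by move=> k km; apply: E0; exact: grid_itv.
    by move=> i; rewrite grid0 h0 mxE.
  have bound m : `|l (interpolate m h)| <= (loop_variance E q l m + K) / 2.
    have tele : \sum_(0 <= k < m) (S (grid m k.+1) - S (grid m k)) <= K.
      rewrite (telescope_sumr (fun k => S (grid m k)))// grid0; apply: SK; exact: grid_itv.
    have st k : (k < m)%N -> [/\ (0 : R) <= grid m k, (grid m k : R) <= grid m k.+1 &
        (grid m k.+1 : R) < 1].
      by move=> km; split; [by have /andP[] := @grid_itv R m k (ltnW km)|exact: grid_le|exact: grid_lt1].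
    rewrite ler_pdivlMr// mulrC ds /loop_variance /dual_variance.
    (* The cases 1 and -1 of [b] together bound the absolute value. *)
    have le1 (b : R) : b ^+ 2 = 1 -> 2 * (b * \sum_(0 <= k < m) \sum_i
         dual_coef E m (grid m) (tent_coef l m) k i *
        (E (grid m k.+1) * val h (grid m k.+1) 0 i - E (grid m k) * val h (grid m k) 0 i)) <=
        \sum_(0 <= k < m) (\sum_i dual_coef E m (grid m) (tent_coef l m) k i ^+ 2) *
         (q (grid m k.+1) - q (grid m k)) + K.
      move=> b1; apply: (@le_trans _ _ (\sum_(0 <= k < m) ((\sum_i dual_coef E m (grid m) (tent_coef l m) k i ^+ 2) *
         (q (grid m k.+1) - q (grid m k)) + (S (grid m k.+1) - S (grid m k))))); last first.
        by rewrite big_split/= lerD2l.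
      rewrite !mulr_sumr; apply: ler_sum_nat => k /andP[_ km].
      have [a1 a2 a3] := st k km.
      have := inc (fun i => b * dual_coef E m (grid m) (tent_coef l m) k i) _ _ a1 a2 a3.
      congr (_ <= _).
        by congr (_ * _); rewrite mulr_sumr; apply: eq_bigr => i _; rewrite mulrA.
      congr (_ * _ + _); apply: eq_bigr => i _.
      by rewrite exprMn b1 mul1r.
    have := le1 1 (expr1n _ _); have := le1 (-1) (etrans (sqrrN _) (expr1n _ _)).
    set A := \sum_(0 <= k < m) _; set A' := \sum_(0 <= k < m) _.
    rewrite mulN1r mul1r => hN hP.
    by rewrite -[2](ger0_norm (ler0n _ 2)) -normrM ler_norml; lra.
  have cl' : `|l (interpolate m h)| @[m --> \oo] --> `|l h|.
    apply: cvg_norm; apply: continuous_cvg; first exact: cl.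
    exact: cvg_interpolate.
  have cb : (loop_variance E q l m + K) / 2 @[m --> \oo] --> (s ^+ 2 + K) / 2.
    by apply: cvgMl; apply: cvgD => //; exact: cvg_cst.
  (* Refining the grid replaces the grid variances by [s ^+ 2], which is at most 1 for an admissible
     functional. *)
  apply: (@le_trans _ _ ((s ^+ 2 + K) / 2)).
    by apply: ler_cvg_to cl' cb _; exact: nearW.
  by rewrite ler_pM2r// lerD2r expr_le1.
apply: (@le_lt_trans _ _ ((1 + K) / 2)%:E); last exact: ltry.
apply: ge_ereal_sup => _ [l [cl nl] <-]; rewrite lee_fin; exact: key.
Qed.

End cameron_martin.

(** * The integrating factors of the two bridges *)

Section powers.
Context {R : realType}.
Implicit Types (t p e : R).

Lemma is_derive_onem t : is_derive t 1 (fun s : R => 1 - s) (-1).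
Proof. by have := is_deriveB (is_derive_cst (1 : R) t 1) (is_derive_id t 1); rewrite sub0r. Qed.

Lemma is_derive_onem_powR p t : t < 1 ->
  is_derive t 1 (fun s : R => (1 - s) `^ p) (- (p * (1 - t) `^ (p - 1))).
Proof.
move=> t1; have u0 : 0 < 1 - t by rewrite subr_gt0.
have := @is_derive1_comp R (fun u => u `^ p) (fun s => 1 - s) t _ _ (is_derive1_powR p u0)
  (is_derive_onem t).
by rewrite mulrN1.
Qed.

Lemma continuous_onem_powR p t : t < 1 -> {for t, continuous (fun s : R => (1 - s) `^ p)}.
Proof.
move=> t1; apply: differentiable_continuous; apply/derivable1_diffP.
by have [] := is_derive_onem_powR p t1.
Qed.

Lemma near_onem (A : R -> Prop) :
  (\forall u \near 0^'+, A u) -> \forall t \near 1^'-, A (1 - t).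
Proof.
move=> [r /= r0 rA]; exists r => // t /= tr t1; apply: rA; rewrite ?subr_gt0//=.
by rewrite sub0r normrN.
Qed.

Lemma near_onem_powR p e : 0 < p -> 0 < e -> \forall t \near 1^'-, (1 - t) `^ p < e.
Proof.
move=> p0 e0; apply: (@near_onem (fun u => u `^ p < e)).
exact: (cvgr_lt 0 (powR_cvg0 p0)).
Qed.

Lemma cvg_onem_powR p : 0 < p -> (1 - t) `^ p @[t --> 1^'-] --> (0 : R).
Proof.
move=> p0; apply/cvgrPdist_lt => e e0; apply: filterS (near_onem_powR p0 e0) => t.
by rewrite sub0r normrN ger0_norm// powR_ge0.
Qed.

Lemma cvg_onem_powRN p : 0 < p -> (1 - t) `^ (- p) @[t --> 1^'-] --> +oo.
Proof.
move=> p0; apply/cvgryPge => M.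
have e0 : 0 < (Num.max 1 M)^-1 by rewrite invr_gt0 lt_max ltr01.
near=> t.
have t1 : t < 1 by near: t; exact: nbhs_left_lt.
have u0 : 0 < (1 - t) `^ p by rewrite powR_gt0// subr_gt0.
rewrite powRN; apply: (@le_trans _ _ (Num.max 1 M)); first by rewrite le_max lexx orbT.
rewrite -[leLHS]invrK lef_pV2 ?posrE//; apply: ltW.
by near: t; exact: near_onem_powR.
Unshelve. all: by end_near.
Qed.

(** The integral starts at -1, so that the two-sided derivative exists at 0; subtracting the value
    at 0 normalises it. *)
Lemma antiderivative (g : R -> R) : (forall t : R, t < 1 -> {for t, continuous g}) ->
  exists2 G : R -> R, G 0 = 0 & forall t : R, -1 < t < 1 -> is_derive t 1 G (g t).
Proof.
move=> cg.
pose F x : R := \int[lebesgue_measure]_(t in `[(-1 : R), x]) g t.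
have dF (x : R) : -1 < x < 1 -> is_derive x 1 F (g x).
  move=> /andP[x0 x1]; pose u := (x + 1) / 2.
  have xu : x < u by rewrite /u; lra.
  have u1 : u < 1 by rewrite /u; lra.
  have ig : lebesgue_measure.-integrable `[-1, u] (EFin \o g).
    apply: continuous_compact_integrable; first exact: segment_compact.
    apply: continuous_in_subspaceT => s; rewrite inE/= in_itv/= => /andP[_ su].
    by apply: cg; exact: le_lt_trans u1.
  have [dF FE] := continuous_FTC1_closed xu ig x0 (cg _ x1).
  by split; [exact: dF|rewrite -derive1E; exact: FE].
exists (fun x => F x - F 0); first by rewrite subrr.
move=> t t1; have := is_deriveB (dF t t1) (is_derive_cst (F 0) t 1).
by rewrite subr0.
Qed.

End powers.

Section classical_factor.
Context {R : realType}.

(** Here E' = E^2, so the clock is E - 1. *)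
Lemma classical_integrating_factor :
  integrating_factor (fun t : R => (1 - t)^-1) (fun t => (1 - t)^-1) (fun t => (1 - t)^-1 - 1).
Proof.
have dV (t : R) : t < 1 -> is_derive t 1 (fun s : R => (1 - s)^-1) ((1 - t)^-1 * (1 - t)^-1).
  move=> t1; have u0 : 0 < 1 - t by rewrite subr_gt0.
  have := @is_deriveV R (fun s => 1 - s) t _ _ (lt0r_neq0 u0) (is_derive_onem t).
  by rewrite /GRing.scale/= mulrN1 opprK expr2 invfM.
split.
- move=> t /andP[_ t1]; apply: differentiable_continuous; apply/derivable1_diffP.
  by have [] := dV t t1.
- by move=> t /andP[_ t1]; rewrite invr_ge0 subr_ge0 ltW.
- by move=> t /andP[_ t1]; exact: dV.
- by move=> t /andP[_ t1]; rewrite invr_gt0 subr_gt0.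
- move=> t /andP[_ t1]; have := is_deriveB (dV t t1) (is_derive_cst (1 : R) t 1).
  by rewrite subr0 expr2.
- by rewrite subr0 invr1 subrr.
Qed.

End classical_factor.

Section alpha_factor.
Context {R : realType}.
Variable alpha : R.
Hypothesis alpha_gt1 : 1 < alpha.

(** The exponential of an antiderivative of [f_ alpha]. *)
Definition alpha_factor (t : R) : R := expR ((alpha - 1)^-1 * (1 - t) `^ (1 - alpha)).

Lemma is_derive_alpha_factor (t : R) : t < 1 ->
  is_derive t 1 alpha_factor (f_ alpha t * alpha_factor t).
Proof.
move=> t1.
have D1 : is_derive t 1 (fun t : R => (alpha - 1)^-1 * (1 - t) `^ (1 - alpha)) (f_ alpha t).
  have D0 := is_derive_onem_powR (1 - alpha) t1.
  apply: is_derive_eq; rewrite /GRing.scale/= /f_ -powRN.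
  rewrite (_ : 1 - alpha - 1 = - alpha); last by ring.
  by field; rewrite subr_eq0 gt_eqF.
have := @is_derive1_comp R expR (fun t => (alpha - 1)^-1 * (1 - t) `^ (1 - alpha)) t _ _
  (is_derive_expR _) D1.
by rewrite mulrC.
Qed.

Lemma alpha_factor_gt0 t : 0 < alpha_factor t.
Proof. exact: expR_gt0. Qed.

Lemma continuous_alpha_factor (t : R) : t < 1 -> {for t, continuous alpha_factor}.
Proof.
move=> t1; apply: differentiable_continuous; apply/derivable1_diffP.
by have [] := is_derive_alpha_factor t1.
Qed.

Lemma cvg_alpha_factor : alpha_factor t @[t --> (1 : R)^'-] --> +oo.
Proof.
apply/cvgryPge => M.
have := @cvg_onem_powRN R (alpha - 1) ltac:(by rewrite subr_gt0).
move=> /cvgryPge/(_ ((alpha - 1) * M)); apply: filterS => t.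
rewrite opprB -ler_pdivlMl ?subr_gt0// => h.
by apply: le_trans h _; apply: le_trans (expR_ge1Dx _); rewrite lerDr.
Qed.

Lemma f_E t : f_ alpha t = (1 - t) `^ (- alpha).
Proof. by rewrite /f_ powRN. Qed.

Lemma alpha_integrating_factor :
  exists q, integrating_factor (f_ alpha) alpha_factor q.
Proof.
have [q q0 dq] := @antiderivative R (fun t => alpha_factor t ^+ 2)
  (fun t t1 => cvgM (continuous_alpha_factor t1) (continuous_alpha_factor t1)).
exists q; split => //.
- move=> t /andP[_ t1]; rewrite (_ : f_ alpha = (fun t => (1 - t) `^ (- alpha))).
    exact: continuous_onem_powR.
  by apply/funext => s; exact: f_E.
- by move=> t _; rewrite invr_ge0 powR_ge0.
- by move=> t /andP[_]; exact: is_derive_alpha_factor.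
- by move=> t _; exact: alpha_factor_gt0.
Qed.

Lemma f_blowup : f_ alpha t @[t --> 1^'-] --> +oo.
Proof.
have := @cvg_onem_powRN R alpha (lt_trans ltr01 alpha_gt1).
by apply: cvg_trans; apply: near_eq_cvg; apply: nearW => t; rewrite f_E.
Qed.

Lemma derive1n_f k (t : R) : t < 1 ->
  derive1n k (f_ alpha) t = (\prod_(i < k) (alpha + i%:R)) * (1 - t) `^ (- (alpha + k%:R)).
Proof.
elim: k t => [|k IH] t t1; first by rewrite big_ord0 mul1r addr0/= f_E.
rewrite derive1nS derive1E.
rewrite (near_eq_derive _ (_ : \near t, derive1n k (f_ alpha) t = (\prod_(i < k) (alpha + i%:R)) * (1 - t) `^ (- (alpha + k%:R)))); last first.
  by near=> s; apply: IH; near: s; exact: lt_nbhsl.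
have D0 := is_derive_onem_powR (- (alpha + k%:R)) t1.
rewrite (@derive_val _ _ _ _ _ _ _ (is_deriveZ (\prod_(i < k) (alpha + i%:R)) D0)).
rewrite big_ord_recr/= /GRing.scale/= -natr1.
rewrite (_ : - (alpha + k%:R) - 1 = - (alpha + (k%:R + 1))); last by ring.
by rewrite mulNr opprK mulrA.
Unshelve. all: by end_near.
Qed.

Lemma f_smooth : smooth_before_1 (f_ alpha).
Proof.
move=> k t /andP[_ t1].
near=> s.
have s1 : s < 1 by near: s; exact: lt_nbhsl.
have D0 := is_derive_onem_powR (- (alpha + k%:R)) s1.
have D1 := is_deriveZ (\prod_(i < k) (alpha + i%:R)) D0.
apply: near_eq_derivable (@ex_derive _ _ _ _ _ _ _ D1).
by near=> r; rewrite derive1n_f//; near: r; exact: lt_nbhsl.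
Unshelve. all: by end_near.
Qed.

(** With [G] the product on the right without [C], G' is E^2 times 2 - alpha (1 - t)^(alpha - 1).
    Near 1 this is at least E^2 = q', so [q] grows no faster than [G]. *)
Lemma alpha_variance_le q : integrating_factor (f_ alpha) alpha_factor q ->
  exists2 C : R, 0 < C & \forall t \near 1^'-,
    0 < q t /\ q t <= C * (alpha_factor t ^+ 2 * (1 - t) `^ alpha).
Proof.
move=> H.
have a0 : 0 < alpha := lt_trans ltr01 alpha_gt1.
have [t0 [t00 t01 small]] : exists t0 : R, [/\ 0 <= t0, t0 < 1 &
    forall t, t0 <= t < 1 -> alpha * (1 - t) `^ (alpha - 1) <= 1].
  have : \forall t \near 1^'-, (1 - t) `^ (alpha - 1) < alpha^-1.
    by apply: near_onem_powR; rewrite ?invr_gt0 ?subr_gt0.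
  move=> [r /= r0 rA]; exists (Num.max 0 (1 - r / 2)); split.
  - by rewrite le_max lexx.
  - by rewrite gt_max ltr01/=; lra.
  - move=> t; rewrite ge_max => /andP[/andP[_ rt] t1].
    rewrite -ler_pdivlMl// mulr1; apply/ltW/rA => //=.
    by rewrite gtr0_norm; lra.
pose G (t : R) := alpha_factor t ^+ 2 * (1 - t) `^ alpha.
have G0 (t : R) : t < 1 -> 0 < G t.
  by move=> t1; rewrite mulr_gt0 ?exprn_gt0 ?alpha_factor_gt0 ?powR_gt0// subr_gt0.
have dG (t : R) : t < 1 -> is_derive t 1 G
    (alpha_factor t ^+ 2 * (2 - alpha * (1 - t) `^ (alpha - 1))).
  move=> t1; have D1 := is_derive_alpha_factor t1; have D2 := is_derive_onem_powR alpha t1.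
  have D3 := is_deriveM (is_deriveM D1 D1) D2.
  rewrite (_ : G = (alpha_factor * alpha_factor * (fun s => (1 - s) `^ alpha))); last first.
    by apply/funext.
  apply: (is_derive_eq D3); rewrite /GRing.scale/= /f_.
  have u0 : (1 - t) `^ alpha != 0 by rewrite gt_eqF// powR_gt0// subr_gt0.
  rewrite [(alpha_factor * alpha_factor) t](_ : _ = alpha_factor t ^+ 2)//.
  move: (alpha_factor t) ((1 - t) `^ alpha) u0 ((1 - t) `^ (alpha - 1)) => a u u0 p.
  by field.
have le_G (s t : R) : t0 <= s -> s <= t -> t < 1 -> q t - q s <= G t - G s.
  move=> ts st t1.
  have : G s - q s <= G t - q t.
    apply: (@ger0_derive_le _ (fun t => G t - q t) (fun t => alpha_factor t ^+ 2 *
       (2 - alpha * (1 - t) `^ (alpha - 1)) - alpha_factor t ^+ 2)) => // x /andP[sx xt].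
      apply: is_deriveB; first by apply: dG; exact: le_lt_trans t1.
      by apply: (if_clock H); lra.
    rewrite subr_ge0 ler_peMr ?sqr_ge0//.
    have := small x; rewrite (le_trans ts sx) (le_lt_trans xt t1) => /(_ isT); lra.
  lra.
have q0 (t : R) : 0 <= t -> t < 1 -> 0 <= q t.
  by move=> t0' t1; rewrite -(if_clock0 H); exact: (if_clock_le H).
have qpos (t : R) : 0 < t -> t < 1 -> 0 < q t.
  move=> t0' t1; have t1' : -1 < t by apply: lt_trans t0'; rewrite ltrN10.
  have [||c] := @MVT R q (fun x => alpha_factor x ^+ 2) 0 t t0'.
  - by move=> x; rewrite in_itv/= => x0t; apply: (if_clock H); lra.
  - exact: (if_within_continuous (if_continuousq H)).
  - rewrite (if_clock0 H) !subr0 => _ ->.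
    by rewrite mulr_gt0// exprn_gt0// alpha_factor_gt0.
have G_le (t : R) : t0 <= t -> t < 1 -> G t0 <= G t.
  move=> tt t1; have := le_G t0 t (lexx _) tt t1.
  have := if_clock_le H t00 tt t1; lra.
(* The starting value [q t0] is absorbed into a multiple of [G t], since [G t0 <= G t] beyond
   [t0]. *)
exists (1 + q t0 / G t0); first by rewrite ltr_pwDl// divr_ge0 ?q0 ?(ltW (G0 _ t01)).
near=> t.
have t1 : t < 1 by near: t; exact: nbhs_left_lt.
have tt : t0 <= t by near: t; exact: nbhs_left_ge.
split.
  apply: qpos => //; near: t; apply: nbhs_left_gt; exact: ltr01.
rewrite -/(G t) mulrDl mul1r.
have h1 := le_G t0 t (lexx _) tt t1.
have h2 : q t0 <= q t0 / G t0 * G t.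
  by rewrite mulrAC ler_pdivlMr ?G0// ler_wpM2l ?q0 ?G_le.
have := G0 t0 t01; lra.
Unshelve. all: by end_near.
Qed.

End alpha_factor.

(** * A loop that separates the Cameron-Martin spaces *)

Section power_loop.
Context {R : realType} (n : nat) (b : R) (j0 : 'I_n).
Hypothesis b_gt : 2^-1 < b.
Hypothesis b_lt : b < 1.

Let b0 : 0 < b. Proof. by apply: lt_trans b_gt; rewrite invr_gt0. Qed.

Definition power_profile (t : R) : R := if 0 <= t < 1 then (1 - t) `^ b - (1 - t) else 0.

Lemma is_loop_power : (fun t => power_profile t *: delta_mx 0 j0 : 'rV[R]_n) \in is_loop R n.
Proof.
have cw : {within `[0, 1[, continuous (fun t : R => (1 - t) `^ b - (1 - t))}.
  apply: continuous_in_subspaceT => t; rewrite inE/= in_itv/= => /andP[_ t1].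
  apply: cvgB; first exact: continuous_onem_powR.
  by apply: cvgB; [exact: cvg_cst|exact: cvg_id].
have c1 : (1 - t) `^ b - (1 - t) @[t --> 1^'-] --> (0 : R).
  rewrite -[X in _ --> X]subr0; apply: cvgB; first exact: cvg_onem_powR.
  rewrite -[X in _ --> X](subrr 1); apply: cvgB; first exact: cvg_cst.
  by apply: cvg_at_left_filter; exact: cvg_id.
have := continuous_extend0 cw c1 => c01.
apply/mem_set; split.
- by move=> x; apply: cvgZr_tmp; exact: c01.
- by rewrite /power_profile lexx ltr01 subr0 powR1 subrr scale0r.
- by rewrite /power_profile ltxx andbF scale0r.
- move=> t; rewrite in_itv/= /power_profile => /negbTE t01; rewrite ifF ?scale0r//.
  by apply/negP => /andP[t0 /ltW t1]; rewrite t0 t1 in t01.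
Qed.

Definition power_loop : loopSpace R n := exist (fun f => f \in is_loop R n) _ is_loop_power.

Lemma power_loopE t j : 0 <= t < 1 ->
  val power_loop t 0 j = ((1 - t) `^ b - (1 - t)) * (j == j0)%:R.
Proof. by move=> t01; rewrite /= mxE /power_profile t01 mxE/= eq_sym. Qed.

(** With E = (1 - t)^-1, the derivative of E h along [j0] is (1 - b)(1 - t)^(b - 2) and q' = (1 -
    t)^-2. The energy density is thus (1 - b)^2 (1 - t)^(2b - 2), of which this is an
    antiderivative, bounded because b > 1/2. *)
Let S (t : R) : R := - ((1 - b) ^+ 2 / (2 * b - 1)) * (1 - t) `^ (2 * b - 1).

(* The derivative of the difference of the two sides is a perfect square. *)
Lemma power_increment (a s t : R) : 0 <= s -> s <= t -> t < 1 ->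
  2 * a * ((1 - t) `^ (b - 1) - (1 - s) `^ (b - 1)) <=
  a ^+ 2 * ((1 - t)^-1 - (1 - s)^-1) + (S t - S s).
Proof.
move=> s0 st t1.
pose G r := a ^+ 2 * ((1 - r)^-1 - 1) - 2 * a * (1 - r) `^ (b - 1) + S r.
suff : G s <= G t by rewrite /G; lra.
apply: (@ger0_derive_le _ G (fun r => (a * (1 - r)^-1 - (1 - b) * (1 - r) `^ (b - 1)) ^+ 2) _ _ st)
  => r /andP[sr rt]; last exact: sqr_ge0.
have r1 : r < 1 by exact: le_lt_trans t1.
have r01 : -1 < r < 1 by lra.
have u0 : 1 - r != 0 by rewrite subr_eq0 gt_eqF.
have D1 := is_deriveZ (a ^+ 2) (if_clock classical_integrating_factor r01).
have D2 := is_deriveZ (2 * a) (is_derive_onem_powR (b - 1) r1).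
have D3 := is_deriveZ (- ((1 - b) ^+ 2 / (2 * b - 1))) (is_derive_onem_powR (2 * b - 1) r1).
apply: (is_derive_eq (is_deriveD (is_deriveB D1 D2) D3)); rewrite /GRing.scale/=.
have -> : (1 - r) `^ (b - 1 - 1) = (1 - r) `^ (b - 1) * (1 - r)^-1.
  by rewrite powRD ?u0 ?implybT// powR_inv1// subr_ge0 ltW.
have -> : (1 - r) `^ (2 * b - 1 - 1) = (1 - r) `^ (b - 1) * (1 - r) `^ (b - 1).
  by rewrite -powRD ?u0 ?implybT//; congr (_ `^ _); ring.
move: ((1 - r) `^ (b - 1)) => p; field.
by rewrite u0 gt_eqF//; have := b_gt; lra.
Qed.

(** Along [j0], E h differs from (1 - t)^(b - 1) by a constant; the other coordinates vanish. The
    scalar inequality therefore suffices. *)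
Lemma classical_increment (a : 'I_n -> R) (s t : R) : 0 <= s -> s <= t -> t < 1 ->
  2 * (\sum_j a j * ((1 - t)^-1 * val power_loop t 0 j - (1 - s)^-1 * val power_loop s 0 j)) <=
    (\sum_j a j ^+ 2) * ((1 - t)^-1 - 1 - ((1 - s)^-1 - 1)) + (S t - S s).
Proof.
move=> s0 st t1.
have HE r : 0 <= r < 1 -> (1 - r)^-1 * ((1 - r) `^ b - (1 - r)) = (1 - r) `^ (b - 1) - 1.
  move=> /andP[r0 r1]; have u0 : 1 - r != 0 by rewrite subr_eq0 gt_eqF.
  rewrite mulrBr mulVf// powRD ?u0 ?implybT// powR_inv1 1?mulrC//.
  by rewrite subr_ge0 ltW.
have s01 : 0 <= s < 1 by rewrite s0 (le_lt_trans st).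
have t01 : 0 <= t < 1 by rewrite t1 (le_trans s0).
have -> : \sum_j a j * ((1 - t)^-1 * val power_loop t 0 j - (1 - s)^-1 * val power_loop s 0 j) =
    a j0 * ((1 - t) `^ (b - 1) - (1 - s) `^ (b - 1)).
  rewrite (bigD1 j0)// big1 ?addr0; last first.
    move=> j /andP[_ /negbTE jj]; rewrite !power_loopE// jj.
    by rewrite !mulr0 subrr mulr0.
  rewrite !power_loopE// eqxx !mulr1 !HE// [LHS]addr0.
  by congr (_ * _); ring.
rewrite mulrA; apply: le_trans (power_increment _ s0 st t1) _.
rewrite lerD2r.
have -> : (1 - t)^-1 - 1 - ((1 - s)^-1 - 1) = (1 - t)^-1 - (1 - s)^-1 by ring.
rewrite ler_wpM2r//.
  by rewrite subr_ge0 lef_pV2 ?posrE ?subr_gt0//; lra.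
by rewrite (bigD1 j0)//= lerDl sumr_ge0// => j _; exact: sqr_ge0.
Qed.

Lemma classical_increment_bound t : 0 <= t < 1 -> S t - S 0 <= (1 - b) ^+ 2 / (2 * b - 1).
Proof.
move=> _; rewrite /S subr0 powR1.
have k0 : 0 <= (1 - b) ^+ 2 / (2 * b - 1) by rewrite divr_ge0 ?sqr_ge0//; have := b_gt; lra.
have := mulr_ge0 k0 (powR_ge0 (1 - t) (2 * b - 1)); lra.
Qed.

Lemma power_loop_in_classical_cm (nu : probability (borelType (loopSpace R n)) R) :
  (forall l : {linear loopSpace R n -> R^o}, continuous l ->
    exists s : R, [/\ 0 <= s,
      loop_variance (fun t : R => (1 - t)^-1) (fun t => (1 - t)^-1 - 1) l m @[m --> \oo] --> s ^+ 2 &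
      gaussian nu (l : borelType (loopSpace R n) -> R) s]) ->
  cameron_martin_space nu power_loop.
Proof.
move=> fn; apply: (in_cameron_martin fn) classical_increment classical_increment_bound.
by move=> t /andP[_ t1]; rewrite invr_eq0 subr_eq0 gt_eqF.
Qed.

End power_loop.

Section alpha_bridge.
Context {R : realType} (n : nat) (alpha : R).
Hypothesis alpha_gt1 : 1 < alpha.
Variable q : R -> R.
Hypothesis H : integrating_factor (f_ alpha) (alpha_factor alpha) q.

(** Near 1 the loop is at least (1 - t)^b / 2, while the deviation of [y] is at most a multiple of
    (1 - t)^(alpha / 2), a smaller order because b < alpha / 2. *)
Lemma power_loop_not_in_alpha_cm (b : R) (j0 : 'I_n)
    (mu : probability (borelType (loopSpace R n)) R) :
  (forall t j, 0 <= t < 1 ->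
    gaussian mu (@loop_eval R n t j : borelType (loopSpace R n) -> R)
      (Num.sqrt (q t) / alpha_factor alpha t)) ->
  forall b_gt : 2^-1 < b, b < 1 -> b < alpha / 2 ->
  ~ cameron_martin_space mu (power_loop j0 b_gt).
Proof.
move=> ev b_gt b1 ba; apply: (not_in_cameron_martin ev (j := j0)) => M.
have [C C0 HC] := alpha_variance_le alpha_gt1 H.
have sC0 : 0 < Num.sqrt C by rewrite sqrtr_gt0.
(* Chosen so that |M| times the bound on the deviation stays strictly below (1 - t)^b / 2; adding 1
   to |M| makes it strict and covers [M = 0]. *)
pose e := (2 * (`|M| + 1) * Num.sqrt C)^-1.
have M0 : 0 < `|M| + 1 by rewrite ltr_wpDl.
have e0 : 0 < e by rewrite invr_gt0 !mulr_gt0.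
have h1 : \forall t \near 1^'-, (1 - t) `^ (1 - b) < 2^-1.
  by apply: near_onem_powR; rewrite ?subr_gt0// invr_gt0.
have h2 : \forall t \near 1^'-, (1 - t) `^ (alpha / 2 - b) < e.
  by apply: near_onem_powR; rewrite ?subr_gt0.
have h3 : \forall t \near (1 : R)^'-, 0 <= t < 1.
  near=> t; apply/andP; split; near: t; [exact: nbhs_left_ge|exact: nbhs_left_lt].
have [t [[h1t h2t] [t01 [q0 qC]]]] := filter_ex (filterI (filterI h1 h2) (filterI h3 HC)).
exists t; split => //; first exact: alpha_factor_gt0.
have /andP[t0 t1] := t01.
have u0 : 0 < 1 - t by rewrite subr_gt0.
have un0 : 1 - t != 0 by rewrite gt_eqF.
have P0 : 0 < (1 - t) `^ b by rewrite powR_gt0.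
rewrite power_loopE// eqxx mulr1.
have lo : (1 - t) `^ b / 2 < (1 - t) `^ b - (1 - t).
  have e1 : 1 - t = (1 - t) `^ b * (1 - t) `^ (1 - b).
    by rewrite -powRD ?un0 ?implybT// [b + _]addrC subrK powRr1// ltW.
  have : (1 - t) `^ b * (1 - t) `^ (1 - b) < (1 - t) `^ b / 2 by rewrite ltr_pM2l.
  rewrite -e1; lra.
apply: lt_le_trans (ler_norm _); apply: lt_trans lo.
have sq : Num.sqrt (q t) / alpha_factor alpha t <= Num.sqrt C * ((1 - t) `^ b * e).
  have E0 : 0 < alpha_factor alpha t by exact: alpha_factor_gt0.
  rewrite ler_pdivrMr//.
  apply: (@le_trans _ _ (Num.sqrt (C * (alpha_factor alpha t ^+ 2 * (1 - t) `^ alpha)))).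
    by rewrite ler_sqrt// (le_trans (ltW q0)).
  rewrite sqrtrM ?(ltW C0)// sqrtrM ?sqr_ge0// sqrtr_sqr gtr0_norm//.
  rewrite -(powR12_sqrt (powR_ge0 (1 - t) alpha)) -powRrM.
  rewrite (_ : alpha / 2 = b + (alpha / 2 - b)); last by ring.
  rewrite powRD ?un0 ?implybT// -mulrA ler_pM2l// mulrC ler_pM2r// ler_pM2l//.
  exact: ltW.
apply: (@le_lt_trans _ _ (`|M| * (Num.sqrt C * ((1 - t) `^ b * e)))).
  apply: (@le_trans _ _ (`|M| * (Num.sqrt (q t) / alpha_factor alpha t))).
    by rewrite ler_wpM2r ?ler_norm// divr_ge0 ?sqrtr_ge0// ltW// alpha_factor_gt0.
  by rewrite ler_wpM2l.
rewrite (_ : `|M| * (Num.sqrt C * ((1 - t) `^ b * e)) =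
  (1 - t) `^ b / 2 * (`|M| / (`|M| + 1))); last first.
  by rewrite /e; field; rewrite !gt_eqF.
by rewrite gtr_pMr ?divr_gt0// ltr_pdivrMr// mul1r ltrDl.
Unshelve. all: by end_near.
Qed.

(** The quotient of the two variances at time t is at most C (1 - t)^(alpha - 1) / t, which tends to
    0 as t tends to 1. *)
Lemma alpha_classical_singular (j0 : 'I_n) (mu nu : probability (borelType (loopSpace R n)) R) :
  (forall t j, 0 <= t < 1 ->
    gaussian mu (@loop_eval R n t j : borelType (loopSpace R n) -> R)
      (Num.sqrt (q t) / alpha_factor alpha t)) ->
  (forall t j, 0 <= t < 1 ->
    gaussian nu (@loop_eval R n t j : borelType (loopSpace R n) -> R)
      (Num.sqrt ((1 - t)^-1 - 1) / (1 - t)^-1)) ->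
  mutually_singular mu nu.
Proof.
move=> evmu evnu.
apply: (gaussian_singular (X := fun t : R => @loop_eval R n t j0 : borelType (loopSpace R n) -> R)
  (s1 := fun t => Num.sqrt (q t) / alpha_factor alpha t)
  (s2 := fun t => Num.sqrt ((1 - t)^-1 - 1) / (1 - t)^-1)).
  move=> t; apply: continuous_borel_measurable; exact: loop_eval_continuous.
move=> eps eps0.
have [C C0 HC] := alpha_variance_le alpha_gt1 H.
(* The factor 2 compensates the classical variance t (1 - t), which is at least (1 - t) / 2 for t >=
   1/2. *)
have h1 : \forall t \near 1^'-, (1 - t) `^ (alpha - 1) < eps / (2 * C).
  by apply: near_onem_powR; rewrite ?subr_gt0// divr_gt0// mulr_gt0.
have h3 : \forall t \near (1 : R)^'-, 2^-1 <= t < 1.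
  near=> t; apply/andP; split; near: t; last exact: nbhs_left_lt.
  by apply: nbhs_left_ge; rewrite invf_lt1// ltr1n.
have [t [h1t [/andP[t2 t1] [q0 qC]]]] := filter_ex (filterI h1 (filterI h3 HC)).
have t0 : 0 < t by apply: lt_le_trans t2; rewrite invr_gt0.
have t01 : 0 <= t < 1 by rewrite ltW.
have u0 : 0 < 1 - t by rewrite subr_gt0.
have un0 : 1 - t != 0 by rewrite gt_eqF.
have E0 := alpha_factor_gt0 alpha t.
have q2 : 0 < (1 - t)^-1 - 1.
  by rewrite subr_gt0 invf_gt1// ltrBlDr ltrDl.
exists t; split; [exact: evmu|exact: evnu| |].
  by rewrite divr_gt0 ?sqrtr_gt0// invr_gt0.
rewrite !exprMn !sqr_sqrtr ?(ltW q0) ?(ltW q2)// invrK.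
rewrite exprVn ler_pdivrMr ?exprn_gt0//; apply: le_trans qC _.
rewrite mulrCA mulrC ler_pM2r ?exprn_gt0//.
have -> : (1 - t) `^ alpha = (1 - t) * (1 - t) `^ (alpha - 1).
  by rewrite mulr_powRB1 ?(ltW u0)// (lt_trans ltr01).
have -> : ((1 - t)^-1 - 1) * (1 - t) ^+ 2 = (1 - t) * t by field.
apply: (@le_trans _ _ (C * ((1 - t) * (eps / (2 * C))))).
  by rewrite ler_pM2l// ler_pM2l// ltW.
rewrite (_ : C * ((1 - t) * (eps / (2 * C))) = eps * ((1 - t) * 2^-1)); last first.
  by field; rewrite gt_eqF.
by rewrite ler_pM2l// ler_pM2l.
Unshelve. all: by end_near.
Qed.

End alpha_bridge.

Theorem mainTheorem2 (R : realType) (n : nat) (alpha : R)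
    (d : measure_display) (Omega : measurableType d) (P : probability Omega R)
    (B y : R -> Omega -> 'rV[R]_n)
    (n_ge1 : (1 <= n)%N) (alpha_gt1 : 1 < alpha)
    (B_bm : brownian_motion P B) (y_sde : sde_solution P B (f_ alpha) y) :
  generalised_brownian_bridge P (f_ alpha) (extend_at_1 y) /\
  exists mu : probability (borelType (loopSpace R n)) R,
    [/\ loop_law P (extend_at_1 y) mu, centred_gaussian mu &
        forall nu : probability (borelType (loopSpace R n)) R,
          classical_brownian_bridge_measure nu ->
          [/\ mutually_singular mu nu, centred_gaussian nu &
              cameron_martin_space mu <> cameron_martin_space nu]].
Proof.
have [q H] := alpha_integrating_factor alpha_gt1.
split.
  split.
  - move=> t /andP[t0 t1]; have [t1'|t1'] := boolP (t < 1).
      rewrite (_ : extend_at_1 y t = y t); last by apply/funext => w; rewrite /extend_at_1 t1'.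
      by apply: (sde_measurable y_sde); rewrite t0.
    rewrite (_ : extend_at_1 y t = cst 0); first exact: measurable_cst.
    by apply/funext => w; rewrite /extend_at_1 (negbTE t1').
  - by apply: filterS (sde_start y_sde) => w; rewrite /extend_at_1 ltr01.
  - exact: f_smooth.
  - exact: f_blowup.
  - exists (bridge_kernel (alpha_factor alpha) y_sde); split.
    + exact: (bridge_chapman_kolmogorov B_bm y_sde H n_ge1).
    + exact: (bridge_markov_property B_bm y_sde H n_ge1).
    + exact: (bridge_has_generator B_bm y_sde H n_ge1).
  - exact: (extend_at_1_end B_bm y_sde H (cvg_alpha_factor alpha_gt1)).
have [mu law] := sde_loop_law B_bm y_sde H (cvg_alpha_factor alpha_gt1).
exists mu; split => //; first exact: (loop_law_centred_gaussian B_bm y_sde H n_ge1 law).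
move=> nu [d' [T' [P' [B' [z [B'_bm z_sde lawnu]]]]]].
have Hc := @classical_integrating_factor R.
pose j0 : 'I_n := Ordinal n_ge1.
have evmu := loop_law_eval B_bm y_sde H n_ge1 law.
have evnu := loop_law_eval B'_bm z_sde Hc n_ge1 lawnu.
split; [exact: (alpha_classical_singular alpha_gt1 H j0 evmu evnu)| |].
  exact: (loop_law_centred_gaussian B'_bm z_sde Hc n_ge1 lawnu).
(* The midpoint of the admissible interval, which is nonempty because alpha > 1. *)
pose b : R := (2^-1 + Num.min 1 (alpha / 2)) / 2.
have [m1 m2] : Num.min 1 (alpha / 2) <= 1 /\ Num.min 1 (alpha / 2) <= alpha / 2.
  by rewrite !ge_min !lexx orbT.
have m3 : 2^-1 < Num.min 1 (alpha / 2) by rewrite lt_min invf_lt1// ltr1n ltr_pdivlMr// mulVf.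
have b_gt : 2^-1 < b by rewrite /b; lra.
have b_lt : b < 1 by rewrite /b; lra.
have ba : b < alpha / 2 by rewrite /b; lra.
have := power_loop_not_in_alpha_cm alpha_gt1 H (j0 := j0) evmu (b_gt := b_gt) b_lt ba.
move=> nin cm; apply: nin; rewrite cm; apply: power_loop_in_classical_cm => // l cl.
exact: (loop_law_functional B'_bm z_sde Hc n_ge1 lawnu cl).
Qed.
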